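(* For every $n\ge 1$ and for each of the classes $\Sigma_n^{\mathrm{P}}$ and $\Pi_n^{\mathrm{P}}$ of the polynomial hierarchy, there exists a countable $\omega$-categorical structure $\mathbb{D}$ with a finite relational signature such that $\mathrm{CSP}(\mathbb{D})$ is complete for that class.
   Context: A countable structure is $\omega$-categorical if for every $k\ge1$ only finitely many $k$-ary relations are first-order definable (without parameters) in it. For a structure $\mathbb{D}$ with finite relational signature $\sigma$, $\mathrm{CSP}(\mathbb{D})$ is the decision problem of whether a given finite $\sigma$-structure admits a homomorphism to $\mathbb{D}$. Completeness is with respect to polynomial-time reductions. *)

(* Defs.v *)
From mathcomp Require Import all_boot all_order all_algebra.
From mathcomp Require Import boolp classical_sets functions cardinality.

Set Implicit Arguments.
Unset Strict Implicit.
Unset Printing Implicit Defensive.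

Local Open Scope classical_set_scope.

Definition word := seq bool.

Definition language := set word.

Inductive move := MoveL | MoveN | MoveR.

(* [None] is the blank; [Some (inl b)] is the input/output bit [b]; the symbols
   [Some (inr a)] are the remaining work symbols. *)
Definition symbol (aux : Type) : Type := option (bool + aux).

(* The number of tapes is [tm_k.+1]. *)
Record machine := Machine {
  tm_k : nat;
  tm_aux : finType;
  tm_state : finType;
  tm_start : tm_state;
  tm_halted : pred tm_state;
  tm_trans : tm_state -> {ffun 'I_tm_k.+1 -> symbol tm_aux} ->
             tm_state * {ffun 'I_tm_k.+1 -> symbol tm_aux * move}
}.

(* A tape is infinite in both directions. In [(l, r)], [l] lists the cells left
   of the head, nearest first, and [r] the cells from the head rightwards; all
   cells not listed are blank. *)
Definition tape (aux : Type) : Type := (seq (symbol aux) * seq (symbol aux))%type.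

Definition tape_read aux (t : tape aux) : symbol aux := head None t.2.

Definition tape_act aux (a : symbol aux * move) (t : tape aux) : tape aux :=
  let: (l, r) := (t.1, a.1 :: behead t.2) in
  match a.2 with
  | MoveL => (behead l, head None l :: r)
  | MoveN => (l, r)
  | MoveR => (head None r :: l, behead r)
  end.

Definition config (M : machine) : Type :=
  (tm_state M * {ffun 'I_(tm_k M).+1 -> tape (tm_aux M)})%type.

Definition tm_step (M : machine) (c : config M) : config M :=
  if tm_halted c.1 then c else
  let: (q, act) := tm_trans c.1 [ffun i => tape_read (c.2 i)] in
  (q, [ffun i => tape_act (act i) (c.2 i)]).

Definition bits aux (w : word) : seq (symbol aux) :=
  [seq Some (inl b) | b <- w].

(* The input is on the first tape, the head on its first letter. *)
Definition tm_init (M : machine) (x : word) : config M :=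
  (tm_start M, [ffun i => ([::], if i == ord0 then bits _ x else [::])]).

(* The output is read on the last tape, from the head up to the first blank. *)
Definition tm_output (M : machine) (c : config M) (y : word) : Prop :=
  exists2 rest, (c.2 ord_max).2 = bits _ y ++ rest & head None rest = None.

(* As [tm_step] is the identity on halted configurations, this says that [M]
   halts on [x] after at most [n] steps with output [y]. *)
Definition tm_computes_within (M : machine) (x y : word) (n : nat) : Prop :=
  let c := iter n (@tm_step M) (tm_init M x) in
  tm_halted c.1 /\ tm_output c y.

Definition polytime (f : word -> word) : Prop :=
  exists (M : machine) (p : {poly nat}),
    forall x, tm_computes_within M x (f x) (p.[size x])%R.

Definition in_P (L : language) : Prop :=
  exists2 f : word -> bool, polytime (fun x => [:: f x]) & forall x, L x <-> f x.

(* Double every bit of [u], then write the separator 01, then [v]. *)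
Definition pairing (u v : word) : word :=
  flatten [seq [:: b; b] | b <- u] ++ [:: false; true] ++ v.

(* [alternation true n l V x] is
     exists y1, forall y2, ..., Q yn, V <...<<x, y1>, y2>..., yn>
   with all [yi] ranging over the words of length [l]; for [false] the first
   quantifier is universal. *)
Fixpoint alternation (ex : bool) (n l : nat) (V : language) (w : word) : Prop :=
  if n is n'.+1 then
    if ex then exists y : l.-tuple bool, alternation false n' l V (pairing w y)
    else forall y : l.-tuple bool, alternation true n' l V (pairing w y)
  else V w.

Definition SigmaP (n : nat) (L : language) : Prop :=
  exists (q : {poly nat}) (V : language), in_P V /\
    forall x, L x <-> alternation true n (q.[size x])%R V x.

Definition PiP (n : nat) (L : language) : Prop := SigmaP n (~` L).

Definition polytime_reducible (L1 L2 : language) : Prop :=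
  exists2 f, polytime f & forall x, L1 x <-> L2 (f x).

Definition complete_for (C : language -> Prop) (L : language) : Prop :=
  C L /\ forall L', C L' -> polytime_reducible L' L.

Record signature := Signature {
  nsymb : nat;
  arity : 'I_nsymb -> nat;
  arity_gt0 : forall s, 0 < arity s
}.

Definition structure (sg : signature) (T : Type) : Type :=
  forall s : 'I_(nsymb sg), set ((arity s).-tuple T).

Definition homomorphism (sg : signature) (S T : Type)
    (A : structure sg S) (B : structure sg T) (h : S -> T) : Prop :=
  forall s (t : (arity s).-tuple S), A s t -> B s (map_tuple h t).

(* First-order formulas with equality whose free variables are among [n]
   variables; [FEx] binds variable 0 and shifts the others. *)
Inductive formula (sg : signature) : nat -> Type :=
| FFalse n : formula sg n
| FEq n (i j : 'I_n) : formula sg n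
| FRel n (s : 'I_(nsymb sg)) (t : (arity s).-tuple 'I_n) : formula sg n
| FNot n (phi : formula sg n) : formula sg n
| FAnd n (phi psi : formula sg n) : formula sg n
| FEx n (phi : formula sg n.+1) : formula sg n.

Fixpoint holds (sg : signature) (T : Type) (D : structure sg T) (n : nat)
    (phi : formula sg n) : n.-tuple T -> Prop :=
  match phi in formula _ n return n.-tuple T -> Prop with
  | FFalse _ => fun _ => False
  | FEq _ i j => fun v => tnth v i = tnth v j
  | FRel _ s t => fun v => D s (map_tuple (tnth v) t)
  | FNot _ phi => fun v => ~ holds D phi v
  | FAnd _ phi psi => fun v => holds D phi v /\ holds D psi v
  | FEx _ phi => fun v => exists d : T, holds D phi (cons_tuple d v)
  end.

Definition definable (sg : signature) (T : Type) (D : structure sg T) (k : nat)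
    (R : set (k.-tuple T)) : Prop :=
  exists phi : formula sg k, R = [set v | holds D phi v].

Definition omega_categorical (sg : signature) (T : Type) (D : structure sg T) :
    Prop :=
  countable [set: T] /\
  forall k, 0 < k -> finite_set [set R : set (k.-tuple T) | definable D R].

Definition encode_nat (n : nat) : word := rcons (nseq n true) false.

(* The fact that the tuple [t] belongs to the relation [s]. *)
Definition fact (sg : signature) (m : nat) : Type :=
  {s : 'I_(nsymb sg) & (arity s).-tuple 'I_m}.

Definition encode_fact sg m (a : fact sg m) : word :=
  encode_nat (tag a) ++ flatten [seq encode_nat (i : 'I_m) | i <- tagged a].

(* A finite structure with domain {0, ..., m-1} is written as [m] followed by a
   list of its facts, in any order, all numbers being in unary. *)
Definition encodes sg m (A : structure sg 'I_m) (w : word) : Prop :=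
  exists2 facts : seq (fact sg m),
    w = encode_nat m ++ flatten [seq encode_fact a | a <- facts] &
    forall s (t : (arity s).-tuple 'I_m), A s t <->
      Tagged (fun s : 'I_(nsymb sg) => (arity s).-tuple 'I_m) t \in
        (facts : seq {s : 'I_(nsymb sg) & (arity s).-tuple 'I_m}).

(* Domains are nonempty; up to isomorphism, the finite ones are the 'I_m.+1.
   Words that encode no structure are not in the language. *)
Definition CSP (sg : signature) (T : Type) (D : structure sg T) : language :=
  [set w | exists m (A : structure sg 'I_m.+1),
     encodes A w /\ exists h, homomorphism A D h].

(* Main.v *)
Require Import Defs.
From mathcomp Require Import all_boot all_order all_algebra.
From mathcomp Require Import boolp classical_sets functions cardinality.
From mathcomp Require Import zify.

(* Instances consist of Horn rules [a /\ b -> c] over the elements of a finite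
   structure, some elements being switched on by quantified valuations; an instance
   is good if no contradiction is derivable. Adding facts can only make an instance
   worse, so goodness is inherited along homomorphisms that are injective on the
   instance, and therefore on every clique of an irreflexive link relation. The
   structures all of whose cliques are good form a class with free amalgamation, so
   there is a countable homogeneous one that is universal for the class. It has
   finitely many orbits on k-tuples, and so does its reduct that forgets a unary
   colour. A finite structure maps to the reduct iff, for some colour (which is the
   outermost existential valuation), all its cliques are good; the quantifier over
   cliques merges with the first universal valuation. For NP there is no universal
   quantifier to merge with, and a two-element template is used instead.

   Hardness is a Cook-Levin argument: the run of a deterministic Turing machine is
   the least model of Horn rules with one atom for each time, column and content.
   Columns are counted from the head, so that moving the head shifts the tape.

   Polynomial-time computability is established for machines acting on stacks of
   bits, which find their arguments in the first registers and put the result in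
   the next one; such functions compose and can be iterated. *)

Set Implicit Arguments.
Unset Strict Implicit.
Unset Printing Implicit Defensive.

(** * Stack machines *)

(** The run of the verifier must be forced by the instance and cannot be guessed, since the
    innermost quantifier may be universal. Horn rules force it, and their least model is computable
    in polynomial time, so the same rules serve for membership and for hardness. To pull goodness
    back along a map, a universally quantified valuation of the source is pushed forward; this fails
    if two elements with different values are identified. Linked elements cannot be identified when
    the target has no loops, and this is why only cliques are tested. Cliques also yield the
    amalgamation: in a free amalgam no link joins the two sides, so each clique lies in one of them.
    An existential valuation in front of the quantifier over cliques has to be common to all
    cliques; it is therefore made a predicate of the structures, and forgetting this predicate turns
    it into the choice of an expansion that embeds. Thus $\Pi_n$ uses [n] alternating valuations of
    which the first is universal, and $\Sigma_n$ with $n\ge 2$ uses the colour followed by [n - 1]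
    such valuations. *)

Inductive op := Nop | Push of bool | Pop.

Definition act (o : op) (w : word) : word :=
  match o with Nop => w | Push b => b :: w | Pop => behead w end.

Record sm := SM {
  st : finType;
  st0 : st;
  reg : st -> nat;
  tr : st -> option bool -> option st * op
}.

(** No bound on the registers is carried along; [compile] recovers one from the finite set of
    states. *)
Definition env := nat -> word.

Definition upd (e : env) (r : nat) (w : word) : env :=
  fun i => if i == r then w else e i.

Definition sstep (B : sm) (c : option (st B) * env) : option (st B) * env :=
  if c.1 is Some q then
    let a := tr q (ohead (c.2 (reg q))) in
    (a.1, upd c.2 (reg q) (act a.2 (c.2 (reg q))))
  else c.

Definition runs (B : sm) (e : env) (n : nat) (e' : env) : Prop :=
  exists2 m, m <= n & iter m (@sstep B) (Some (st0 B), e) = (None, e').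

Lemma upd_same e r w : upd e r w r = w.
Proof. by rewrite /upd eqxx. Qed.

Lemma upd_diff e r w i : i != r -> upd e r w i = e i.
Proof. by rewrite /upd => /negbTE ->. Qed.

Lemma upd_id e r : upd e r (e r) = e.
Proof. by apply: funext => i; rewrite /upd; case: eqP => // ->. Qed.

Lemma upd_upd e r w w' : upd (upd e r w) r w' = upd e r w'.
Proof. by apply: funext => i; rewrite /upd; case: eqP. Qed.

Lemma upd_comm e r s w w' : r != s -> upd (upd e r w) s w' = upd (upd e s w') r w.
Proof.
move=> rs; apply: funext => i; rewrite /upd; case: eqP => // ->.
by rewrite eq_sym (negbTE rs).
Qed.

Lemma iter_sstep_none B n e : iter n (@sstep B) (None, e) = (None, e).
Proof. by elim: n => //= n ->. Qed.

Lemma runs_le B e n n' e' : n <= n' -> runs B e n e' -> runs B e n' e'.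
Proof. by move=> nn [m mn H]; exists m => //; apply: leq_trans nn. Qed.

(* [B] runs inside a larger machine [C], its exits being redirected to [k]. *)
Lemma hosted (B C : sm) (i : st B -> st C) (k : option (st C)) :
  (forall q, reg (i q) = reg q) ->
  (forall q h, tr (i q) h =
     (if (tr q h).1 is Some q' then Some (i q') else k, (tr q h).2)) ->
  forall n q e e', iter n (@sstep B) (Some q, e) = (None, e') ->
  exists2 m, m <= n & iter m (@sstep C) (Some (i q), e) = (k, e').
Proof.
move=> Hr Ht; elim=> [|n IH] q e e' //.
rewrite iterSr {2}/sstep /=; case E: (tr q _) => [[q'|] o] /=.
  move=> /IH [m mn Hm]; exists m.+1 => //.
  by rewrite iterSr {2}/sstep /= Hr Ht E.
rewrite iter_sstep_none => -[<-]; exists 1 => //=.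
by rewrite /sstep /= Hr Ht E.
Qed.

Definition instr (r : nat) (o : op) : sm :=
  @SM unit tt (fun _ => r) (fun _ _ => (None, o)).

Lemma runs_instr r o e : runs (instr r o) e 1 (upd e r (act o (e r))).
Proof. by exists 1. Qed.

Definition skipB := instr 0 Nop.

Lemma runs_skip e : runs skipB e 1 e.
Proof. by rewrite -[X in runs _ _ _ X](upd_id e 0); exact: runs_instr. Qed.

Definition seqB (B C : sm) : sm :=
  @SM (st B + st C)%type (inl (st0 B))
    (fun q => match q with inl q => reg q | inr q => reg q end)
    (fun q h => match q with
     | inl q => let a := tr q h in
         (Some (if a.1 is Some q' then inl q' else inr (st0 C)), a.2)
     | inr q => let a := tr q h in (omap inr a.1, a.2)
     end).

Lemma runs_seq B C e1 n1 e2 n2 e3 :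
  runs B e1 n1 e2 -> runs C e2 n2 e3 -> runs (seqB B C) e1 (n1 + n2) e3.
Proof.
move=> [m1 le1 H1] [m2 le2 H2].
have Ht1 q h : tr (inl q : st (seqB B C)) h =
    (if (tr q h).1 is Some q' then Some (inl q') else Some (inr (st0 C)), (tr q h).2).
  by move=> /=; case: (tr q h) => [[]].
have Ht2 q h : tr (inr q : st (seqB B C)) h =
    (if (tr q h).1 is Some q' then Some (inr q') else None, (tr q h).2).
  by move=> /=; case: (tr q h) => [[]].
have [k1 lk1 K1] := @hosted B (seqB B C) inl _ (fun q => erefl) Ht1 _ _ _ _ H1.
have [k2 lk2 K2] := @hosted C (seqB B C) inr _ (fun q => erefl) Ht2 _ _ _ _ H2.
exists (k2 + k1); first by lia.
by rewrite iterD K1.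
Qed.

Definition caseB (r : nat) (Bn Bt Bf : sm) : sm :=
  @SM (option (st Bn + (st Bt + st Bf)))%type None
    (fun q => match q with
     | None => r
     | Some (inl q) => reg q
     | Some (inr (inl q)) => reg q
     | Some (inr (inr q)) => reg q end)
    (fun q h => match q with
     | None => (Some (Some (match h with
         | None => inl (st0 Bn)
         | Some true => inr (inl (st0 Bt))
         | Some false => inr (inr (st0 Bf)) end)), Nop)
     | Some (inl q) => let a := tr q h in (omap (fun q => Some (inl q)) a.1, a.2)
     | Some (inr (inl q)) => let a := tr q h in
         (omap (fun q => Some (inr (inl q))) a.1, a.2)
     | Some (inr (inr q)) => let a := tr q h in
         (omap (fun q => Some (inr (inr q))) a.1, a.2)
     end).

Lemma runs_case r Bn Bt Bf e n e' :
  match e r with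
  | [::] => runs Bn e n e'
  | true :: _ => runs Bt e n e'
  | false :: _ => runs Bf e n e'
  end -> runs (caseB r Bn Bt Bf) e n.+1 e'.
Proof.
set C := caseB _ _ _ _.
suff H B (i : st B -> st C) : (forall q, reg (i q) = reg q) ->
   (forall q h, tr (i q) h = (omap i (tr q h).1, (tr q h).2)) ->
   sstep (Some (st0 C), e) = (Some (i (st0 B)), e) ->
   runs B e n e' -> runs C e n.+1 e'.
  case E: (e r) => [|[] w].
  - by apply: (H Bn (fun q => Some (inl q))) => //; rewrite /sstep /= E /= -E upd_id.
  - by apply: (H Bt (fun q => Some (inr (inl q)))) => //; rewrite /sstep /= E /= -E upd_id.
  - by apply: (H Bf (fun q => Some (inr (inr q)))) => //; rewrite /sstep /= E /= -E upd_id.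
move=> Hr Ht Hs [m le1 H1].
have Ht' q h : tr (i q) h =
    (if (tr q h).1 is Some q' then Some (i q') else None, (tr q h).2).
  by rewrite Ht; case: (tr q h) => [[]].
have [k lk K] := hosted Hr Ht' H1.
exists k.+1; first by lia.
by rewrite iterSr Hs.
Qed.

(* Pop the bits of register [r] one by one, running [Bt] or [Bf] after each. *)
Definition eachB (r : nat) (Bt Bf : sm) : sm :=
  @SM (option (st Bt + st Bf))%type None
    (fun q => match q with
     | None => r
     | Some (inl q) => reg q
     | Some (inr q) => reg q end)
    (fun q h => match q with
     | None => match h with
         | None => (None, Nop)
         | Some true => (Some (Some (inl (st0 Bt))), Pop)
         | Some false => (Some (Some (inr (st0 Bf))), Pop) end
     | Some (inl q) => let a := tr q h in (Some (omap inl a.1), a.2)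
     | Some (inr q) => let a := tr q h in (Some (omap inr a.1), a.2)
     end).

Lemma runs_each_nil r Bt Bf e : e r = [::] -> runs (eachB r Bt Bf) e 1 e.
Proof. by move=> E; exists 1 => //=; rewrite /sstep /= E /= -E upd_id. Qed.

Lemma runs_each_cons r Bt Bf e b w e1 n1 n2 e2 : e r = b :: w ->
  runs (if b then Bt else Bf) (upd e r w) n1 e1 ->
  runs (eachB r Bt Bf) e1 n2 e2 ->
  runs (eachB r Bt Bf) e (1 + n1 + n2) e2.
Proof.
set C := eachB r Bt Bf => E H1 [m2 le2 H2].
suff H B (i : st B -> st C) : (forall q, reg (i q) = reg q) ->
   (forall q h, tr (i q) h = (Some (if (tr q h).1 is Some q' then i q' else st0 C), (tr q h).2)) ->
   sstep (Some (st0 C), e) = (Some (i (st0 B)), upd e r w) ->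
   runs B (upd e r w) n1 e1 -> runs C e (1 + n1 + n2) e2.
  case: b E H1 => E H1.
  - by apply: (H Bt (fun q => Some (inl q)) _ _ _ H1) => //; rewrite /sstep /= E.
  - by apply: (H Bf (fun q => Some (inr q)) _ _ _ H1) => //; rewrite /sstep /= E.
move=> Hr Ht Hs [m le1 K1].
have Ht' q h : tr (i q) h =
    (if (tr q h).1 is Some q' then Some (i q') else Some (st0 C), (tr q h).2).
  by rewrite Ht; case: (tr q h) => [[]].
have [k lk K] := hosted Hr Ht' K1.
exists (m2 + k.+1); first by lia.
by rewrite iterD iterSr Hs K.
Qed.

Definition renB (rho : nat -> nat) (B : sm) : sm :=
  @SM (st B) (st0 B) (fun q => rho (reg q)) (@tr B).

Lemma runs_ren rho B e0 n e1 e : injective rho -> e \o rho = e0 ->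
  runs B e0 n e1 ->
  exists2 e', runs (renB rho B) e n e' &
    e' \o rho = e1 /\ forall i, (forall j, i <> rho j) -> e' i = e i.
Proof.
move=> inj <- [m lm H].
suff {H} sim q : iter m (@sstep B) (Some q, e \o rho) = (None, e1) ->
    exists2 e', iter m (@sstep (renB rho B)) (Some q, e) = (None, e') &
    e' \o rho = e1 /\ forall i, (forall j, i <> rho j) -> e' i = e i.
  by have [e' H1 H2] := sim _ H; exists e' => //; exists m.
clear lm; elim: m q e => [//|m IH] q e.
rewrite 2!iterSr {2 4}/sstep /=; case E: (tr q _) => [q' o] /= H.
pose e2 := upd e (rho (reg q)) (act o (e (rho (reg q)))).
have E2 : upd (e \o rho) (reg q) (act o (e (rho (reg q)))) = e2 \o rho.
  apply: funext => i; rewrite /upd /e2 /= /upd.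
  by rewrite (inj_eq inj).
rewrite E2 in H; rewrite -/e2.
case: q' E H => [q'|] E H.
  have [e' H1 [H2 H3]] := IH _ _ H; exists e' => //; split=> // i Hi.
  by rewrite H3 // /e2 upd_diff //; apply/eqP/Hi.
move: H; rewrite iter_sstep_none => -[H]; exists e2; first exact: (@iter_sstep_none (renB rho B)).
by split=> // i Hi; rewrite /e2 upd_diff //; apply/eqP/Hi.
Qed.

(** * Compilation of stack machines to Turing machines *)

(** The cells left of the head are blank, so a push can move left and write there. The [j] listed
    blanks arise because [tape_act] records visited cells. *)
Definition rep (w : word) (t : tape void) : Prop :=
  all (fun s => ~~ isSome s) t.1 /\ exists j, t.2 = bits _ w ++ nseq j None.

Lemma rep_read w t : rep w t -> tape_read t = omap inl (ohead w).
Proof. by case=> _ [j]; rewrite /tape_read => ->; case: w => //=; case: j. Qed.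

Lemma rep_stay w t : rep w t -> rep w (tape_act (tape_read t, MoveN) t).
Proof.
case: t => l r [/= Hl [j /= ->]]; split=> //=.
case: w => [|b w] /=; last by exists j.
by exists j.-1.+1; case: j.
Qed.

Lemma rep_pop w t : rep w t -> rep (behead w) (tape_act (None, MoveR) t).
Proof.
case: t => l r [/= Hl [j /= ->]]; split=> //=.
by case: w => [|b w] /=; [exists j.-1; case: j | exists j].
Qed.

Lemma rep_push b w t : rep w t ->
  rep (b :: w) (tape_act (Some (inl b), MoveN) (tape_act (tape_read t, MoveL) t)).
Proof.
case: t => l r [/= Hl [j /= ->]]; split=> /=.
  by case: l Hl => //= ? l /andP[].
case: w => [|c w] /=; last by exists j.
by exists j.-1.+1; case: j.
Qed.

Section Compile.
Variable B : sm.

Let K := (\max_(q : st B) reg q).+1.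

(* Register 0 is the first tape and register 1 the last one. *)
Let tau (r : nat) : 'I_K.+1 :=
  inord (if r is r'.+1 then if r' == 0 then K else r' else 0).

Let tau_inj r s : r <= K -> s <= K -> tau r = tau s -> r = s.
Proof.
move=> rK sK /(congr1 val); rewrite /tau /= !inordK.
- by case: r s rK sK => [|[|r]] [|[|s]] //= rK sK; rewrite -?[0 == 0]/true /=; lia.
- by case: s sK => [|[|s]] //=; lia.
- by case: r rK => [|[|r]] //=; lia.
Qed.

Let regK (q : st B) : reg q <= K.
Proof. by rewrite ltnW // ltnS (leq_bigmax q). Qed.

(** A state [inr (q, b, i)] is the middle of a push, the only operation that takes two steps: the
    head of tape [i] has moved left and [b] is still to be written. *)
Let state : finType := (option (st B) + (option (st B) * bool * 'I_K.+1))%type.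

Let trans (s : state) (rd : {ffun 'I_K.+1 -> symbol void}) :
    state * {ffun 'I_K.+1 -> symbol void * move} :=
  match s with
  | inl None => (inl None, [ffun i => (rd i, MoveN)])
  | inl (Some q) =>
      let a := tr q (if rd (tau (reg q)) is Some (inl b) then Some b else None) in
      match a.2 with
      | Nop => (inl a.1, [ffun i => (rd i, MoveN)])
      | Pop => (inl a.1, [ffun i =>
          if i == tau (reg q) then (None, MoveR) else (rd i, MoveN)])
      | Push b => (inr (a.1, b, tau (reg q)), [ffun i =>
          if i == tau (reg q) then (rd i, MoveL) else (rd i, MoveN)])
      end
  | inr (q, b, i0) =>
      (inl q, [ffun i => if i == i0 then (Some (inl b), MoveN) else (rd i, MoveN)])
  end.

Definition compile : machine :=
  @Machine K void state (inl (Some (st0 B)))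
    (fun s => if s is inl None then true else false) trans.

Let sim (c : option (st B) * env) (d : config compile) : Prop :=
  d.1 = inl c.1 /\ forall r, r <= K -> rep (c.2 r) (d.2 (tau r)).

Let sim_step c d : sim c d ->
  exists2 n, n <= 2 & sim (sstep c) (iter n (@tm_step compile) d).
Proof.
case: c d => [[q|] e] [s tp] [/= -> Hrep]; last by exists 0.
have Hrd : (if tape_read (tp (tau (reg q))) is Some (inl b) then Some b else None)
   = ohead (e (reg q)).
  by rewrite (rep_read (Hrep _ (regK q))); case: (e _).
rewrite /sstep /=.
case E: (tr q (ohead (e (reg q)))) => [q' [|b|]] /=.
- exists 1 => //=; rewrite /tm_step /= ffunE Hrd E; split=> //= r rK.
  rewrite !ffunE upd_id; exact/rep_stay/Hrep.
- exists 2 => //=; rewrite /tm_step /= ffunE Hrd E /=; split=> //= r rK.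
  rewrite !ffunE /=; case: eqP => [/tau_inj -> //|ne].
    by rewrite upd_same; exact/rep_push/Hrep.
  rewrite upd_diff; first by apply/rep_stay/rep_stay/Hrep.
  by apply/eqP => rq; apply: ne; rewrite rq.
- exists 1 => //=; rewrite /tm_step /= ffunE Hrd E; split=> //= r rK.
  rewrite !ffunE; case: eqP => [/tau_inj -> //|ne].
    by rewrite upd_same; exact/rep_pop/Hrep.
  rewrite upd_diff; first exact/rep_stay/Hrep.
  by apply/eqP => rq; apply: ne; rewrite rq.
Qed.

Let sim_iter m c d : sim c d ->
  exists2 n, n <= 2 * m & sim (iter m (@sstep B) c) (iter n (@tm_step compile) d).
Proof.
elim: m c d => [|m IH] c d H; first by exists 0.
have [n1 le1 /IH [n2 le2 H2]] := sim_step H.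
by exists (n2 + n1); [lia | rewrite iterSr iterD].
Qed.

Lemma compile_computes x n e' :
  runs B (fun i => if i == 0 then x else [::]) n e' ->
  tm_computes_within compile x (e' 1) (2 * n).
Proof.
case=> m mn H.
have H0 : sim (Some (st0 B), fun i => if i == 0 then x else [::]) (tm_init compile x).
  split=> //= r rK; rewrite ffunE; split=> //=; exists 0; rewrite cats0.
  have -> : (tau r == ord0) = (r == 0).
    apply/eqP/eqP => [|->]; last by apply: val_inj; rewrite /= inordK.
    have -> : ord0 = tau 0 by apply: val_inj; rewrite /= inordK.
    exact: tau_inj.
  by case: (r == 0).
have [k le1] := sim_iter m H0; rewrite H => -[/= H1 H2].
have E : iter (2 * n) (@tm_step compile) (tm_init compile x) =
         iter k (@tm_step compile) (tm_init compile x).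
  rewrite -(subnK (_ : k <= 2 * n)); last by lia.
  rewrite iterD; move: (iter k _ _) H1 => c H1.
  by elim: (_ - _) => //= j ->; rewrite /tm_step H1.
rewrite /tm_computes_within E; split; first by rewrite H1.
have := H2 1 isT; have -> : tau 1 = ord_max by apply: val_inj; rewrite /= inordK.
by case=> _ [j Ej]; exists (nseq j None) => //; case: j {Ej}.
Qed.

End Compile.

Lemma polytime_sm (B : sm) (f : word -> word) (d : nat) :
  (forall x, exists2 e',
     runs B (fun i => if i == 0 then x else [::]) ((size x + 2) ^ d) e' &
     e' 1 = f x) ->
  polytime f.
Proof.
move=> H; exists (compile B), (2%:R *: ('X + 2%:R%:P) ^+ d)%R => x.
have [e' /compile_computes H1 H2] := H x.
move: H1; rewrite H2.
suff -> : ((2%:R *: ('X + 2%:R%:P) ^+ d).[size x])%R = 2 * (size x + 2) ^ d by [].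
rewrite hornerZ horner_exp hornerD hornerX hornerC.
by rewrite -natrXE.
Qed.

(** * Functions computable in polynomial time *)

(** Moving between stacks reverses a word, hence the double moves below. *)
Definition mvB (r s : nat) : sm := eachB r (instr s (Push true)) (instr s (Push false)).
Definition dupB (r s t : nat) : sm :=
  eachB r (seqB (instr s (Push true)) (instr t (Push true)))
          (seqB (instr s (Push false)) (instr t (Push false))).
Definition clearB (r : nat) : sm := eachB r skipB skipB.

Lemma runs_clear r e : runs (clearB r) e (2 * size (e r) + 1) (upd e r [::]).
Proof.
move E: (e r) => w; elim: w e E => [|b w IH] e E.
  by rewrite /= -E !upd_id; exact: (runs_each_nil _ _ E).
have := IH (upd e r w); rewrite upd_same upd_upd => /(_ erefl) H.
apply: runs_le (runs_each_cons E _ H); last by rewrite if_same; exact: runs_skip.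
by rewrite /=; lia.
Qed.

Lemma runs_mv r s e : r != s ->
  runs (mvB r s) e (2 * size (e r) + 1) (upd (upd e r [::]) s (catrev (e r) (e s))).
Proof.
move=> rs; have sr : s != r by rewrite eq_sym.
move E: (e r) => w; elim: w e E => [|b w IH] e E.
  by rewrite /= -E !upd_id; exact: (runs_each_nil _ _ E).
have := IH (upd (upd e r w) s (b :: e s)).
rewrite upd_diff // !upd_same => /(_ erefl).
rewrite (upd_comm _ w _ rs) upd_upd (upd_comm _ _ [::] sr) upd_upd => H.
apply: (@runs_le _ _ (1 + 1 + (2 * size w + 1))); first by rewrite /=; lia.
rewrite (_ : catrev _ _ = catrev w (b :: e s)) //.
apply: runs_each_cons H; first exact: E.
rewrite (_ : (if b then _ else _) = instr s (Push b)); last by case: (b).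
have := runs_instr s (Push b) (upd e r w).
by rewrite /= upd_diff // (upd_comm _ _ _ sr).
Qed.

Lemma runs_dup r s t e : r != s -> r != t -> s != t ->
  runs (dupB r s t) e (3 * size (e r) + 1)
    (upd (upd (upd e r [::]) s (catrev (e r) (e s))) t (catrev (e r) (e t))).
Proof.
move=> rs rt st; have sr : s != r by rewrite eq_sym.
have tr : t != r by rewrite eq_sym. have ts : t != s by rewrite eq_sym.
move E: (e r) => w; elim: w e E => [|b w IH] e E.
  by rewrite /= -E !upd_id; exact: (runs_each_nil _ _ E).
have := IH (upd (upd (upd e r w) s (b :: e s)) t (b :: e t)).
rewrite (upd_diff _ _ rt) (upd_diff _ _ rs) !upd_same (upd_diff _ _ st) upd_same => /(_ erefl).
set e' := upd (upd (upd (upd _ _ _) _ _) _ _) _ _.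
have -> : e' = upd (upd (upd e r [::]) s (catrev w (b :: e s))) t (catrev w (b :: e t)).
  apply: funext => i; rewrite /e' /upd.
  by case: (i =P t) => //; case: (i =P s) => //; case: (i =P r).
move=> H; apply: (@runs_le _ _ (1 + (1 + 1) + (3 * size w + 1))); first by rewrite /=; lia.
apply: runs_each_cons H; first exact: E.
have H1 := runs_instr s (Push b) (upd e r w).
have H2 := runs_instr t (Push b) (upd (upd e r w) s (b :: e s)).
rewrite /= upd_diff // in H1; rewrite /= !upd_diff // in H2.
by case: b H1 H2 {IH E e'} => H1 H2; apply: runs_seq H1 H2.
Qed.

Definition envl (l : seq word) : env := nth [::] l.

Lemma upd_envl l m j v :
  upd (envl (l ++ m)) (size l + j) v = envl (l ++ set_nth [::] m j v).
Proof.
apply: funext => i; rewrite /upd /envl !nth_cat nth_set_nth /=.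
case: ltnP => H; first by rewrite ltn_eqF // ltn_addr.
by rewrite -[in RHS](eqn_add2l (size l)) subnKC.
Qed.

Lemma envl_at l m j : envl (l ++ m) (size l + j) = nth [::] m j.
Proof. by rewrite /envl nth_cat ltnNge leq_addr /= addKn. Qed.

Lemma envl_nil l : envl (rcons l [::]) = envl l.
Proof.
apply: funext => i; rewrite /envl nth_rcons; case: ltnP => // H.
by rewrite nth_default // if_same.
Qed.

Section Poly.
Variable X : Type.
Implicit Types (cs : seq (X -> word)) (g h : X -> nat) (f : X -> word).

Definition vals cs (x : X) : seq word := [seq a x | a <- cs].
Definition csz cs (x : X) : nat := sumn [seq size (a x) | a <- cs].

(** The base is at least 2, so sums and constants are absorbed by a larger exponent and no explicit
    polynomial is needed. *)
Definition PB cs g : Prop := exists d, forall x, g x <= (csz cs x + 2) ^ d.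

Lemma PB_le cs g h : (forall x, g x <= h x) -> PB cs h -> PB cs g.
Proof. by move=> H [d Hd]; exists d => x; apply: leq_trans (H x) (Hd x). Qed.

Lemma PB_const cs n : PB cs (fun=> n).
Proof.
exists n => x; apply: leq_trans (ltnW (ltn_expl n (isT : 1 < 2))) _.
by case: n => // n; rewrite leq_exp2r ?leq_addl.
Qed.

Lemma expn_bound (a b c : nat) : 1 < a -> a ^ b + a ^ c <= a ^ (b + c).+1.
Proof.
move=> a1; rewrite expnS expnD.
have H1 : 0 < a ^ b by rewrite expn_gt0; lia.
have H2 : 0 < a ^ c by rewrite expn_gt0; lia.
move: (a ^ b) (a ^ c) H1 H2 => u v u0 v0.
apply: (@leq_trans (2 * (u * v))); last by rewrite leq_mul2r a1 orbT.
by rewrite mul2n -addnn leq_add // ?leq_pmulr ?leq_pmull.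
Qed.

Lemma PB_add cs g h : PB cs g -> PB cs h -> PB cs (fun x => g x + h x).
Proof.
move=> [b Hb] [c Hc]; exists (b + c).+1 => x.
by apply: leq_trans (leq_add (Hb x) (Hc x)) _; apply: expn_bound; lia.
Qed.

Lemma PB_mul cs g h : PB cs g -> PB cs h -> PB cs (fun x => g x * h x).
Proof.
by move=> [b Hb] [c Hc]; exists (b + c) => x; rewrite expnD leq_mul.
Qed.

Lemma PB_exp cs g d : PB cs g -> PB cs (fun x => g x ^ d).
Proof.
move=> H; elim: d => [|d IH]; first exact: (PB_const _ 1).
by apply: PB_le (PB_mul H IH) => x; rewrite expnS.
Qed.

Lemma PB_csz cs : PB cs (csz cs).
Proof. by exists 1 => x; rewrite expn1 leq_addr. Qed.

(* The program finds the values of [cs] in the first registers, all the others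
   being empty, and leaves them there with [f] in the next register. *)
Definition PF cs f : Prop :=
  PB cs (fun x => size (f x)) /\
  exists (B : sm) (T : X -> nat), PB cs T /\
    forall x, runs B (envl (vals cs x)) (T x) (envl (rcons (vals cs x) (f x))).

End Poly.

Lemma PB_comp X Z (cs : seq (X -> word)) (cs' : seq (Z -> word)) (r : Z -> X)
    (g : X -> nat) (G : Z -> nat) :
  PB cs g -> PB cs' G -> (forall z, csz cs (r z) <= G z) ->
  PB cs' (fun z => g (r z)).
Proof.
move=> [d Hd] HG le.
apply: (@PB_le _ _ _ (fun z => (G z + 2) ^ d)).
  by move=> z; apply: leq_trans (Hd _) _; case: (d) => // d'; rewrite leq_exp2r // leq_add2r.
by apply: PB_exp; apply: PB_add HG (PB_const _ _).
Qed.

Definition nilf {X : Type} : X -> word := fun=> [::].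

Lemma nth_vals X (cs : seq (X -> word)) x i :
  nth [::] (vals cs x) i = nth nilf cs i x.
Proof.
case: (ltnP i (size cs)) => H; first by rewrite (nth_map nilf).
by rewrite !nth_default ?size_map.
Qed.

Lemma csz_nth X (cs : seq (X -> word)) x i : size (nth nilf cs i x) <= csz cs x.
Proof.
elim: cs i => [|c cs IH] [|i] //=; first by rewrite leq_addr.
by apply: leq_trans (IH i) _; rewrite leq_addl.
Qed.

Lemma csz_bound X (cs : seq (X -> word)) x M :
  (forall i, i < size cs -> size (nth nilf cs i x) <= M) -> csz cs x <= size cs * M.
Proof.
elim: cs => [|c cs IH] H //=; rewrite /csz /= mulSn leq_add //; first exact: (H 0).
by apply: IH => i Hi; exact: (H i.+1).
Qed.

Lemma PF_ext X (cs : seq (X -> word)) f f' : f =1 f' -> PF cs f -> PF cs f'.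
Proof. by move=> /funext ->. Qed.

(** Covers every change of context: argument register [i] of the old program becomes register
    [nth 0 js i], and its output and work registers are shifted past [ds]. The map [g] lets the type
    of the data change as well. *)
Lemma PF_ren X Z (cs : seq (X -> word)) (ds : seq (Z -> word)) (g : Z -> X) f
    (js : seq nat) :
  uniq js -> all (fun j => j < size ds) js -> size js = size cs ->
  (forall i z, i < size cs -> nth nilf cs i (g z) = nth nilf ds (nth 0 js i) z) ->
  PF cs f -> PF ds (fun z => f (g z)).
Proof.
move=> Ju Jds Jsz Hj [Hs [B [T [HT HB]]]].
have Hc z : csz cs (g z) <= size cs * csz ds z.
  by apply: csz_bound => i Hi; rewrite Hj //; exact: csz_nth.
have PBc h : PB cs h -> PB ds (fun z => h (g z)).
  by move=> Hh; apply: PB_comp Hh _ Hc; apply: PB_mul (PB_const _ _) (PB_csz _).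
split; first exact: PBc Hs.
pose k := size cs; pose rho i := if i < k then nth 0 js i else i - k + size ds.
have Jlt i : i < k -> nth 0 js i < size ds.
  by move=> Hi; apply: (allP Jds); rewrite mem_nth // Jsz.
have inj : injective rho.
  move=> i j; rewrite /rho; case: ltnP => Hi; case: ltnP => Hj'.
  - by move/eqP; rewrite nth_uniq ?Jsz // => /eqP.
  - by have := Jlt i Hi; lia.
  - by have := Jlt j Hj'; lia.
  - by lia.
exists (renB rho B), (fun z => T (g z)); split; first exact: PBc.
move=> z.
have E0 : envl (vals ds z) \o rho = envl (vals cs (g z)).
  apply: funext => i; rewrite /= /envl !nth_vals /rho; case: ltnP => Hi.
    by rewrite Hj.
  by rewrite !nth_default // leq_addl.
have [e' H1 [H2 H3]] := runs_ren inj E0 (HB (g z)).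
suff <- : e' = envl (rcons (vals ds z) (f (g z))) by [].
apply: funext => i; case: (pselect (exists j, i = rho j)) => [[j ->]|Hi].
  have /= -> := congr1 (fun e : env => e j) H2.
  rewrite /envl !nth_rcons !size_map !nth_vals /rho -/k.
  case: ltnP => jk; first by rewrite Jlt // Hj.
  rewrite (_ : (j - k + size ds < size ds) = false); last by lia.
  by rewrite (_ : (j - k + size ds == size ds) = (j == k)); last by lia.
rewrite H3; last by move=> j Ej; apply: Hi; exists j.
rewrite /envl nth_rcons !nth_vals size_map; case: ltnP => Hi2 //.
case: eqP => [E|_]; last by rewrite nth_default.
by exfalso; apply: Hi; exists k; rewrite /rho ltnn subnn.
Qed.

Definition wk X Z (g : Z -> X) (cs : seq (X -> word)) : seq (Z -> word) :=
  [seq (fun z => a (g z)) | a <- cs].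

Lemma PF_weak X Z (cs : seq (X -> word)) (ds : seq (Z -> word)) (g : Z -> X) f :
  PF cs f -> PF (wk g cs ++ ds) (fun z => f (g z)).
Proof.
apply: (@PF_ren _ _ _ _ _ _ (iota 0 (size cs))); rewrite ?iota_uniq ?size_iota //.
  by apply/allP => i; rewrite mem_iota size_cat size_map => /andP[_ ?]; rewrite ltn_addr.
by move=> i z Hi; rewrite nth_iota // nth_cat size_map Hi (nth_map nilf).
Qed.

Lemma PF_var X (cs : seq (X -> word)) i : i < size cs -> PF cs (nth nilf cs i).
Proof.
move=> Hi; split; first by exists 1 => x; rewrite expn1; apply: leq_trans (csz_nth _ _ _) _; rewrite leq_addr.
pose k := size cs.
(* The word is reversed into [k.+1] and then copied back in its original order, both to [i] and to
   the output register [k]. *)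
exists (seqB (mvB i k.+1) (dupB k.+1 i k)), (fun x => 5 * csz cs x + 2); split.
  by apply: PB_add (PB_const _ _); apply: PB_mul (PB_const _ _) (PB_csz _).
move=> x; pose w := nth nilf cs i x.
have E : envl (vals cs x) i = w by rewrite /envl nth_vals.
have i1 : i != k.+1 by apply/eqP; lia.
have := runs_mv (envl (vals cs x)) i1; rewrite E.
have -> : envl (vals cs x) k.+1 = [::] by rewrite /envl nth_default ?size_map.
set e1 := upd _ _ _ => H1.
have k1 : k.+1 != i by apply/eqP; lia.
have k2 : k.+1 != k by apply/eqP; lia.
have k3 : i != k by apply/eqP; lia.
have := runs_dup e1 k1 k2 k3.
have -> : e1 k.+1 = rev w by rewrite /e1 upd_same.
have -> : e1 i = [::] by rewrite /e1 upd_diff // upd_same.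
have -> : e1 k = [::].
  by rewrite /e1 !upd_diff ?(eq_sym k) // /envl nth_default ?size_map.
rewrite -/(rev (rev w)) revK size_rev => H2.
have Hw : size w <= csz cs x by exact: csz_nth.
set e2 := upd _ _ _ in H2.
suff <- : e2 = envl (rcons (vals cs x) w).
  by apply: runs_le (runs_seq H1 H2); lia.
apply: funext => j; rewrite /e2 /e1 /upd /envl nth_rcons size_map -/k nth_vals.
case: (ltngtP j k) => jk //.
  by case: eqP => [->//|_]; rewrite ltn_eqF // ltnW.
case: eqP => [|_]; first by lia.
by case: eqP => // jk1; rewrite nth_default // ltnW.
Qed.

Section Prim.
Variable X : Type.
Implicit Types (cs : seq (X -> word)) (f : X -> word).

Lemma PF_nil cs : PF cs (fun=> [::]).
Proof.
split; first exact: PB_const.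
exists skipB, (fun=> 1); split; first exact: PB_const.
by move=> x; rewrite envl_nil; exact: runs_skip.
Qed.

Lemma PF_instr cs f o (h : word -> word) : (forall w, act o w = h w) ->
  (forall w, size (h w) <= (size w).+1) ->
  PF cs f -> PF cs (fun x => h (f x)).
Proof.
move=> Ho Hh [Hs [B [T [HT HB]]]]; split.
  by apply: PB_le (PB_add Hs (PB_const _ 1)) => x; rewrite addn1.
exists (seqB B (instr (size cs) o)), (fun x => T x + 1); split.
  exact: PB_add HT (PB_const _ _).
move=> x; have H := runs_instr (size cs) o (envl (rcons (vals cs x) (f x))).
have sz : size cs = size (vals cs x) + 0 by rewrite addn0 size_map.
move: H; rewrite {2 3}sz -{2 3}cats1 envl_at upd_envl /= Ho cats1 => H.
exact: runs_seq (HB x) H.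
Qed.

Lemma PF_cons cs b f : PF cs f -> PF cs (fun x => b :: f x).
Proof. by apply: (@PF_instr cs f (Push b)). Qed.

Lemma PF_behead cs f : PF cs f -> PF cs (fun x => behead (f x)).
Proof. by apply: (@PF_instr cs f Pop behead) => // w; rewrite size_behead; lia. Qed.

Lemma PF_const cs w : PF cs (fun=> w).
Proof. by elim: w => [|b w IH]; [exact: PF_nil | exact: PF_cons]. Qed.

Lemma PF_case cs f fn ft ff : PF cs f -> PF cs fn -> PF cs ft -> PF cs ff ->
  PF cs (fun x => match f x with
                  | [::] => fn x | true :: _ => ft x | false :: _ => ff x end).
Proof.
move=> [S0 [B0 [T0 [P0 H0]]]] [S1 [B1 [T1 [P1 H1]]]] [S2 [B2 [T2 [P2 H2]]]] [S3 [B3 [T3 [P3 H3]]]].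
split.
  apply: PB_le (PB_add S1 (PB_add S2 S3)) => x.
  by case: (f x) => [|[] ?]; lia.
pose C := clearB (size cs).
exists (seqB B0 (caseB (size cs) (seqB C B1) (seqB C B2) (seqB C B3))).
exists (fun x => T0 x + (2 * size (f x) + 1 + (T1 x + (T2 x + T3 x)) + 1)); split.
  apply: PB_add P0 (PB_add (PB_add _ (PB_add P1 (PB_add P2 P3))) (PB_const _ _)).
  exact: PB_add (PB_mul (PB_const _ _) S0) (PB_const _ _).
move=> x; apply: runs_seq (H0 x) _.
rewrite addn1; apply: runs_case.
have sz : size cs = size (vals cs x) + 0 by rewrite addn0 size_map.
have E : envl (rcons (vals cs x) (f x)) (size cs) = f x.
  by rewrite {1}sz -cats1 envl_at.
rewrite E.
have HC := runs_clear (size cs) (envl (rcons (vals cs x) (f x))).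
rewrite E {2}sz -{2}cats1 upd_envl /= cats1 envl_nil in HC.
case Ef: (f x) => [|[] w]; rewrite -Ef.
- by apply: runs_le (runs_seq HC (H1 x)); lia.
- by apply: runs_le (runs_seq HC (H2 x)); lia.
- by apply: runs_le (runs_seq HC (H3 x)); lia.
Qed.

End Prim.

(** * Bounded recursion on words and on unary numbers *)

Lemma frame_mv l m i j : i != j ->
  runs (mvB (size l + i) (size l + j)) (envl (l ++ m))
    (2 * size (nth [::] m i) + 1)
    (envl (l ++ set_nth [::] (set_nth [::] m i [::]) j
                  (catrev (nth [::] m i) (nth [::] m j)))).
Proof.
move=> ij; have := @runs_mv (size l + i) (size l + j) (envl (l ++ m)).
by rewrite eqn_add2l => /(_ ij); rewrite !envl_at !upd_envl.
Qed.

Lemma frame_clear l m i :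
  runs (clearB (size l + i)) (envl (l ++ m)) (2 * size (nth [::] m i) + 1)
    (envl (l ++ set_nth [::] m i [::])).
Proof. by have := runs_clear (size l + i) (envl (l ++ m)); rewrite !envl_at !upd_envl. Qed.

Lemma frame_push l m i b :
  runs (instr (size l + i) (Push b)) (envl (l ++ m)) 1
    (envl (l ++ set_nth [::] m i (b :: nth [::] m i))).
Proof.
by have := runs_instr (size l + i) (Push b) (envl (l ++ m)); rewrite !envl_at !upd_envl.
Qed.

Lemma envl_cat_nil l m : envl (l ++ rcons m [::]) = envl (l ++ m).
Proof. by rewrite -rcons_cat envl_nil. Qed.

Lemma csz_wk X Z (g : Z -> X) cs ds z :
  csz (wk g cs ++ ds) z = csz cs (g z) + csz ds z.
Proof. by rewrite /csz map_cat sumn_cat /wk -map_comp. Qed.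

Lemma vals_wk X Z (g : Z -> X) cs ds z :
  vals (wk g cs ++ ds) z = vals cs (g z) ++ vals ds z.
Proof. by rewrite /vals map_cat /wk -map_comp. Qed.

(* Recursion on a word [u]: [F x p s] is the value at the suffix [s] of [u], and [p]
   is the prefix before it, reversed. The body runs on [p], the first letter of the
   suffix, its tail, and the value at the tail; [Z] is the type of these data. *)
Section Loop.
Variables (X Z : Type) (cs : seq (X -> word)) (g : Z -> X).
Variables (u : X -> word) (F : X -> word -> word -> word).
Variables (pre bit rest acc body : Z -> word) (bound : X -> nat).

Hypothesis PFu : PF cs u.
Hypothesis PFinit : PF cs (fun x => F x (rev (u x)) [::]).
Hypothesis PFbody : PF (wk g cs ++ [:: pre; bit; rest; acc]) body.
Hypothesis stepF : forall x p b s, catrev p (b :: s) = u x ->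
  exists z, g z = x /\ [/\ pre z = p, bit z = [:: b], rest z = s,
    acc z = F x (b :: p) s & body z = F x p (b :: s)].
Hypothesis PBbound : PB cs bound.
Hypothesis Fbound : forall x p s, catrev p s = u x -> size (F x p s) <= bound x.

Let k := size cs.

(** Registers [k] to [k + 3] hold the reversed prefix, the current letter, the suffix and the value
    at the suffix. The new value, which [B] leaves in [k + 4], passes through [k + 5] to keep its
    order. *)
Let loop_body (B : sm) (b : bool) : sm :=
  seqB (instr (k + 1) (Push b)) (seqB B (seqB (clearB (k + 3))
   (seqB (mvB (k + 4) (k + 5)) (seqB (mvB (k + 5) (k + 3))
   (seqB (clearB (k + 1)) (instr (k + 2) (Push b))))))).

Let run_loop_body B l p b s a new n M : size l = k ->
  runs B (envl (l ++ [:: p; [:: b]; s; a])) n (envl (l ++ [:: p; [:: b]; s; a; new])) ->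
  size a <= M -> size new <= M ->
  runs (loop_body B b) (envl (l ++ [:: p; [::]; s; a])) (n + 6 * M + 10)
    (envl (l ++ [:: p; [::]; b :: s; new])).
Proof.
move=> lk HB aM nM; rewrite /loop_body -lk.
have H1 := frame_push l [:: p; [::]; s; a] 1 b; rewrite /= in H1.
have H2 := frame_clear l [:: p; [:: b]; s; a; new] 3; rewrite /= in H2.
have H3 := @frame_mv l [:: p; [:: b]; s; [::]; new] 4 5 isT; rewrite /= in H3.
have H4 := @frame_mv l [:: p; [:: b]; s; [::]; [::]; rev new] 5 3 isT; rewrite /= in H4.
rewrite -/(rev (rev new)) revK size_rev in H4.
have H5 := frame_clear l [:: p; [:: b]; s; new; [::]; [::]] 1; rewrite /= in H5.
rewrite (envl_cat_nil l [:: p; [::]; _; _; _]) (envl_cat_nil l [:: p; [::]; _; _]) in H5.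
have H6 := frame_push l [:: p; [::]; s; new] 2 b; rewrite /= in H6.
apply: runs_le (runs_seq H1 (runs_seq HB (runs_seq H2 (runs_seq H3
  (runs_seq H4 (runs_seq H5 H6)))))).
lia.
Qed.

(** Cobham's bounded recursion on notation: the bound on [F], given in advance, keeps the input of
    every call of the body polynomial in size, however many iterations precede it. *)
Lemma PF_loop : PF cs (fun x => F x [::] (u x)).
Proof.
have Fb0 x : size (F x [::] (u x)) <= bound x by apply: Fbound.
split; first exact: PB_le Fb0 PBbound.
have [Su [Bu [Tu [PTu Hu]]]] := PFu.
have [Si [Bi [Ti [PTi Hi]]]] :=
  @PF_weak _ _ _ [:: (fun x => rev (u x)); nilf; nilf] id _ PFinit.
have [Sb [Bb [Tb [[d Hd] Hb]]]] := PFbody.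
pose G x := csz cs x + (size (u x) + (size (u x) + (1 + bound x))).
pose It x := (G x + 2) ^ d + 6 * bound x + 10.
pose body_run x b p s n := runs (loop_body Bb b)
   (envl (vals cs x ++ [:: p; [::]; s; F x (b :: p) s])) n
   (envl (vals cs x ++ [:: p; [::]; b :: s; F x p (b :: s)])).
have Hbody x b p s : catrev p (b :: s) = u x -> body_run x b p s (It x).
  move=> E; have [z [gz [Ep Eb Es Ea Eo]]] := stepF E.
  apply: run_loop_body; first by rewrite size_map.
  - have := Hb z; rewrite vals_wk -cats1 -catA /=.
    rewrite gz Ep Eb Es Ea Eo; apply: runs_le.
    apply: leq_trans (Hd z) _; case: (d) => // d'; rewrite leq_exp2r // leq_add2r.
    have Esz := congr1 size E; rewrite catrevE size_cat size_rev /= in Esz.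
    have := Fbound (E : catrev (b :: p) s = u x) => Hs.
    rewrite csz_wk gz /csz /= Ep Eb Es Ea -/(csz cs x) /G /=; lia.
  - exact: Fbound.
  - exact: Fbound.
have Hloop x p s : catrev p s = u x ->
   runs (eachB k (loop_body Bb true) (loop_body Bb false))
   (envl (vals cs x ++ [:: p; [::]; s; F x p s])) (size p * (1 + It x) + 1)
   (envl (vals cs x ++ [:: [::]; [::]; u x; F x [::] (u x)])).
  have kE : k = size (vals cs x) + 0 by rewrite addn0 size_map.
  elim: p s => [|b p IH] s E.
    rewrite -E /=; apply: runs_each_nil.
    by rewrite kE envl_at.
  have H := Hbody x b p s E.
  apply: (@runs_le _ _ (1 + It x + (size p * (1 + It x) + 1))); first by rewrite /=; lia.
  apply: (runs_each_cons (b := b) (w := p)); last exact: (IH (b :: s) E).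
    by rewrite kE envl_at.
  by rewrite kE upd_envl /=; case: (b) H.
have sk x : k = size (vals cs x) by rewrite size_map.
(* The word [u] has to be reversed within its own register [k], which takes three moves; the loop
   then pops its last letter first. *)
exists (seqB Bu (seqB (mvB (k + 0) (k + 2)) (seqB (mvB (k + 2) (k + 1))
  (seqB (mvB (k + 1) (k + 0)) (seqB Bi
  (seqB (eachB k (loop_body Bb true) (loop_body Bb false))
  (seqB (clearB (k + 2)) (seqB (mvB (k + 3) (k + 4)) (mvB (k + 4) (k + 0)))))))))).
exists (fun x => Tu x + ((2 * size (u x) + 1) + ((2 * size (u x) + 1) +
  ((2 * size (u x) + 1) + (Ti x + (size (u x) * (1 + It x) + 1 +
  ((2 * size (u x) + 1) + ((2 * bound x + 1) + (2 * bound x + 1))))))))).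
have PTi' : PB cs Ti.
  apply: (@PB_comp _ _ _ cs id _ (fun x => csz cs x + size (u x)) PTi).
    exact: PB_add (PB_csz _) Su.
  by move=> x; rewrite csz_wk {2}/csz /= size_rev; lia.
have P1 : PB cs (fun=> 1) by exact: PB_const.
have PM n h : PB cs h -> PB cs (fun x => n * h x) by apply: PB_mul; exact: PB_const.
have PG : PB cs G by apply: PB_add (PB_csz _) (PB_add Su (PB_add Su (PB_add P1 PBbound))).
have PIt : PB cs It.
  apply: PB_add (PB_const _ _); apply: PB_add (PM _ _ PBbound).
  by apply: PB_exp; apply: PB_add PG (PB_const _ _).
have P2u := PB_add (PM 2 _ Su) P1.
have P2b := PB_add (PM 2 _ PBbound) P1.
split.
  apply: PB_add PTu (PB_add P2u (PB_add P2u (PB_add P2u (PB_add PTi' (PB_add _ (PB_add P2u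
    (PB_add P2b P2b))))))).
  exact: PB_add (PB_mul Su (PB_add P1 PIt)) P1.
move=> x; apply: runs_seq (Hu x) _; rewrite -cats1.
pose l := vals cs x.
have H1 := @frame_mv l [:: u x] 0 2 isT; rewrite -(sk x) /= in H1.
have H2 := @frame_mv l [:: [::]; [::]; rev (u x)] 2 1 isT; rewrite -(sk x) /= in H2.
rewrite size_rev -/(rev (rev (u x))) revK in H2.
have H3 := @frame_mv l [:: [::]; u x; [::]] 1 0 isT; rewrite -(sk x) /= in H3.
apply: runs_seq H1 _; apply: runs_seq H2 _; apply: runs_seq H3 _.
have := Hi x; rewrite vals_wk -cats1 -catA /= => H4.
apply: runs_seq H4 _.
have E0 : catrev (rev (u x)) [::] = u x by exact: revK.
have H5 := Hloop x _ _ E0; rewrite size_rev in H5.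
apply: runs_seq H5 _.
have H6 := frame_clear l [:: [::]; [::]; u x; F x [::] (u x)] 2; rewrite -(sk x) /= in H6.
apply: runs_seq H6 _.
have H7 := @frame_mv l [:: [::]; [::]; [::]; F x [::] (u x)] 3 4 isT; rewrite -(sk x) /= in H7.
have H8 := @frame_mv l [:: [::]; [::]; [::]; [::]; rev (F x [::] (u x))] 4 0 isT.
rewrite -(sk x) /= size_rev -/(rev (rev (F x [::] (u x)))) revK in H8.
rewrite !(envl_cat_nil l [:: _; _; _; _]) !(envl_cat_nil l [:: _; _; _]) in H8.
rewrite !(envl_cat_nil l [:: _; _]) !(envl_cat_nil l [:: _]) in H8.
by rewrite -cats1; apply: runs_le (runs_seq H7 H8); have := Fb0 x; lia.
Qed.

End Loop.

(* Numbers are computed in unary. *)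
Definition wn (n : nat) : word := nseq n true.
Definition wb (b : bool) : word := [:: b].

Lemma PF_polytime f : PF [:: id] f -> polytime f.
Proof.
case=> _ [B [T [[d Hd] HB]]]; apply: (@polytime_sm B f d) => x.
exists (envl [:: x; f x]) => //.
rewrite (_ : (fun i => _) = envl [:: x]); last by apply: funext => -[|[|i]].
by apply: runs_le (HB x); apply: leq_trans (Hd x) _; rewrite /csz /= addn0.
Qed.

Lemma PF_new X Z (g : Z -> X) cs ds j : j < size ds ->
  PF (wk g cs ++ ds) (nth nilf ds j).
Proof.
move=> jd; have H : size cs + j < size (wk g cs ++ ds).
  by rewrite size_cat size_map ltn_add2l.
by have := PF_var H; rewrite nth_cat size_map ltnNge leq_addr /= addKn.
Qed.

Lemma PF_cat_ctx X (cs ds : seq (X -> word)) f : PF cs f -> PF (cs ++ ds) f.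
Proof.
apply: (@PF_ren _ _ _ _ id _ (iota 0 (size cs))); rewrite ?iota_uniq ?size_iota //.
  by apply/allP => i; rewrite mem_iota size_cat => /andP[_ ?]; rewrite ltn_addr.
by move=> i z Hi; rewrite nth_iota // nth_cat Hi.
Qed.

Definition zip_ctx X cs (F : X -> word -> word -> word) :
    seq (X * (word * bool * word) -> word) :=
  wk fst cs ++ [:: (fun z => z.2.1.1); (fun z => wb z.2.1.2); (fun z => z.2.2);
    (fun z => F z.1 (z.2.1.2 :: z.2.1.1) z.2.2)].

Lemma PF_word X (cs : seq (X -> word)) u F bound :
  PF cs u -> PF cs (fun x => F x (rev (u x)) [::]) ->
  PF (zip_ctx cs F) (fun z => F z.1 z.2.1.1 (z.2.1.2 :: z.2.2)) ->
  PB cs bound ->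
  (forall x p s, catrev p s = u x -> size (F x p s) <= bound x) ->
  PF cs (fun x => F x [::] (u x)).
Proof.
move=> Pu P0 PS Pb Hb; apply: PF_loop PS _ Pb Hb => // x p b s _.
by exists (x, (p, b, s)).
Qed.

Lemma all_true_wn (s : word) : all id s -> s = wn (size s).
Proof. by elim: s => //= -[] s IH //= /IH <-. Qed.

Definition nat_ctx X (cs : seq (X -> word)) : seq (X * nat -> word) :=
  wk fst cs ++ [:: (fun z => wn z.2)].

Definition rec_ctx X cs (F : X -> nat -> word) : seq (X * nat -> word) :=
  wk fst cs ++ [:: (fun z => wn z.2); (fun z => F z.1 z.2)].

(** A loop over the word [wn (n x)]. Prefix and suffix of a unary word are determined by their
    lengths, so the body needs only the counter and the accumulator. *)
Lemma PF_nrec X (cs : seq (X -> word)) n (F : X -> nat -> word) bound :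
  PF cs (fun x => wn (n x)) -> PF cs (fun x => F x 0) ->
  PF (rec_ctx cs F) (fun z => F z.1 z.2.+1) ->
  PB cs bound -> (forall x i, i <= n x -> size (F x i) <= bound x) ->
  PF cs (fun x => F x (n x)).
Proof.
move=> Pn P0 PS Pb Hb.
pose ds : seq (X * nat -> word) := wk fst cs ++ [:: (fun z => wn (n z.1 - z.2.+1));
  (fun z => [:: true]); (fun z => wn z.2); (fun z => F z.1 z.2)].
have PS' : PF ds (fun z => F z.1 z.2.+1).
  apply: (@PF_ren _ _ _ _ id _ (rcons (rcons (iota 0 (size cs)) (size cs + 2)) (size cs + 3))) PS.
  - by rewrite !rcons_uniq iota_uniq mem_rcons inE !mem_iota; lia.
  - rewrite !all_rcons !size_cat size_map /= !ltn_add2l /=.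
    by apply/allP => i; rewrite mem_iota => /andP[_ ?]; rewrite ltn_addr.
  - by rewrite !size_rcons size_iota size_cat size_map addn2.
  - move=> i z; rewrite size_cat size_map /= => Hi.
    have [H1|[->|->]] : i < size cs \/ i = size cs \/ i = (size cs).+1 by lia.
    - rewrite !nth_rcons !size_rcons !size_iota H1 ltnW // nth_iota // add0n.
      by rewrite !nth_cat !size_map H1.
    - rewrite !nth_rcons !size_rcons !size_iota ltnn leqnn eqxx !nth_cat !size_map ltnn.
      by rewrite subnn ltnNge leq_addr addKn.
    - rewrite !nth_rcons !size_rcons !size_iota ltnn eqxx !nth_cat !size_map.
      by rewrite !ltnNge leqnSn leq_addr /= subSnn addKn.
apply: (@PF_ext _ _ (fun x => F x (size (wn (n x))))).
  by move=> x; rewrite size_nseq.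
pose F' x (p s : word) := F x (size s).
apply: (@PF_loop _ _ cs fst _ F') PS' _ Pb _ => //.
- move=> x p b s /(congr1 (fun w => (all id w, size w))).
  rewrite catrevE all_cat all_rev size_cat size_rev size_nseq /= => -[].
  rewrite all_nseq orbT => /and3P[/all_true_wn Ep /= eb /all_true_wn Es] En.
  exists (x, size s); split=> //; split=> //=.
  + by rewrite [RHS]Ep -En addnK.
  + by case: b eb {En}.
- move=> x p s /(congr1 size); rewrite catrevE size_cat size_rev size_nseq => En.
  by apply: Hb; lia.
Qed.

Ltac pf_hyp := match goal with
  | H : PF ?c _ |- PF ?c _ => exact H
  | H : PF ?c _ |- PF (wk _ ?c ++ _) _ => exact (PF_weak _ _ H)
  | H : PF ?c _ |- PF (wk _ (wk _ ?c ++ _) ++ _) _ =>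
      exact (PF_weak _ _ (PF_weak _ _ H))
  | H : PF ?c _ |- PF (wk _ (wk _ (wk _ ?c ++ _) ++ _) ++ _) _ =>
      exact (PF_weak _ _ (PF_weak _ _ (PF_weak _ _ H)))
  end.

Lemma PF_new0 X Z (g : Z -> X) cs d0 ds : PF (wk g cs ++ d0 :: ds) d0.
Proof. exact: (@PF_new _ _ _ _ (d0 :: ds) 0). Qed.

Lemma PF_new1 X Z (g : Z -> X) cs d0 d1 ds : PF (wk g cs ++ [:: d0, d1 & ds]) d1.
Proof. exact: (@PF_new _ _ _ _ [:: d0, d1 & ds] 1). Qed.

Lemma PF_new2 X Z (g : Z -> X) cs d0 d1 d2 ds :
  PF (wk g cs ++ [:: d0, d1, d2 & ds]) d2.
Proof. exact: (@PF_new _ _ _ _ [:: d0, d1, d2 & ds] 2). Qed.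

Lemma PF_new3 X Z (g : Z -> X) cs d0 d1 d2 d3 ds :
  PF (wk g cs ++ [:: d0, d1, d2, d3 & ds]) d3.
Proof. exact: (@PF_new _ _ _ _ [:: d0, d1, d2, d3 & ds] 3). Qed.

Ltac pf_new := lazymatch goal with
  | |- PF (wk _ (wk _ (wk _ _ ++ ?d) ++ ?d') ++ ?d'') _ => first
    [ exact (@PF_new0 _ _ _ _ _ _) | exact (@PF_new1 _ _ _ _ _ _ _)
    | exact (@PF_weak _ _ _ d'' _ _ (@PF_new0 _ _ _ _ _ _))
    | exact (@PF_weak _ _ _ d'' _ _ (@PF_weak _ _ _ d' _ _ (@PF_new0 _ _ _ _ _ _))) ]
  | |- PF (wk _ (wk _ _ ++ ?d) ++ ?d') _ => first
    [ exact (@PF_new0 _ _ _ _ _ _) | exact (@PF_new1 _ _ _ _ _ _ _)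
    | exact (@PF_weak _ _ _ d' _ _ (@PF_new0 _ _ _ _ _ _))
    | exact (@PF_weak _ _ _ d' _ _ (@PF_new1 _ _ _ _ _ _ _))
    | exact (@PF_weak _ _ _ d' _ _ (@PF_new2 _ _ _ _ _ _ _ _)) ]
  | |- PF (wk _ _ ++ _) _ => first
    [ exact (@PF_new0 _ _ _ _ _ _) | exact (@PF_new1 _ _ _ _ _ _ _)
    | exact (@PF_new2 _ _ _ _ _ _ _ _) | exact (@PF_new3 _ _ _ _ _ _ _ _ _) ]
  end.

Ltac pf_leaf := cbv beta; unfold zip_ctx, rec_ctx, nat_ctx; first
  [ exact (PF_const _ _) | pf_hyp | pf_new ].

Lemma PF_if X (cs : seq (X -> word)) b f g : PF cs (fun x => wb (b x)) -> PF cs f -> PF cs g ->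
  PF cs (fun x => if b x then f x else g x).
Proof.
move=> Hb Hf Hg; apply: PF_ext (PF_case Hb (PF_nil cs) Hf Hg) => x /=.
by case: (b x).
Qed.

Lemma PF_wbif X (cs : seq (X -> word)) b c d : PF cs (fun x => wb (b x)) ->
  PF cs (fun x => wb (c x)) -> PF cs (fun x => wb (d x)) ->
  PF cs (fun x => wb (if b x then c x else d x)).
Proof. by move=> Hb Hc Hd; apply: PF_ext (PF_if Hb Hc Hd) => x; case: ifP. Qed.

Lemma PF_wnif X (cs : seq (X -> word)) b m n : PF cs (fun x => wb (b x)) ->
  PF cs (fun x => wn (m x)) -> PF cs (fun x => wn (n x)) ->
  PF cs (fun x => wn (if b x then m x else n x)).
Proof. by move=> Hb Hc Hd; apply: PF_ext (PF_if Hb Hc Hd) => x; case: ifP. Qed.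

Lemma PF_and X (cs : seq (X -> word)) b c : PF cs (fun x => wb (b x)) -> PF cs (fun x => wb (c x)) ->
  PF cs (fun x => wb (b x && c x)).
Proof. by move=> Hb Hc; apply: PF_wbif => //; exact: PF_const. Qed.

Lemma PF_or X (cs : seq (X -> word)) b c : PF cs (fun x => wb (b x)) -> PF cs (fun x => wb (c x)) ->
  PF cs (fun x => wb (b x || c x)).
Proof. by move=> Hb Hc; apply: PF_wbif => //; exact: PF_const. Qed.

Lemma PF_imp X (cs : seq (X -> word)) b c : PF cs (fun x => wb (b x)) -> PF cs (fun x => wb (c x)) ->
  PF cs (fun x => wb (b x ==> c x)).
Proof. by move=> Hb Hc; apply: PF_wbif => //; exact: PF_const. Qed.

Lemma PF_neg X (cs : seq (X -> word)) b : PF cs (fun x => wb (b x)) -> PF cs (fun x => wb (~~ b x)).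
Proof. by move=> Hb; apply: PF_wbif => //; exact: PF_const. Qed.

Lemma PF_head X (cs : seq (X -> word)) f : PF cs f -> PF cs (fun x => wb (head false (f x))).
Proof.
move=> Hf; apply: PF_ext (PF_case Hf (PF_const cs (wb false))
  (PF_const cs (wb true)) (PF_const cs (wb false))) => x.
by case: (f x) => [|[]].
Qed.

Lemma PF_pushb X (cs : seq (X -> word)) b f : PF cs (fun x => wb (b x)) -> PF cs f -> PF cs (fun x => b x :: f x).
Proof.
move=> Hb Hf; apply: PF_ext (PF_if Hb (PF_cons true Hf) (PF_cons false Hf)) => x.
by case: (b x).
Qed.

Lemma PF_cat X (cs : seq (X -> word)) f g : PF cs f -> PF cs g -> PF cs (fun x => f x ++ g x).
Proof.
move=> Hf Hg; apply: (@PF_word _ cs f (fun x p s => s ++ g x)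
  (fun x => size (f x) + size (g x))) => //=.
- by apply: PF_pushb; pf_leaf.
- exact: PB_add Hf.1 Hg.1.
- by move=> x p s <-; rewrite catrevE !size_cat; lia.
Qed.

Lemma PF_size X (cs : seq (X -> word)) f : PF cs f -> PF cs (fun x => wn (size (f x))).
Proof.
move=> Hf; apply: (@PF_word _ cs f (fun x p s => wn (size s)) (fun x => size (f x))) => //=.
- exact: PF_nil.
- by apply: (PF_cons true); pf_leaf.
- exact: Hf.1.
- by move=> x p s <-; rewrite catrevE size_nseq size_cat; lia.
Qed.

Lemma PF_succ X (cs : seq (X -> word)) n : PF cs (fun x => wn (n x)) -> PF cs (fun x => wn (n x).+1).
Proof. exact: PF_cons. Qed.

Lemma PF_pred X (cs : seq (X -> word)) n : PF cs (fun x => wn (n x)) -> PF cs (fun x => wn (n x).-1).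
Proof. by move/PF_behead; apply: PF_ext => x; case: (n x). Qed.

Lemma PF_add X (cs : seq (X -> word)) m n : PF cs (fun x => wn (m x)) -> PF cs (fun x => wn (n x)) ->
  PF cs (fun x => wn (m x + n x)).
Proof. by move=> Hm Hn; apply: PF_ext (PF_cat Hm Hn) => x; rewrite /wn nseqD. Qed.

Lemma PB_wn X (cs : seq (X -> word)) n : PF cs (fun x => wn (n x)) -> PB cs n.
Proof. by case=> H _; apply: PB_le H => x; rewrite size_nseq. Qed.

Lemma PF_mul X (cs : seq (X -> word)) m n : PF cs (fun x => wn (m x)) -> PF cs (fun x => wn (n x)) ->
  PF cs (fun x => wn (m x * n x)).
Proof.
move=> Hm Hn; apply: (@PF_nrec _ cs m (fun x i => wn (i * n x)) (fun x => m x * n x)) => //=.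
- exact: PF_nil.
- rewrite /rec_ctx; apply: (PF_ext (f := fun z => wn (n z.1 + z.2 * n z.1))).
    by move=> z; rewrite mulSn.
  apply: PF_add; pf_leaf.
- exact: PB_mul (PB_wn Hm) (PB_wn Hn).
- by move=> x i Hi; rewrite size_nseq leq_mul2r Hi orbT.
Qed.

Lemma PF_nilp X (cs : seq (X -> word)) f : PF cs f -> PF cs (fun x => wb (nilp (f x))).
Proof.
move=> Hf; apply: PF_ext (PF_case Hf (PF_const cs (wb true))
  (PF_const cs (wb false)) (PF_const cs (wb false))) => x.
by case: (f x) => [|[]].
Qed.

Lemma PF_sub X (cs : seq (X -> word)) m n : PF cs (fun x => wn (m x)) ->
  PF cs (fun x => wn (n x)) -> PF cs (fun x => wn (m x - n x)).
Proof.
move=> Hm Hn; apply: (@PF_nrec _ cs n (fun x i => wn (m x - i)) m) => //=.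
- by apply: PF_ext Hm => x; rewrite subn0.
- apply: (PF_ext (f := fun z => wn (m z.1 - z.2).-1)); first by move=> z; rewrite subnS.
  by apply: PF_pred; pf_leaf.
- exact: PB_wn.
- by move=> x i _; rewrite size_nseq leq_subr.
Qed.

Lemma PF_leq X (cs : seq (X -> word)) m n : PF cs (fun x => wn (m x)) ->
  PF cs (fun x => wn (n x)) -> PF cs (fun x => wb (m x <= n x)).
Proof.
move=> Hm Hn; apply: PF_ext (PF_nilp (PF_sub Hm Hn)) => x.
by rewrite /nilp size_nseq subn_eq0.
Qed.

Lemma PF_eqn X (cs : seq (X -> word)) (m n : X -> nat) : PF cs (fun x => wn (m x)) ->
  PF cs (fun x => wn (n x)) -> PF cs (fun x => wb (m x == n x)).
Proof.
move=> Hm Hn; apply: PF_ext (PF_and (PF_leq Hm Hn) (PF_leq Hn Hm)) => x.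
by rewrite eqn_leq.
Qed.

Lemma PF_odd X (cs : seq (X -> word)) n : PF cs (fun x => wn (n x)) ->
  PF cs (fun x => wb (odd (n x))).
Proof.
move=> Hn; apply: (@PF_nrec _ cs n (fun x i => wb (odd i)) (fun=> 1)) => //=.
- exact: PF_const.
- by apply: PF_neg; pf_leaf.
- exact: PB_const.
Qed.

Lemma PF_drop X (cs : seq (X -> word)) n u : PF cs (fun x => wn (n x)) ->
  PF cs u -> PF cs (fun x => drop (n x) (u x)).
Proof.
move=> Hn Hu; apply: (@PF_nrec _ cs n (fun x i => drop i (u x)) (fun x => size (u x))) => //=.
- by apply: PF_ext Hu => x; rewrite drop0.
- apply: (PF_ext (f := fun z => behead (drop z.2 (u z.1)))).
    by move=> z; rewrite -drop1 drop_drop add1n.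
  by apply: PF_behead; pf_leaf.
- exact: Hu.1.
- by move=> x i _; rewrite size_drop leq_subr.
Qed.

Lemma PF_nth X (cs : seq (X -> word)) n u : PF cs (fun x => wn (n x)) ->
  PF cs u -> PF cs (fun x => wb (nth false (u x) (n x))).
Proof.
move=> Hn Hu; apply: PF_ext (PF_head (PF_drop Hn Hu)) => x.
by rewrite -nth0 nth_drop addn0.
Qed.

Lemma PF_range X (cs : seq (X -> word)) (n : X -> nat) (G : X -> nat -> word) :
  PF cs (fun x => wn (n x)) -> PF (nat_ctx cs) (fun z => G z.1 z.2) ->
  PF cs (fun x => flatten [seq G x i | i <- iota 0 (n x)]).
Proof.
move=> Hn HG; have [[d Hd] _] := HG.
pose M x := (csz cs x + n x + 2) ^ d.
have PM : PB cs M.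
  by apply: PB_exp; apply: PB_add (PB_const _ _); apply: PB_add (PB_csz _) (PB_wn Hn).
have szG x i : i <= n x -> size (G x i) <= M x.
  move=> Hi; apply: leq_trans (Hd (x, i)) _; rewrite /M; case: (d) => // d'.
  by rewrite leq_exp2r // leq_add2r csz_wk /csz /= size_nseq addn0 leq_add2l.
apply: (@PF_nrec _ cs n (fun x i => flatten [seq G x j | j <- iota 0 i])
  (fun x => n x * M x)) => //; cbv beta.
- exact: PF_nil.
- apply: (PF_ext (f := fun z => flatten [seq G z.1 j | j <- iota 0 z.2] ++ G z.1 z.2)).
    by move=> z; rewrite -[z.2.+1]addn1 iotaD map_cat flatten_cat /= cats0.
  have HG' := PF_cat_ctx [:: (fun z => flatten [seq G z.1 j | j <- iota 0 z.2])] HG.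
  rewrite /nat_ctx -catA in HG'.
  by apply: PF_cat; last exact: HG'; pf_leaf.
- exact: PB_mul (PB_wn Hn) PM.
- move=> x i Hi; apply: (@leq_trans (i * M x)); last by rewrite leq_mul2r Hi orbT.
  elim: i Hi => // i IH Hi.
  rewrite -[i.+1]addn1 iotaD map_cat flatten_cat size_cat mulnDl mul1n leq_add ?IH //.
    by rewrite ltnW.
  by rewrite /= cats0 szG // ltnW.
Qed.

Lemma PF_const_flatten X (cs : seq (X -> word)) (C : Type) (l : seq C)
    (G : X -> C -> word) :
  (forall c, PF cs (fun x => G x c)) -> PF cs (fun x => flatten [seq G x c | c <- l]).
Proof. by move=> H; elim: l => [|c l IH] /=; [exact: PF_nil | exact: PF_cat]. Qed.

Lemma PF_has X (cs : seq (X -> word)) (n : X -> nat) (P : X -> nat -> bool) :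
  PF cs (fun x => wn (n x)) -> PF (nat_ctx cs) (fun z => wb (P z.1 z.2)) ->
  PF cs (fun x => wb (has (P x) (iota 0 (n x)))).
Proof.
move=> Hn HP; apply: (@PF_nrec _ cs n (fun x i => wb (has (P x) (iota 0 i)))
  (fun=> 1)) => //; cbv beta.
- exact: (PF_const _ (wb false)).
- apply: (PF_ext (f := fun z => wb (has (P z.1) (iota 0 z.2) || P z.1 z.2))).
    by move=> z; rewrite -[z.2.+1]addn1 iotaD has_cat /= orbF.
  have HP' := PF_cat_ctx [:: (fun z => wb (has (P z.1) (iota 0 z.2)))] HP.
  rewrite /nat_ctx -catA in HP'.
  by apply: PF_or; last exact: HP'; pf_leaf.
- exact: PB_const.
Qed.

Lemma PF_all X (cs : seq (X -> word)) (n : X -> nat) (P : X -> nat -> bool) :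
  PF cs (fun x => wn (n x)) -> PF (nat_ctx cs) (fun z => wb (P z.1 z.2)) ->
  PF cs (fun x => wb (all (P x) (iota 0 (n x)))).
Proof.
move=> Hn HP; apply: (PF_ext (f := fun x => wb (~~ has (fun i => ~~ P x i) (iota 0 (n x))))).
  by move=> x; rewrite -all_predC; congr wb; apply: eq_all => i /=; rewrite negbK.
by apply/PF_neg/PF_has => //; exact: PF_neg.
Qed.

Lemma PF_horner X (cs : seq (X -> word)) (p : {poly nat}) n :
  PF cs (fun x => wn (n x)) -> PF cs (fun x => wn (p.[n x])%R).
Proof.
move=> Hn; rewrite /horner; elim: (p : seq nat) => [|c s IH] /=; first exact: PF_const.
by apply: PF_add; [apply: PF_mul | exact: PF_const].
Qed.

(** * Lists of unary numbers, the format of encoded structures *)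

Definition wl (ns : seq nat) : word := flatten [seq encode_nat i | i <- ns].

Lemma wl_cons n ns : wl (n :: ns) = wn n ++ false :: wl ns.
Proof. by rewrite /wl /= /encode_nat cat_rcons. Qed.

Lemma wl_cat ms ns : wl (ms ++ ns) = wl ms ++ wl ns.
Proof. by rewrite /wl map_cat flatten_cat. Qed.

Lemma wl_flatten nss : wl (flatten nss) = flatten [seq wl ns | ns <- nss].
Proof. by elim: nss => //= ns nss <-; rewrite wl_cat. Qed.

Fixpoint drop_num (w : word) : word :=
  if w is b :: w' then if b then drop_num w' else w' else [::].

Fixpoint head_num (w : word) : nat :=
  if w is b :: w' then if b then (head_num w').+1 else 0 else 0.

Lemma drop_num_wl ns : drop_num (wl ns) = wl (behead ns).
Proof. by case: ns => // n ns; rewrite wl_cons; elim: n. Qed.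

Lemma head_num_wl ns : head_num (wl ns) = head 0 ns.
Proof. by case: ns => // n ns; rewrite wl_cons /=; elim: n => //= n ->. Qed.

Lemma PF_drop_num X (cs : seq (X -> word)) u : PF cs u -> PF cs (fun x => drop_num (u x)).
Proof.
move=> Hu; apply: (@PF_word _ cs u (fun x p s => drop_num s) (fun x => size (u x))) => //=.
- exact: PF_nil.
- by apply: PF_if; pf_leaf.
- exact: Hu.1.
- move=> x p s <-; rewrite catrevE size_cat; apply: leq_trans (leq_addl _ _).
  by elim: s => //= -[] s IH //=; apply: leq_trans IH _.
Qed.

Lemma PF_head_num X (cs : seq (X -> word)) u : PF cs u -> PF cs (fun x => wn (head_num (u x))).
Proof.
move=> Hu; apply: (@PF_word _ cs u (fun x p s => wn (head_num s)) (fun x => size (u x))) => //=.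
- exact: PF_nil.
- by apply: PF_wnif; [pf_leaf | apply: PF_succ; pf_leaf | exact: (PF_const _ (wn 0))].
- exact: Hu.1.
- move=> x p s <-; rewrite catrevE size_cat size_nseq; apply: leq_trans (leq_addl _ _).
  by elim: s => //= -[].
Qed.

Lemma size_wl_drop i ns : size (wl (drop i ns)) <= size (wl ns).
Proof. by rewrite -{2}(cat_take_drop i ns) wl_cat size_cat leq_addl. Qed.

Lemma PF_nthl X (cs : seq (X -> word)) n (ns : X -> seq nat) :
  PF cs (fun x => wn (n x)) -> PF cs (fun x => wl (ns x)) ->
  PF cs (fun x => wn (nth 0 (ns x) (n x))).
Proof.
move=> Hn Hl; apply: (PF_ext (f := fun x => wn (head_num (wl (drop (n x) (ns x)))))).
  by move=> x; rewrite head_num_wl -nth0 nth_drop addn0.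
apply: PF_head_num.
apply: (@PF_nrec _ cs n (fun x i => wl (drop i (ns x))) (fun x => size (wl (ns x)))) => //=.
- by apply: PF_ext Hl => x; rewrite drop0.
- apply: (PF_ext (f := fun z => drop_num (wl (drop z.2 (ns z.1))))).
    by move=> z; rewrite drop_num_wl -drop1 drop_drop add1n.
  by apply: PF_drop_num; pf_leaf.
- exact: Hl.1.
- by move=> x i _; exact: size_wl_drop.
Qed.

Lemma count_wl ns : count negb (wl ns) = size ns.
Proof. by elim: ns => // n ns IH; rewrite wl_cons count_cat /= IH count_nseq /=. Qed.

Lemma PF_sizel X (cs : seq (X -> word)) (ns : X -> seq nat) :
  PF cs (fun x => wl (ns x)) -> PF cs (fun x => wn (size (ns x))).
Proof.
move=> Hl; apply: (PF_ext (f := fun x => wn (count negb (wl (ns x))))).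
  by move=> x; rewrite count_wl.
apply: (@PF_word _ cs (fun x => wl (ns x)) (fun x p s => wn (count negb s))
  (fun x => size (wl (ns x)))) => //=.
- exact: PF_nil.
- apply: (PF_ext (f := fun z => wn (if z.2.1.2 then count negb z.2.2 else (count negb z.2.2).+1))).
    by move=> z; case: (z.2.1.2).
  by apply: PF_wnif; [pf_leaf | pf_leaf | apply: PF_succ; pf_leaf].
- exact: Hl.1.
- by move=> x p s <-; rewrite catrevE size_cat size_nseq -(leq_add2l (size (rev p))) leq_add2l
    (leq_trans (count_size _ _)) ?leq_addl.
Qed.

Lemma PF_encode X (cs : seq (X -> word)) n :
  PF cs (fun x => wn (n x)) -> PF cs (fun x => encode_nat (n x)).
Proof.
move=> Hn; apply: PF_ext (PF_cat Hn (PF_const cs [:: false])) => x.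
by rewrite /encode_nat -cats1.
Qed.

Lemma PF_consl X (cs : seq (X -> word)) n (ns : X -> seq nat) :
  PF cs (fun x => wn (n x)) -> PF cs (fun x => wl (ns x)) ->
  PF cs (fun x => wl (n x :: ns x)).
Proof. by move=> Hn Hl; apply: PF_cat (PF_encode Hn) Hl. Qed.

Lemma PF_catl X (cs : seq (X -> word)) (ms ns : X -> seq nat) :
  PF cs (fun x => wl (ms x)) -> PF cs (fun x => wl (ns x)) ->
  PF cs (fun x => wl (ms x ++ ns x)).
Proof. by move=> Hm Hl; apply: PF_ext (PF_cat Hm Hl) => x; rewrite wl_cat. Qed.

Lemma PF_rangel X (cs : seq (X -> word)) (n : X -> nat) (G : X -> nat -> seq nat) :
  PF cs (fun x => wn (n x)) -> PF (nat_ctx cs) (fun z => wl (G z.1 z.2)) ->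
  PF cs (fun x => wl (flatten [seq G x i | i <- iota 0 (n x)])).
Proof.
move=> Hn HG; apply: PF_ext (PF_range Hn HG) => x.
by rewrite wl_flatten -map_comp.
Qed.

Lemma PF_const_flattenl X (cs : seq (X -> word)) (C : Type) (l : seq C)
    (G : X -> C -> seq nat) :
  (forall c, PF cs (fun x => wl (G x c))) ->
  PF cs (fun x => wl (flatten [seq G x c | c <- l])).
Proof.
move=> H; apply: PF_ext (PF_const_flatten l H) => x.
by rewrite wl_flatten -map_comp.
Qed.

Lemma PF_ifl X (cs : seq (X -> word)) b (ms ns : X -> seq nat) :
  PF cs (fun x => wb (b x)) -> PF cs (fun x => wl (ms x)) -> PF cs (fun x => wl (ns x)) ->
  PF cs (fun x => wl (if b x then ms x else ns x)).
Proof. by move=> Hb Hc Hd; apply: PF_ext (PF_if Hb Hc Hd) => x; case: ifP. Qed.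

(** A total parser: an unterminated number at the end is dropped, so a word is a list of numbers
    exactly when encoding the result again preserves the length. *)
Fixpoint nums (w : word) : seq nat :=
  match w with
  | [::] => [::]
  | false :: w' => 0 :: nums w'
  | true :: w' => if nums w' is n :: ns then n.+1 :: ns else [::]
  end.

Lemma nums_wl ns : nums (wl ns) = ns.
Proof. by elim: ns => // n ns IH; rewrite wl_cons; elim: n => /= [|n ->]; rewrite ?IH. Qed.

Lemma size_wl_nums w : size (wl (nums w)) <= size w.
Proof.
elim: w => //= -[] w IH; last by rewrite wl_cons.
by case: (nums w) IH => // n ns; rewrite !wl_cons !size_cat.
Qed.

Lemma wl_nums w : (size w == size (wl (nums w))) = (w == wl (nums w)).
Proof.
apply/eqP/eqP => [|{1}->//].
elim: w => //= -[] w IH; last by rewrite wl_cons /= => -[/IH] {1}->.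
case E: (nums w) IH => [|n ns] //; rewrite !wl_cons !size_cat /= => IH [H].
by rewrite {1}IH // wl_cons.
Qed.

Lemma PF_nums X (cs : seq (X -> word)) u : PF cs u -> PF cs (fun x => wl (nums (u x))).
Proof.
move=> Hu; apply: (@PF_word _ cs u (fun x p s => wl (nums s)) (fun x => size (u x))) => //=.
- exact: PF_nil.
- apply: (PF_ext (f := fun z => if z.2.1.2 && nilp (wl (nums z.2.2)) then [::]
                      else z.2.1.2 :: wl (nums z.2.2))).
    move=> [x [[p b] s]] /=; case: b => //=.
    by case: (nums s) => // n ns; rewrite !wl_cons /nilp size_cat /= addnS.
  apply: PF_if; last 2 first.
  + exact: PF_nil.
  + by apply: PF_pushb; pf_leaf.
  by apply: PF_and; last apply: PF_nilp; pf_leaf.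
- exact: Hu.1.
- by move=> x p s <-; rewrite catrevE size_cat (leq_trans (size_wl_nums _)) ?leq_addl.
Qed.

(** * Quantified Horn derivations and the universal structure *)

(** One arity for all symbols, with idle arguments where fewer would do, makes every fact a
    quadruple of numbers. *)
Definition tern (T : Type) := nat -> T -> T -> T -> Prop.

Section Derivation.
Variables (T : Type) (R : tern T) (S : T -> Prop).

(* Symbol 0 is a Horn rule [a /\ b -> c], symbol 1 the link relation, symbol 2
   marks contradictions, and symbol [i + 3] reads the [i]-th quantified
   valuation. *)
Inductive der (f : nat -> T -> bool) : T -> Prop :=
| der_read i a b c : R (i + 3) a b c -> S a -> S b -> S c ->
    der f (if f i a then a else b)
| der_rule a b c : R 0 a b c -> S a -> S b -> S c -> der f a -> der f b -> der f c.

Definition val_of (fs : seq (T -> bool)) : nat -> T -> bool := nth (fun=> false) fs.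

(* [loops] is set except for NP, whose template has no use for cliques. *)
Definition bad (loops : bool) (fs : seq (T -> bool)) : Prop :=
  (exists a b c, [/\ R 2 a b c, S a, S b, S c & der (val_of fs) a]) \/
  (loops /\ exists2 a, S a & R 1 a a a).

Definition clique : Prop :=
  forall a b, S a -> S b -> a <> b -> R 1 a b b \/ R 1 b a a.

End Derivation.

Fixpoint qalt T (ex : bool) (n : nat) (Phi : seq (T -> bool) -> Prop)
    (fs : seq (T -> bool)) : Prop :=
  if n is n'.+1 then
    if ex then exists f, qalt false n' Phi (rcons fs f)
    else forall f, qalt true n' Phi (rcons fs f)
  else Phi fs.

Lemma qalt_impl T ex n (Phi Psi : seq (T -> bool) -> Prop) fs :
  (forall fs, Phi fs -> Psi fs) -> qalt ex n Phi fs -> qalt ex n Psi fs.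
Proof.
move=> H; elim: n ex fs => [|n IH] ex fs /=; first exact: H.
case: ex => [[f Hf]|Hf f]; last exact: IH.
by exists f; exact: IH.
Qed.

Lemma qalt_all T ex n (Phi : seq (T -> bool) -> Prop) fs :
  (forall fs, Phi fs) -> qalt ex n Phi fs.
Proof.
move=> H; elim: n ex fs => [|n IH] ex fs /=; first exact: H.
case: ex => [|f]; last exact: IH.
by exists (fun=> false); exact: IH.
Qed.

Lemma qalt_some T ex n (Phi : seq (T -> bool) -> Prop) fs :
  qalt ex n Phi fs -> exists fs, Phi fs.
Proof.
elim: n ex fs => [|n IH] ex fs /=; first by exists fs.
case: ex => [[f /IH //]|].
by move/(_ (fun=> false))/IH.
Qed.

Section Mono.
Variables (T1 T2 : Type) (R1 : tern T1) (R2 : tern T2).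
Variables (S1 : T1 -> Prop) (S2 : T2 -> Prop) (h : T1 -> T2).
Hypothesis hS : forall a, S1 a -> S2 (h a).
Hypothesis hR : forall k a b c, S1 a -> S1 b -> S1 c -> R1 k a b c ->
  R2 k (h a) (h b) (h c).

Lemma der_mono f1 f2 a : (forall i a, S1 a -> f1 i a = f2 i (h a)) ->
  der R1 S1 f1 a -> der R2 S2 f2 (h a).
Proof.
move=> Hf; elim=> {a} [i a b c HR Sa Sb Sc|a b c HR Sa Sb Sc _ Da _ Db].
  rewrite (fun_if h) Hf //.
  by apply: (@der_read _ R2 S2 f2 i _ _ (h c)); by [exact: hR | exact: hS].
apply: (@der_rule _ R2 S2 f2 (h a) (h b)) => //; by [exact: hR | exact: hS].
Qed.

Lemma bad_mono lp fs1 fs2 :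
  (forall i a, S1 a -> val_of fs1 i a = val_of fs2 i (h a)) ->
  bad R1 S1 lp fs1 -> bad R2 S2 lp fs2.
Proof.
move=> Hf [[a [b [c [HR Sa Sb Sc Da]]]]|[Hl [a Sa HR]]].
  left; exists (h a), (h b), (h c); split; try exact: hS; first exact: hR.
  exact: der_mono Hf Da.
by right; split=> //; exists (h a); [exact: hS | exact: hR].
Qed.

Hypothesis h_inj : forall a b, S1 a -> S1 b -> h a = h b -> a = b.

(** An existential valuation is composed with [h]. A universal one is carried to the image of [S1],
    which is well defined by injectivity. *)
Lemma qalt_mono lp ex n fs1 fs2 : size fs1 = size fs2 ->
  (forall i a, S1 a -> val_of fs1 i a = val_of fs2 i (h a)) ->
  qalt ex n (fun fs => ~ bad R2 S2 lp fs) fs2 ->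
  qalt ex n (fun fs => ~ bad R1 S1 lp fs) fs1.
Proof.
have Hr fs1' fs2' f1 f2 : size fs1' = size fs2' ->
    (forall i a, S1 a -> val_of fs1' i a = val_of fs2' i (h a)) ->
    (forall a, S1 a -> f1 a = f2 (h a)) ->
    (forall i a, S1 a -> val_of (rcons fs1' f1) i a = val_of (rcons fs2' f2) i (h a)).
  move=> Hs Hf Hff i a Sa; rewrite /val_of !nth_rcons -Hs.
  by case: ltnP => _; [exact: Hf | case: ifP => // _; exact: Hff].
elim: n ex fs1 fs2 => [|n IH] ex fs1 fs2 Hs Hf /=.
  by move=> Hb /(bad_mono Hf).
case: ex => [[f2 Hq]|Hq].
  exists (f2 \o h); apply: IH Hq; first by rewrite !size_rcons Hs.
  exact: Hr.
move=> f1; pose f2 y := `[< exists2 a, S1 a & h a = y /\ f1 a >].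
apply: IH (Hq f2); first by rewrite !size_rcons Hs.
apply: Hr => // a Sa; apply/idP/asboolP => [fa|]; first by exists a.
by case=> b Sb [/h_inj -> //].
Qed.

End Mono.

Section Good.
(* The colour [c] is the outermost existential valuation for the classes Sigma. *)
Variables (sigma : bool) (k : nat).

Definition good T (R : tern T) (c : T -> bool) (S : T -> Prop) : Prop :=
  qalt false k (fun fs => ~ bad R S true fs) (if sigma then [:: c] else [::]).

Lemma good_mono T1 T2 (R1 : tern T1) (R2 : tern T2) c1 c2 S1 S2 (h : T1 -> T2) :
  (forall a b, S1 a -> S1 b -> h a = h b -> a = b) ->
  (forall a, S1 a -> S2 (h a)) ->
  (forall s a b c, S1 a -> S1 b -> S1 c -> R1 s a b c -> R2 s (h a) (h b) (h c)) ->
  (forall a, S1 a -> c1 a = c2 (h a)) ->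
  good R2 c2 S2 -> good R1 c1 S1.
Proof.
move=> hi hS hR hc; rewrite /good.
apply: (qalt_mono hS hR hi); first by case: sigma.
by case: sigma => -[|i] a Sa //=; [exact: hc | rewrite /val_of !nth_nil].
Qed.

Lemma good_loop T (R : tern T) c S a : good R c S -> S a -> ~ R 1 a a a.
Proof. by move/qalt_some => [fs Hb] Sa Ra; apply: Hb; right; split=> //; exists a. Qed.

Lemma good_empty T (R : tern T) c S :
  (forall s a b d, S a -> S b -> S d -> ~ R s a b d) -> good R c S.
Proof.
move=> H; apply: qalt_all => fs [[a [b [d [HR Sa Sb Sd _]]]]|[_ [a Sa HR]]].
  exact: H HR.
exact: H HR.
Qed.

(** The list [l] makes the cliques finite, so that those of the limit already occur at some
    stage. *)
Definition cliques_good (T : eqType) (R : tern T) (c : T -> bool) : Prop :=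
  forall (l : seq T) (S : T -> Prop), (forall a, S a -> a \in l) ->
  clique R S -> good R c S.

(* A countable universal homogeneous structure, in the style of the Rado graph:
   the number [j] codes a set of facts linking a new point to earlier points,
   and these facts are added unless this creates a clique that is not good. *)
Variable m : nat.

Definition code := (seq (nat * (option nat * option nat * option nat)) * bool)%type.

(** The exponent of 2 takes each value infinitely often, so every code recurs beyond any bound. *)
Definition dec (j : nat) : code := odflt ([::], false) (unpickle (logn 2 j)).

Definition colour (j : nat) : bool := (dec j).2.

Definition nfact := (nat * (nat * nat * nat))%type.

Definition before (j : nat) (o : option nat) := if o is Some i then i < j else true.

(** [None] stands for the new point [j]. Every new fact has to mention it, so facts among earlier
    points never change again. *)
Definition fresh (j : nat) : seq nfact :=
  [seq (p.1, (odflt j p.2.1.1, odflt j p.2.1.2, odflt j p.2.2)) | p <- (dec j).1 &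
     [&& p.1 < m, None \in [:: p.2.1.1; p.2.1.2; p.2.2] &
       all (before j) [:: p.2.1.1; p.2.1.2; p.2.2]]].

Definition rel_of (F : seq nfact) : tern nat := fun s a b c => (s, (a, b, c)) \in F.

Fixpoint stage (j : nat) : seq nfact :=
  if j is i.+1 then
    stage i ++ (if `[< cliques_good (rel_of (stage i ++ fresh i)) colour >]
                then fresh i else [::])
  else [::].

Definition limit : tern nat := fun s a b c => exists j, (s, (a, b, c)) \in stage j.

Lemma dec_onto (x : code) N : exists2 j, N <= j & dec j = x.
Proof.
exists (2 ^ pickle x * N.*2.+1).
  by apply: (@leq_trans N.*2.+1); [lia | rewrite leq_pmull // expn_gt0].
rewrite /dec lognM ?expn_gt0 // pfactorK // logn_coprime ?addn0 ?pickleK //.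
by rewrite coprime2n /= odd_double.
Qed.

Lemma freshP j s a b c : (s, (a, b, c)) \in fresh j ->
  [/\ s < m, j \in [:: a; b; c] & all (fun i => i <= j) [:: a; b; c]].
Proof.
case/mapP=> -[s' [[a' b'] c']]; rewrite mem_filter /= => /andP[/and3P[sm HN]].
rewrite andbT => /and3P[Ha Hb Hc] _ [-> -> -> ->]; split=> //.
  move: HN; rewrite !inE.
  by case: a' {Ha} => [?|]; case: b' {Hb} => [?|]; case: c' {Hc} => [?|];
     rewrite //= ?eqxx ?orbT.
rewrite andbT; case: a' Ha {HN} => [?|] /=; case: b' Hb => [?|] /=;
  case: c' Hc => [?|] /=; lia.
Qed.

Lemma stageP j s a b c : (s, (a, b, c)) \in stage j ->
  [/\ s < m, a < j, b < j & c < j].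
Proof.
elim: j => //= j IH; rewrite mem_cat => /orP[/IH [-> ? ? ?]|]; first by split=> //; lia.
by case: asboolP => // _ /freshP [-> _ /and4P[? ? ? _]].
Qed.

Lemma stage_mono i j f : i <= j -> f \in stage i -> f \in stage j.
Proof.
move/subnK <-; elim: (j - i) => //= d IH /IH H.
by rewrite mem_cat H.
Qed.

Lemma limit_stage j s a b c : a < j -> b < j -> c < j ->
  limit s a b c <-> (s, (a, b, c)) \in stage j.
Proof.
move=> aj bj cj; split=> [[i]|]; last by exists j.
case: (leqP i j) => [ij|/ltnW/subnK <-]; first exact: stage_mono.
elim: (i - j) => //= d IH; rewrite mem_cat => /orP[/IH //|].
case: asboolP => // _ /freshP [_ + _]; rewrite !inE.
by case/or3P => /eqP H; lia.
Qed.

Lemma limit_lt s a b c : limit s a b c -> s < m.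
Proof. by case=> j /stageP []. Qed.

Lemma stage_good j : cliques_good (rel_of (stage j)) colour.
Proof.
elim: j => [|j IH] /=; first by move=> l S _ _; exact: good_empty.
by case: asboolP => //; rewrite cats0.
Qed.

Lemma limit_good : cliques_good limit colour.
Proof.
move=> l S Sl Sc; pose j := (\max_(i <- l) i).+1.
have lj a : S a -> a < j by move/Sl => H; rewrite ltnS; apply: (leq_bigmax_seq (F := fun i => i)).
apply: (@good_mono _ _ _ (rel_of (stage j)) _ colour _ S id) => //.
  by move=> s a b c /lj ? /lj ? /lj ? /(limit_stage _) H; apply/H.
apply: (stage_good Sl) => a b Sa Sb ab.
by case: (Sc a b Sa Sb ab) => H; [left|right]; apply/limit_stage; auto.
Qed.

End Good.

(** * One-point extensions and homogeneity *)

Section Homogeneity.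
Variables (sigma : bool) (k m : nat).
Local Notation D := (limit sigma k m).

(** Colours have to agree although no formula mentions them, because the goodness of a clique may
    depend on them. *)
Definition partial_iso (T : eqType) (R : tern T) (c : T -> bool) (l : seq (nat * T)) :=
  [/\ (forall p q, p \in l -> q \in l -> (p.1 = q.1 <-> p.2 = q.2)),
      (forall p, p \in l -> colour p.1 = c p.2) &
      (forall s p q r, p \in l -> q \in l -> r \in l ->
         (D s p.1 q.1 r.1 <-> R s p.2 q.2 r.2))].

Lemma partial_iso_sub (T : eqType) (R : tern T) c l l' :
  {subset l' <= l} -> partial_iso R c l -> partial_iso R c l'.
Proof. by move=> sub [H1 H2 H3]; split=> *; [apply: H1|apply: H2|apply: H3]; exact: sub. Qed.

Section Extend.
Variables (T : eqType) (R : tern T) (c : T -> bool) (l : seq (nat * T)) (y : T).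
Hypothesis Rgood : cliques_good sigma k R c.
Hypothesis R_lt : forall s a b d, R s a b d -> s < m.
Hypothesis l_iso : partial_iso R c l.
Hypothesis y_new : y \notin [seq p.2 | p <- l].

Let look (o : option nat) : T :=
  if o is Some i then nth y [seq p.2 | p <- l] (index i [seq p.1 | p <- l]) else y.

Let look_mem p : p \in l -> look (Some p.1) = p.2.
Proof.
move=> pl /=; have Hi : index p.1 [seq p.1 | p <- l] < size l.
  by rewrite -(size_map fst) index_mem map_f.
rewrite (nth_map p) //; set q := nth p l _.
have ql : q \in l by rewrite mem_nth.
have [H1 _ _] := l_iso; apply/(H1 q p ql pl).
by rewrite /q -(nth_map _ 0 fst) // nth_index // map_f.
Qed.

Let os : seq (option nat) := None :: [seq Some p.1 | p <- l].

(** All facts of [R] on [y] and the matched points, with [y] written as [None] and the others as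
    their partners; [fresh] selects those that mention [y]. *)
Let the_code : code :=
  ([seq f <- [seq (s, abd) | s <- iota 0 m, abd <- [seq (ab, d) |
      ab <- [seq (a, b) | a <- os, b <- os], d <- os]]
    | `[< R f.1 (look f.2.1.1) (look f.2.1.2) (look f.2.2) >]], c y).

Let the_codeP s a b d : (s, (a, b, d)) \in the_code.1 <->
  [/\ s < m, a \in os, b \in os, d \in os & R s (look a) (look b) (look d)].
Proof.
rewrite mem_filter; split.
  case/andP => /asboolP HR /allpairsP [[s' t] []]; rewrite [(_, _).1]/= [(_, _).2]/=.
  rewrite mem_iota => /andP[_ Hs] /allpairsP [[[a' b'] d'] []].
  rewrite [(_, _).1]/= [(_, _).2]/= => /allpairsP [[a'' b''] []].
  rewrite [(_, _).1]/= [(_, _).2]/= => Ha Hb [-> ->] Hd -> [E1 E2 E3 E4]; subst.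
  by [].
case=> Hs Ha Hb Hd HR; apply/andP; split; first exact/asboolP.
apply: allpairs_f; first by rewrite mem_iota.
by do 2! apply: allpairs_f => //.
Qed.

Let N := (\max_(p <- l) p.1).+1.

Lemma extend_new : exists x, partial_iso R c ((x, y) :: l).
Proof.
have [H1 H2 H3] := l_iso.
have lN p : p \in l -> p.1 < N.
  by move=> pl; rewrite ltnS; apply: (leq_bigmax_seq (F := fst)).
(* Beyond [N] all matched points are earlier than [j], as [fresh] requires. *)
have [j Nj Ej] := dec_onto the_code N.
have lj p : p \in l -> p.1 < j by move/lN => ?; exact: leq_trans Nj.
pose h a := if a == j then y else look (Some a).
have hl p : p \in l -> h p.1 = p.2.
  by move=> pl; rewrite /h ltn_eqF ?lj //; exact: look_mem.
have hj : h j = y by rewrite /h eqxx.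
pose js := j :: [seq p.1 | p <- l].
have jsP a : a \in js -> a = j \/ exists2 p, p \in l & a = p.1.
  by rewrite inE => /orP[/eqP ->|/mapP[p pl ->]]; [left | right; exists p].
have osP o : o \in os -> odflt j o \in js /\ h (odflt j o) = look o.
  rewrite inE => /orP[/eqP ->|/mapP[p pl ->]]; first by rewrite mem_head hj.
  by rewrite [odflt _ _]/= inE map_f ?orbT // hl // look_mem.
have jsO a : a \in js -> exists2 o, o \in os & odflt j o = a /\ (o == None) = (a == j).
  case/jsP => [->|[p pl ->]].
    by exists None; rewrite ?mem_head // !eqxx.
  exists (Some p.1); first by rewrite inE map_f.
  by rewrite /= (ltn_eqF (lj p pl)).
have freshE s a b d : (s, (a, b, d)) \in fresh m j <->
    [/\ j \in [:: a; b; d], a \in js, b \in js, d \in js & R s (h a) (h b) (h d)].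
  split.
    move=> Hf; have [_ + _] := freshP Hf; move: Hf; rewrite /fresh Ej.
    case/mapP => -[s' [[a' b'] d']]; rewrite mem_filter => /andP[_ /the_codeP].
    case=> _ /osP[Ha Ea] /osP[Hb Eb] /osP[Hd Ed] HR [-> -> -> ->] Hj.
    by split=> //; rewrite Ea Eb Ed.
  case=> Hj /jsO [oa Ha [Ea Fa]] /jsO [ob Hb [Eb Fb]] /jsO [od Hd [Ed Fd]] HR.
  apply/mapP; exists (s, (oa, ob, od)); last by rewrite /= Ea Eb Ed.
  have bef o : o \in os -> before j o.
    by rewrite inE => /orP[/eqP -> //|/mapP [p pl ->]]; exact: lj.
  rewrite mem_filter /= Ej !bef // (R_lt HR) !inE !(eq_sym None) Fa Fb Fd.
  move: Hj; rewrite !inE !(eq_sym j) => -> /=.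
  apply/the_codeP; split=> //; first exact: R_lt HR.
  by rewrite -(osP _ Ha).2 -(osP _ Hb).2 -(osP _ Hd).2 Ea Eb Ed.
have colj : colour j = c y by rewrite /colour Ej.
have hinj a b : a \in js -> b \in js -> h a = h b -> a = b.
  case/jsP => [->|[p pl ->]]; case/jsP => [->|[q ql ->]] //; rewrite ?hj ?hl //.
  - by move=> E; case/negP: y_new; rewrite E map_f.
  - by move=> E; case/negP: y_new; rewrite -E map_f.
  - by move/(H1 p q pl ql).
have hR s a b d : a \in js -> b \in js -> d \in js ->
    (s, (a, b, d)) \in stage sigma k m j ++ fresh m j -> R s (h a) (h b) (h d).
  move=> Ha Hb Hd; rewrite mem_cat => /orP[Hs|/freshE [] //].
  have [_ aj bj dj] := stageP Hs.
  case/jsP: Ha => [E|[p pl E]]; first by rewrite E ltnn in aj.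
  case/jsP: Hb => [E'|[q ql E']]; first by rewrite E' ltnn in bj.
  case/jsP: Hd => [E''|[r rl E'']]; first by rewrite E'' ltnn in dj.
  rewrite E E' E'' in Hs *; rewrite !hl //; apply/(H3 s p q r pl ql rl).
  by exists j.
(* Free amalgamation: links to [j] are fresh, so a clique through [j] consists of matched points and
   embeds into [R]; a clique avoiding [j] is already one of the good stage [j]. *)
have Hgood : cliques_good sigma k (rel_of (stage sigma k m j ++ fresh m j)) colour.
  move=> ll S Sl Sc; case: (pselect (S j)) => [Sj|nSj].
    have Sjs a : S a -> a \in js.
      move=> Sa; case: (eqVneq a j) => [->|/eqP aj]; first exact: mem_head.
      case: (Sc a j Sa Sj aj); rewrite /rel_of mem_cat => /orP[/stageP[]|/freshE[]] //;
        by rewrite ltnn.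
    apply: (@good_mono _ _ _ _ _ R _ c _ (fun z => exists2 a, S a & h a = z) h).
    - by move=> a b Sa Sb; apply: hinj; exact: Sjs.
    - by move=> a Sa; exists a.
    - by move=> s a b d Sa Sb Sd; apply: hR; exact: Sjs.
    - by move=> a /Sjs /jsP [->|[p pl ->]]; rewrite ?hj ?hl // H2.
    - apply: (Rgood (l := map h ll)) => [z [a Sa <-]|]; first by rewrite map_f // Sl.
      move=> _ _ [a Sa <-] [b Sb <-] hab.
      have ab : a <> b by move=> E; rewrite E in hab.
      by case: (Sc a b Sa Sb ab) => HH; [left|right]; apply: hR => //; exact: Sjs.
  have old s a b d : S a -> S b -> S d ->
      (s, (a, b, d)) \in stage sigma k m j ++ fresh m j -> (s, (a, b, d)) \in stage sigma k m j.
    move=> Sa Sb Sd; rewrite mem_cat => /orP[//|/freshE [+ _ _ _ _]].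
    by rewrite !inE => /or3P[] /eqP E; case: nSj; rewrite E.
  apply: (@good_mono _ _ _ _ _ (rel_of (stage sigma k m j)) _ colour _ S id) => //.
  apply: (@stage_good _ _ _ _ ll) => // a b Sa Sb ab.
  by case: (Sc a b Sa Sb ab) => HH; [left|right]; exact: old HH.
have Estage : stage sigma k m j.+1 = stage sigma k m j ++ fresh m j.
  by rewrite /=; case: asboolP.
exists j; split.
- move=> p q; rewrite !inE => /orP[/eqP ->|pl] /orP[/eqP ->|ql] //=; last exact: H1.
  + split=> E; first by have := lj q ql; rewrite -E ltnn.
    by case/negP: y_new; rewrite E map_f.
  + split=> E; first by have := lj p pl; rewrite E ltnn.
    by case/negP: y_new; rewrite -E map_f.
- by move=> p; rewrite inE => /orP[/eqP -> //|]; exact: H2.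
have inP p : p \in (j, y) :: l -> [/\ p.1 \in js, p.1 < j.+1 & h p.1 = p.2].
  rewrite inE => /orP[/eqP -> /=|pl]; first by rewrite mem_head hj.
  by rewrite inE map_f ?orbT // hl // ltnS ltnW ?lj.
move=> s p q r Hp Hq Hr.
have [Jp Lp Ep] := inP p Hp; have [Jq Lq Eq] := inP q Hq; have [Jr Lr Er] := inP r Hr.
split=> [/(limit_stage _ _ _ _ Lp Lq Lr)|HR].
  by rewrite Estage -Ep -Eq -Er; exact: hR.
apply/(limit_stage _ _ _ _ Lp Lq Lr); rewrite Estage mem_cat.
case: (boolP (j \in [:: p.1; q.1; r.1])) => Hj.
  by apply/orP; right; apply/freshE; split=> //; rewrite Ep Eq Er.
have old o : o \in (j, y) :: l -> o.1 != j -> o \in l.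
  by rewrite inE => /orP[/eqP ->|//]; rewrite eqxx.
move: Hj; rewrite !inE !negb_or !(eq_sym j) => /and3P[Np Nq Nr].
apply/orP; left; apply/(limit_stage sigma k m s (lj _ (old _ Hp Np)) (lj _ (old _ Hq Nq))
  (lj _ (old _ Hr Nr))).
by apply/H3 => //; exact: old.
Qed.

End Extend.

Lemma extend (T : eqType) (R : tern T) c l y :
  cliques_good sigma k R c -> (forall s a b d, R s a b d -> s < m) ->
  partial_iso R c l -> exists x, partial_iso R c ((x, y) :: l).
Proof.
move=> Rg Rm Hl; case: (boolP (y \in [seq p.2 | p <- l])); last exact: extend_new.
case/mapP => p pl Ey; exists p.1; apply: partial_iso_sub Hl => q.
by rewrite inE => /orP[/eqP ->|//]; rewrite Ey -surjective_pairing.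
Qed.

Lemma embed (T : eqType) (R : tern T) c (l : seq T) :
  cliques_good sigma k R c -> (forall s a b d, R s a b d -> s < m) ->
  exists2 l', partial_iso R c l' & [seq p.2 | p <- l'] = l.
Proof.
move=> Rg Rm; elim: l => [|y l [l' Hl <-]]; first by exists [::].
by have [x Hx] := extend y Rg Rm Hl; exists ((x, y) :: l').
Qed.

End Homogeneity.

(** * The reduct without colour: categoricity and homomorphisms into it *)

Definition horn_sig (n : nat) : signature :=
  @Signature n.+3 (fun=> 3) (fun=> isT).

Definition struct_of n T (R : tern T) : structure (horn_sig n) T :=
  fun s (t : 3.-tuple T) => R s (tnth t (@Ordinal 3 0 isT)) (tnth t (@Ordinal 3 1 isT))
    (tnth t (@Ordinal 3 2 isT)).

Definition tern_of n T (A : structure (horn_sig n) T) : tern T :=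
  fun k a b c => exists2 s : 'I_n.+3, nat_of_ord s = k & A s [tuple a; b; c].

Lemma tuple3E T (t : 3.-tuple T) : t = [tuple tnth t (@Ordinal 3 0 isT);
  tnth t (@Ordinal 3 1 isT); tnth t (@Ordinal 3 2 isT)].
Proof. by apply: val_inj; case: t => -[|a [|b [|c []]]]. Qed.

Lemma tern_of_lt n T (A : structure (horn_sig n) T) k a b c :
  tern_of A k a b c -> k < n.+3.
Proof. by case=> s <-. Qed.

Lemma hom_tern n S T (A : structure (horn_sig n) S) (R : tern T) (h : S -> T) :
  homomorphism A (struct_of R) h <->
  (forall k a b c, tern_of A k a b c -> R k (h a) (h b) (h c)).
Proof.
split=> [H k a b c [s <- HA]|H s t HA]; first exact: (H s _ HA).
rewrite /struct_of !tnth_map; apply: H; exists s => //.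
by rewrite -tuple3E.
Qed.

Section Limit.
Variables (sigma : bool) (k n : nat).
Let D : tern nat := limit sigma k n.+3.
Let DS : structure (horn_sig n) nat := struct_of D.
Let piso := partial_iso sigma k n.+3 D colour.

Let piso_sym l : piso l -> piso [seq (p.2, p.1) | p <- l].
Proof.
case=> H1 H2 H3; split.
- move=> _ _ /mapP[p pl ->] /mapP[q ql ->] /=.
  by have := H1 p q pl ql; tauto.
- by move=> _ /mapP[p pl ->] /=; rewrite H2.
- move=> s _ _ _ /mapP[p pl ->] /mapP[q ql ->] /mapP[r rl ->] /=.
  by have := H3 s p q r pl ql rl; rewrite /D; tauto.
Qed.

Let in_zip K (v w : K.-tuple nat) (i : 'I_K) : (tnth v i, tnth w i) \in zip v w.
Proof.
rewrite !(tnth_nth 0) -nth_zip ?size_tuple // mem_nth //.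
by rewrite size_zip !size_tuple minnn.
Qed.

Let zip_in K (v w : K.-tuple nat) p : p \in zip v w ->
  exists i : 'I_K, p = (tnth v i, tnth w i).
Proof.
case/(nthP (0, 0)) => i; rewrite size_zip !size_tuple minnn => iK <-.
by exists (Ordinal iK); rewrite !(tnth_nth 0) nth_zip ?size_tuple.
Qed.

(** Back and forth: the limit extends partial isomorphisms into every structure with good cliques,
    in particular into itself, and [piso] is symmetric. *)
Let holds_iso K (phi : formula (horn_sig n) K) (v w : K.-tuple nat) :
  piso (zip v w) -> holds DS phi v <-> holds DS phi w.
Proof.
elim: {K} phi v w => [K|K i j|K s t|K phi IH|K phi IH1 psi IH2|K phi IH] v w Hp //=.
- by have [H1 _ _] := Hp; exact: (H1 _ _ (in_zip v w i) (in_zip v w j)).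
- have [_ _ H3] := Hp; rewrite /DS /struct_of !tnth_map.
  exact: (H3 s _ _ _ (in_zip v w _) (in_zip v w _) (in_zip v w _)).
- by rewrite (IH v w Hp).
- by rewrite (IH1 v w Hp) (IH2 v w Hp).
- have ext l y : piso l -> exists x, piso ((x, y) :: l).
    apply: extend; first exact: limit_good.
    by move=> ? ? ? ?; exact: limit_lt.
  split=> -[d Hd].
    have [e He] := ext _ d (piso_sym Hp); exists e.
    have Hp' : piso (zip (cons_tuple d v) (cons_tuple e w)).
      have := piso_sym He; rewrite /= -map_comp; congr (piso (_ :: _)).
      by rewrite -[RHS]map_id; apply: eq_map => -[].
    by apply/(IH _ _ Hp').
  have [e He] := ext _ d Hp; exists e.
  by apply/(IH (cons_tuple e v) (cons_tuple d w) He).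
Qed.

(** The quantifier-free type in the coloured structure. It takes finitely many values and, by
    homogeneity, decides every formula. *)
Let ty K (v : K.-tuple nat) :=
  ([ffun p : 'I_K * 'I_K => tnth v p.1 == tnth v p.2],
   [ffun i : 'I_K => colour (tnth v i)],
   [ffun p : 'I_n.+3 * ('I_K * 'I_K * 'I_K) =>
      `[< D p.1 (tnth v p.2.1.1) (tnth v p.2.1.2) (tnth v p.2.2) >]]).

Let ty_iso K (v w : K.-tuple nat) : ty v = ty w -> piso (zip v w).
Proof.
case=> /ffunP E1 /ffunP E2 /ffunP E3; split.
- move=> p q /zip_in [i ->] /zip_in [j ->] /=.
  have := E1 (i, j); rewrite !ffunE /= => E.
  by split=> /eqP; [rewrite E | rewrite -E] => /eqP.
- by move=> p /zip_in [i ->] /=; have := E2 i; rewrite !ffunE.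
- move=> s p q r /zip_in [i1 ->] /zip_in [i2 ->] /zip_in [i3 ->] /=.
  case: (ltnP s n.+3) => Hs; last first.
    by split=> /limit_lt; rewrite ltnNge Hs.
  have := E3 (Ordinal Hs, (i1, i2, i3)); rewrite !ffunE /= => E.
  by split=> /asboolP; [rewrite E | rewrite -E] => /asboolP.
Qed.

Lemma limit_categorical : omega_categorical DS.
Proof.
split; first exact: countableP.
move=> K _.
pose g (X : {ffun _ -> bool}) : set (K.-tuple nat) := [set v | X (ty v)]%classic.
apply: (@sub_finite_set _ _ (g @` setT)%classic); last first.
  by apply: finite_image; exact: finite_finset.
(* A definable relation is the union of the types realised in it. *)
move=> _ [phi ->] /=; exists [ffun t => `[< exists v, ty v = t /\ holds DS phi v >]] => //.
apply/seteqP; split=> v; rewrite /g /= ffunE.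
  by case/asboolP => w [/ty_iso Hp] /(holds_iso _ Hp).
by move=> Hv; apply/asboolP; exists v.
Qed.

(** A homomorphism induces [c] by composition with the colour of the limit; conversely the expansion
    of [A] by [c] embeds. *)
Lemma limit_hom m (A : structure (horn_sig n) 'I_m) :
  (exists h, homomorphism A DS h) <-> (exists c, cliques_good sigma k (tern_of A) c).
Proof.
split=> [[h /hom_tern Hh]|[c Hc]].
  exists (colour \o h) => l S Sl Sc.
  apply: (@good_mono _ _ _ _ _ D _ colour _ (fun z => exists2 a, S a & h a = z) h) => //.
  (* Identifying two points of a clique would make a loop in the limit; but a single point is a
     clique there, hence good, and good sets have no loops. *)
  - move=> a b Sa Sb E; apply: contrapT => ab.
    have loop : D 1 (h a) (h a) (h a).
      by case: (Sc a b Sa Sb ab) => /Hh; rewrite -E.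
    have G : good sigma k D colour (fun z => z = h a).
      apply: (@limit_good _ _ _ [:: h a]) => [z ->|z z' -> -> //].
      by rewrite inE.
    exact: good_loop G erefl loop.
  - by move=> a Sa; exists a.
  - by move=> s a b d _ _ _; exact: Hh.
  - apply: (@limit_good _ _ _ (map h l)) => [z [a Sa <-]|]; first by rewrite map_f // Sl.
    move=> _ _ [a Sa <-] [b Sb <-] hab.
    have ab : a <> b by move=> E; rewrite E in hab.
    by case: (Sc a b Sa Sb ab) => HH; [left|right]; exact: Hh.
have [l' Hl El] := embed (enum 'I_m) Hc (@tern_of_lt n _ A).
have [_ _ H3] := Hl.
have all_in a : exists x, (x, a) \in l'.
  have : a \in [seq p.2 | p <- l'] by rewrite El mem_enum.
  by case/mapP => -[x y] /= H ->; exists x.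
pose h a := projT1 (cid (all_in a)).
have hP a : (h a, a) \in l' by rewrite /h; case: cid.
exists h; apply/hom_tern => s a b d HA.
by apply/(H3 s _ _ _ (hP a) (hP b) (hP d)).
Qed.

End Limit.

(** * The verifier *)

Lemma PF_bits X (cs : seq (X -> word)) (n : X -> nat) (P : X -> nat -> bool) :
  PF cs (fun x => wn (n x)) -> PF (nat_ctx cs) (fun z => wb (P z.1 z.2)) ->
  PF cs (fun x => [seq P x i | i <- iota 0 (n x)]).
Proof.
move=> Hn HP; apply: PF_ext (PF_range (G := fun x i => wb (P x i)) Hn HP) => x.
by elim: (iota _ _) => //= i l ->.
Qed.

(** The reversed prefix [p] supplies the parity: at odd positions the second copy of a bit is
    skipped, and only at even ones can 01 be the separator. *)
Fixpoint ufst (p s : word) : word :=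
  if s is b :: s' then
    if odd (size p) then ufst (b :: p) s'
    else if ~~ b && head false s' then [::] else b :: ufst (b :: p) s'
  else [::].

Fixpoint usnd (p s : word) : word :=
  if s is b :: s' then
    if ~~ odd (size p) && (~~ b && head false s') then behead s' else usnd (b :: p) s'
  else [::].

Lemma ufst_pairing u v : ufst [::] (pairing u v) = u.
Proof.
suff gen p : odd (size p) = false -> ufst p (pairing u v) = u by exact: gen.
rewrite /pairing; elim: u p => [|b u IH] p Hp /=; rewrite Hp //=.
by case: b; rewrite /= ?Hp /= IH //= Hp.
Qed.

Lemma usnd_pairing u v : usnd [::] (pairing u v) = v.
Proof.
suff gen p : odd (size p) = false -> usnd p (pairing u v) = v by exact: gen.
rewrite /pairing; elim: u p => [|b u IH] p Hp /=; rewrite Hp //=.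
by case: b; rewrite /= ?Hp /= IH //= Hp.
Qed.

Lemma size_ufst p s : size (ufst p s) <= size s.
Proof.
elim: s p => //= b s IH p; case: ifP => _; first exact: leqW.
by case: ifP => //= _; rewrite ltnS.
Qed.

Lemma size_usnd p s : size (usnd p s) <= size s.
Proof.
elim: s p => //= b s IH p; case: ifP => _; last exact: leqW.
by rewrite size_behead; lia.
Qed.

Ltac pf_op := lazymatch goal with
  | |- PF _ (fun _ => wb (_ && _)) => apply PF_and
  | |- PF _ (fun _ => wb (_ || _)) => apply PF_or
  | |- PF _ (fun _ => wb (~~ _)) => apply PF_neg
  | |- PF _ (fun _ => wb (_ ==> _)) => apply PF_imp
  | |- PF _ (fun _ => wb (has _ _)) => apply PF_has
  | |- PF _ (fun _ => wb (all _ _)) => apply PF_all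
  | |- PF _ (fun _ => wb (_ == _)) => apply PF_eqn
  | |- PF _ (fun _ => wb (_ <= _)) => apply PF_leq
  | |- PF _ (fun _ => wb (odd _)) => apply PF_odd
  | |- PF _ (fun _ => wb (nth _ _ _)) => apply PF_nth
  | |- PF _ (fun _ => wb (head _ _)) => apply PF_head
  | |- PF _ (fun _ => wb (if _ then _ else _)) => apply PF_wbif
  | |- PF _ (fun _ => wn (if _ then _ else _)) => apply PF_wnif
  | |- PF _ (fun _ => wn (nth _ _ _)) => apply PF_nthl
  | |- PF _ (fun _ => wn (_.+1)) => apply PF_succ
  | |- PF _ (fun _ => wn (_.-1)) => apply PF_pred
  | |- PF _ (fun _ => wn (_ + _)) => apply PF_add
  | |- PF _ (fun _ => wn (_ * _)) => apply PF_mul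
  | |- PF _ (fun _ => wn (_ - _)) => apply PF_sub
  | |- PF _ (fun _ => wn (horner _ _)) => apply PF_horner
  | |- PF _ (fun _ => wn (@size nat _)) => apply PF_sizel
  | |- PF _ (fun _ => wn (size _)) => apply PF_size
  | |- PF _ (fun _ => wl (nums _)) => apply PF_nums
  | |- PF _ (fun _ => wl (_ ++ _)) => apply PF_catl
  | |- PF _ (fun _ => wl (if _ then _ else _)) => apply PF_ifl
  | |- PF _ (fun _ => wl (_ :: _)) => apply PF_consl
  | |- PF _ (fun _ => wl (flatten (map _ (iota 0 _)))) => apply PF_rangel
  | |- PF _ (fun _ => wl (flatten (map _ _))) => apply PF_const_flattenl; intro
  | |- PF _ (fun _ => map _ (iota 0 _)) => apply PF_bits
  | |- PF _ (fun _ => behead _) => apply PF_behead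
  | |- PF _ (fun _ => _ :: _) => apply PF_pushb
  | |- PF _ (fun _ => if _ then _ else _) => apply PF_if
  | |- PF _ (fun _ => _ ++ _) => apply PF_cat
  end.
Ltac pf1 := cbv beta; unfold zip_ctx, rec_ctx, nat_ctx; first [ pf_leaf | pf_op ].
Ltac pf := repeat pf1.

Lemma PF_ufst X (cs : seq (X -> word)) u : PF cs u -> PF cs (fun x => ufst [::] (u x)).
Proof.
move=> Hu; apply: (@PF_word _ cs u (fun x p s => ufst p s) (fun x => size (u x))) => //=.
- exact: PF_nil.
- by pf.
- exact: Hu.1.
- by move=> x p s <-; rewrite catrevE size_cat (leq_trans (size_ufst _ _)) ?leq_addl.
Qed.

Lemma PF_usnd X (cs : seq (X -> word)) u : PF cs u -> PF cs (fun x => usnd [::] (u x)).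
Proof.
move=> Hu; apply: (@PF_word _ cs u (fun x p s => usnd p s) (fun x => size (u x))) => //=.
- exact: PF_nil.
- by pf.
- exact: Hu.1.
- by move=> x p s <-; rewrite catrevE size_cat (leq_trans (size_usnd _ _)) ?leq_addl.
Qed.

Lemma PF_iter_ufst X (cs : seq (X -> word)) n u : PF cs (fun x => wn (n x)) ->
  PF cs u -> PF cs (fun x => iter (n x) (ufst [::]) (u x)).
Proof.
move=> Hn Hu; apply: (@PF_nrec _ cs n (fun x i => iter i (ufst [::]) (u x))
  (fun x => size (u x))) => //=.
- by apply: PF_ufst; pf_leaf.
- exact: Hu.1.
- by move=> x i _; elim: i => //= i IH; apply: leq_trans (size_ufst _ _) IH.
Qed.

Section Verifier.
#[local] Opaque nth size iota has all nums ufst usnd head iter muln addn subn nseq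
  horner flatten map odd eq_op leq.

Variables (n : nat) (lp : bool).

Section Checks.
Variables (ns : seq nat) (S : nat -> bool) (f : nat -> nat -> bool).

(** Entry 0 of the list is the size of the domain, hence the shift by one. *)
Definition field (q t : nat) : nat := nth 0 ns (q * 4 + t.+1).
Definition is_quad (q : nat) : bool := q * 4 + 4 < size ns.

Definition fact_in (k q : nat) : bool :=
  [&& is_quad q, field q 0 == k, S (field q 1), S (field q 2) & S (field q 3)].

(** One round of derivation, [g] being the characteristic word of what is derived so far. As many
    rounds as there are elements suffice. The search runs over more indices than there are facts,
    and [is_quad] discards the surplus. *)
Definition der_step (g : word) : word :=
  [seq has (fun q =>
     [&& fact_in 0 q, field q 3 == c, nth false g (field q 1) & nth false g (field q 2)]
     || has (fun i => fact_in (i + 3) q &&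
          (c == if f i (field q 1) then field q 1 else field q 2)) (iota 0 n))
     (iota 0 (size ns)) | c <- iota 0 (nth 0 ns 0)].

Definition der_set : word := iter (nth 0 ns 0) der_step [::].

Definition bad_check (g : word) : bool :=
  has (fun q => (fact_in 2 q && nth false g (field q 1)) ||
    [&& lp, fact_in 1 q, field q 1 == field q 2 & field q 2 == field q 3])
    (iota 0 (size ns)).

Definition link_check (a b : nat) : bool :=
  has (fun q => [&& is_quad q, field q 0 == 1, field q 1 == a, field q 2 == b
    & field q 3 == b]) (iota 0 (size ns)).

Definition clique_check : bool :=
  all (fun a => all (fun b => [&& S a, S b & a != b] ==>
    (link_check a b || link_check b a)) (iota 0 (nth 0 ns 0))) (iota 0 (nth 0 ns 0)).

End Checks.

(** The equality of lengths says, by [wl_nums], that [w] is a list of numbers. *)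
Definition valid_check (w : word) : bool :=
  let ns := nums w in
  [&& size w == size (wl ns), 0 < nth 0 ns 0,
      has (fun q => size ns == q * 4 + 1) (iota 0 (size ns)) &
      all (fun q => is_quad ns q ==> [&& field ns q 0 < n.+3,
        field ns q 1 < nth 0 ns 0, field ns q 2 < nth 0 ns 0 & field ns q 3 < nth 0 ns 0])
        (iota 0 (size ns))].

Variable j : nat.

(* The input is [w] paired with [n] guesses of length [2 |w|]: the first half of each
   guess is a valuation, the second half of guess [j] selects a clique. *)
Definition base (u : word) : word := iter n (ufst [::]) u.
Definition guess (u : word) (i : nat) : word := usnd [::] (iter (n - i.+1) (ufst [::]) u).
Definition sel (u : word) (a : nat) : bool := lp ==> nth false (guess u j) (size (base u) + a).
Definition vals_of (u : word) (i a : nat) : bool := nth false (guess u i) a.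

(** With [lp], the selected set is meant to range over all cliques under a universal quantifier, so
    a selection that is no clique has to be accepted. *)
Definition verify (u : word) : bool :=
  let ns := nums (base u) in
  valid_check (base u) &&
  ((lp ==> clique_check ns (sel u)) ==>
   ~~ bad_check ns (sel u) (der_set ns (sel u) (vals_of u))).

Lemma PF_guess X (cs : seq (X -> word)) (u : X -> word) (m : X -> nat) :
  PF cs u -> PF cs (fun x => wn (m x)) -> PF cs (fun x => guess (u x) (m x)).
Proof. by move=> H1 H2; apply: PF_usnd; apply: PF_iter_ufst => //; pf. Qed.

Lemma PF_field X (cs : seq (X -> word)) (l : X -> seq nat) (q : X -> nat) t :
  PF cs (fun x => wl (l x)) -> PF cs (fun x => wn (q x)) ->
  PF cs (fun x => wn (field (l x) (q x) t)).
Proof. by move=> H1 H2; rewrite /field; pf. Qed.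

Lemma PF_is_quad X (cs : seq (X -> word)) (l : X -> seq nat) (q : X -> nat) :
  PF cs (fun x => wl (l x)) -> PF cs (fun x => wn (q x)) ->
  PF cs (fun x => wb (is_quad (l x) (q x))).
Proof. by move=> H1 H2; rewrite /is_quad; pf. Qed.

Lemma PF_base X (cs : seq (X -> word)) u : PF cs u -> PF cs (fun x => base (u x)).
Proof. exact: PF_iter_ufst (PF_const _ (wn n)). Qed.

Lemma PF_sel X (cs : seq (X -> word)) (u : X -> word) (a : X -> nat) :
  PF cs u -> PF cs (fun x => wn (a x)) -> PF cs (fun x => wb (sel (u x) (a x))).
Proof.
move=> H1 H2; rewrite /sel; apply: PF_imp; first exact: (PF_const _ (wb lp)).
apply: PF_nth; last by apply: PF_guess H1 (PF_const _ (wn j)).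
by apply: PF_add H2; apply: PF_size; exact: PF_base.
Qed.

Ltac pfv := repeat (cbv beta; lazymatch goal with
  | |- PF _ (fun _ => wn (field _ _ _)) => apply PF_field
  | |- PF _ (fun _ => wb (is_quad _ _)) => apply PF_is_quad
  | |- PF _ (fun _ => wb (sel _ _)) => apply PF_sel
  | |- PF _ (fun _ => wl (nums (base _))) => apply PF_nums
  | |- PF _ (fun _ => base _) => apply PF_base
  | |- PF _ (fun _ => guess _ _) => apply PF_guess
  | |- PF _ (fun _ => wn (fst _)) => pf_leaf
  | |- PF _ (fun _ => wn (snd _)) => pf_leaf
  | |- _ => first [pf_op | pf_leaf]
  end).

Lemma PF_fact_in X (cs : seq (X -> word)) (u : X -> word) (q k : X -> nat) :
  PF cs u -> PF cs (fun x => wn (q x)) -> PF cs (fun x => wn (k x)) ->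
  PF cs (fun x => wb (fact_in (nums (base (u x))) (sel (u x)) (k x) (q x))).
Proof. by move=> H0 H1 H2; rewrite /fact_in; pfv. Qed.

Ltac pff := repeat first [progress (cbv beta; lazymatch goal with
  | |- PF _ (fun _ => wb (fact_in _ _ _ _)) => apply PF_fact_in end) | progress pfv].

Lemma PF_link_check X (cs : seq (X -> word)) (l : X -> seq nat) (a b : X -> nat) :
  PF cs (fun x => wl (l x)) -> PF cs (fun x => wn (a x)) -> PF cs (fun x => wn (b x)) ->
  PF cs (fun x => wb (link_check (l x) (a x) (b x))).
Proof. by move=> H1 H2 H3; rewrite /link_check; pfv. Qed.

Lemma PF_der_step X (cs : seq (X -> word)) (u g : X -> word) : PF cs u -> PF cs g ->
  PF cs (fun x => der_step (nums (base (u x))) (sel (u x)) (vals_of (u x)) (g x)).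
Proof. by move=> H1 H2; rewrite /der_step /vals_of; pff. Qed.

Lemma PF_der_set X (cs : seq (X -> word)) (u : X -> word) : PF cs u ->
  PF cs (fun x => der_set (nums (base (u x))) (sel (u x)) (vals_of (u x))).
Proof.
move=> H; have Hm : PF cs (fun x => wn (nth 0 (nums (base (u x))) 0)) by pfv.
apply: (@PF_nrec _ _ (fun x => nth 0 (nums (base (u x))) 0)
  (fun x i => iter i (der_step (nums (base (u x))) (sel (u x)) (vals_of (u x))) [::])
  (fun x => nth 0 (nums (base (u x))) 0)) => //.
- exact: PF_nil.
- apply: (PF_ext (f := fun z => der_step (nums (base (u z.1))) (sel (u z.1)) (vals_of (u z.1))
    (iter z.2 (der_step (nums (base (u z.1))) (sel (u z.1)) (vals_of (u z.1))) [::]))).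
    by move=> z; rewrite iterS.
  by apply: PF_der_step; pf_leaf.
- exact: PB_wn.
- by move=> x [|i] _ //=; rewrite size_map size_iota.
Qed.

Lemma PF_verify : PF [:: id] (fun u => wb (verify u)).
Proof.
have Hu : PF [:: id] (fun u : word => u) by exact: (@PF_var _ [:: id] 0 isT).
have Hb : PF [:: id] base by exact: PF_base Hu.
have Hw : PF [:: id] (fun u => wl (nums (base u))) by exact: PF_nums Hb.
have Hd := PF_der_set Hu.
rewrite /verify /valid_check /clique_check /bad_check.
repeat first [progress (cbv beta; lazymatch goal with
  | |- PF _ (fun _ => wb (link_check _ _ _)) => apply PF_link_check
  | |- PF _ (fun _ => der_set _ _ _) => pf_leaf end) | progress pff].
Qed.

End Verifier.

(** * Correctness of the checks *)

Definition valid_quad (n m : nat) (x : seq nat) : bool :=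
  [&& size x == 4, nth 0 x 0 < n.+3 & all (fun a => a < m) (behead x)].

Definition quad_rel m (qs : seq (seq nat)) : tern 'I_m :=
  fun k a b c => [:: k; val a; val b; val c] \in qs.

Section Semantics.
Variables (n m : nat) (lp : bool) (qs : seq (seq nat)).
Hypothesis qs_valid : all (valid_quad n m) qs.
Let ns := m :: flatten qs.
Let R : tern 'I_m := quad_rel qs.

Let size_flat : size (flatten qs) = size qs * 4.
Proof.
elim: qs qs_valid => //= x l IH /andP[/and3P[/eqP sx _ _] /IH Hl].
by rewrite size_cat sx Hl mulSn.
Qed.

Lemma is_quadE q : is_quad ns q = (q < size qs).
Proof. by rewrite /is_quad /= size_flat; lia. Qed.

Lemma fieldE q t : q < size qs -> t < 4 -> field ns q t = nth 0 (nth [::] qs q) t.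
Proof.
rewrite /field addnS /=; elim: qs qs_valid q => //= x l IH /andP[/and3P[/eqP sx _ _] Hl] [|q] Hq Ht.
  by rewrite nth_cat sx Ht.
by rewrite nth_cat sx mulSn -addnA ltnNge leq_addr /= addKn IH.
Qed.

(** The searches through the list of facts are brought into this form, which refers to [R] alone. *)
Lemma quad_hasP (P : nat -> nat -> nat -> nat -> bool) :
  has (fun q => is_quad ns q && P (field ns q 0) (field ns q 1) (field ns q 2) (field ns q 3))
    (iota 0 (size ns)) <->
  exists k (a b c : 'I_m), R k a b c /\ P k a b c.
Proof.
split=> [/hasP[q _ /andP[]]|[k [a [b [c [HR HP]]]]]].
  rewrite is_quadE => Hq; rewrite !fieldE //.
  have Hx : nth [::] qs q \in qs by rewrite mem_nth.
  have := allP qs_valid _ Hx; move: Hx.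
  case: (nth [::] qs q) => [|k [|a [|b [|c [|? ?]]]]] // Hx /and3P[_ _] /=.
  rewrite andbT => /and3P[Ha Hb Hc] HP.
  by exists k, (Ordinal Ha), (Ordinal Hb), (Ordinal Hc).
have [i Hi Ei] : exists2 i, i < size qs & nth [::] qs i = [:: k; val a; val b; val c].
  by exists (index [:: k; val a; val b; val c] qs); rewrite ?index_mem ?nth_index.
apply/hasP; exists i; first by rewrite mem_iota /= size_flat; lia.
by rewrite is_quadE Hi !fieldE // Ei.
Qed.

Variables (S : nat -> bool) (f : nat -> nat -> bool).
Let SP : 'I_m -> Prop := fun a => S a.
Let fP : nat -> 'I_m -> bool := fun i a => f i a.

(** A round of derivation as a monotone operator on subsets; its least fixed point [fixset] is an
    iterate indexed by the number of elements, exactly as in [der_set]. *)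
Let dop (X : {set 'I_m}) : {set 'I_m} :=
  [set c : 'I_m | `[< (exists a b, [/\ R 0 a b c, [/\ SP a, SP b & SP c], a \in X & b \in X]) \/
     (exists i a b d, [/\ R (i + 3) a b d, [/\ SP a, SP b & SP d] &
        c = if fP i a then a else b]) >]].

Let dop_mono : {homo dop : X Y / X \subset Y}.
Proof.
move=> X Y /fintype.subsetP XY; apply/fintype.subsetP => c; rewrite !inE.
case=> [[a [b [HR HS Ha Hb]]]|H]; last by right.
by left; exists a, b; split=> //; exact: XY.
Qed.

Let der_step_dop g (X : {set 'I_m}) : (forall c : 'I_m, nth false g c = (c \in X)) ->
  forall c : 'I_m, nth false (der_step n ns S f g) c = (c \in dop X).
Proof.
move=> Hg c; rewrite /der_step (nth_map 0) ?size_iota // nth_iota // add0n inE.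
pose P (k' a b d : nat) := [&& k' == 0, S a, S b, S d, d == c, nth false g a & nth false g b] ||
  has (fun i => [&& k' == i + 3, S a, S b, S d & val c == if f i a then a else b]) (iota 0 n).
rewrite (eq_has (a2 := fun q => is_quad ns q &&
    P (field ns q 0) (field ns q 1) (field ns q 2) (field ns q 3))); last first.
  move=> q; rewrite /P /fact_in; case: (is_quad ns q) => /=; last first.
    by apply/hasPn.
  by rewrite -!andbA; congr (_ || _); apply: eq_has => i; rewrite -!andbA.
apply/(sameP idP)/(iffP idP).
  move/asboolP => H; apply/quad_hasP; case: H.
    case=> a [b [HR [Sa Sb Sc] Ha Hb]]; exists 0, a, b, c; split=> //.
    by rewrite /P !Hg Ha Hb (Sa : S a) (Sb : S b) (Sc : S c) !eqxx.
  case=> i [a [b [d [HR [Sa Sb Sd] Hc]]]]; exists (i + 3), a, b, d; split=> //.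
  apply/orP; right; apply/hasP; exists i.
    have /and3P[_ /= Hi _] := allP qs_valid _ HR.
    by rewrite mem_iota; lia.
  by rewrite eqxx (Sa : S a) (Sb : S b) (Sd : S d) Hc /fP /=; case: ifP; rewrite eqxx.
move/quad_hasP => [k [a [b [d [HR /orP[]]]]]].
  case/and5P => /eqP Hk Sa Sb Sd /and3P[/eqP Hd Ha Hb]; apply/asboolP; left.
  have Ed : d = c by apply: val_inj.
  by exists a, b; rewrite -!Hg -Ed -Hk.
case/hasP => i _ /and5P[/eqP Hk Sa Sb Sd /eqP Hc]; apply/asboolP; right.
exists i, a, b, d; rewrite -Hk; split=> //; apply: val_inj.
by rewrite Hc /fP /=; case: ifP.
Qed.

Lemma der_setP (c : 'I_m) : nth false (der_set n ns S f) c <-> der R SP fP c.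
Proof.
have E i (d : 'I_m) : nth false (iter i (der_step n ns S f) [::]) d = (d \in iter i dop finset.set0).
  elim: i d => [|i IH] d; first by rewrite nth_nil inE.
  by rewrite !iterS (der_step_dop IH).
have -> : nth false (der_set n ns S f) c = (c \in fixset dop).
  by rewrite /der_set E /fixset card_ord.
split.
  rewrite /fixset; elim: #|_| c => [|i IH] c; first by rewrite inE.
  rewrite iterS inE => /asboolP[[a [b [HR [Sa Sb Sc] /IH Ha /IH Hb]]]|].
    exact: der_rule HR Sa Sb Sc Ha Hb.
  by case=> j [a [b [d [HR [Sa Sb Sd] ->]]]]; exact: der_read HR Sa Sb Sd.
elim=> {c} [i a b d HR Sa Sb Sd|a b c HR Sa Sb Sc _ Ha _ Hb]; rewrite -(fixsetK dop_mono) inE;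
  apply/asboolP.
  by right; exists i, a, b, d.
by left; exists a, b.
Qed.

Lemma bad_checkP (fs : seq ('I_m -> bool)) :
  (forall i a, i < n -> val_of fs i a = fP i a) ->
  bad_check lp ns S (der_set n ns S f) <-> bad R SP lp fs.
Proof.
move=> Hfs.
(* Symbols are below [n + 3], so derivations consult only the first [n] valuations. *)
have Hder a : der R SP (val_of fs) a <-> der R SP fP a.
  have der_eq f1 f2 : (forall i a, i < n -> f1 i a = f2 i a) -> der R SP f1 a -> der R SP f2 a.
    move=> E; elim=> {a} [i a b d HR Sa Sb Sd|a b c HR Sa Sb Sc _ Ha _ Hb].
      have /and3P[_ /= Hi _] := allP qs_valid _ HR.
      by rewrite E; [exact: der_read HR Sa Sb Sd | lia].
    exact: der_rule HR Sa Sb Sc Ha Hb.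
  by split; apply: der_eq => i b Hi; rewrite Hfs.
pose P (k a b d : nat) := [&& k == 2, S a, S b, S d & nth false (der_set n ns S f) a] ||
  [&& lp, k == 1, S a, S b, S d, a == b & b == d].
rewrite /bad_check (eq_has (a2 := fun q => is_quad ns q &&
    P (field ns q 0) (field ns q 1) (field ns q 2) (field ns q 3))); last first.
  move=> q; rewrite /P /fact_in; case: (is_quad ns q) => /=; last by rewrite andbF.
  by rewrite -!andbA.
rewrite quad_hasP; split.
  case=> k [a [b [d [HR /orP[/and5P[/eqP Hk Sa Sb Sd /der_setP Ha]|]]]]].
    by left; exists a, b, d; rewrite -Hk; split=> //; apply/Hder.
  case/and5P => Hl /eqP Hk Sa Sb /and3P[Sd /eqP/val_inj Eab /eqP/val_inj Ebd].
  by right; split=> //; exists a => //; rewrite -Ebd -Eab Hk in HR.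
case=> [[a [b [d [HR Sa Sb Sd /Hder /der_setP Ha]]]]|[Hl [a Sa HR]]].
  exists 2, a, b, d; split=> //; apply/orP; left.
  by rewrite Ha (Sa : S a) (Sb : S b) (Sd : S d).
exists 1, a, a, a; split=> //; apply/orP; right.
by rewrite Hl (Sa : S a) !eqxx.
Qed.

Lemma clique_checkP : clique_check ns S <-> clique R SP.
Proof.
have link a b : link_check ns (val (a : 'I_m)) (val (b : 'I_m)) <-> R 1 a b b.
  pose P (k a' b' d' : nat) := [&& k == 1, a' == val a, b' == val b & d' == val b].
  rewrite /link_check (quad_hasP P); split.
    case=> k [a' [b' [d' [HR /and4P[/eqP Hk /eqP/val_inj Ha /eqP/val_inj Hb /eqP/val_inj Hd]]]]].
    by rewrite Hk Ha Hb Hd in HR.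
  by move=> HR; exists 1, a, b, b; rewrite /P !eqxx.
split=> [/allP H a b Sa Sb ab|H].
  have Hi (d : 'I_m) : val d \in iota 0 (nth 0 ns 0) by rewrite mem_iota /= ltn_ord.
  have := allP (H _ (Hi a)) _ (Hi b).
  rewrite (Sa : S (val a)) (Sb : S (val b)) /=; case: eqP => [/val_inj //|_] /= /orP[] /link; by [left|right].
apply/allP => a; rewrite mem_iota /= => Ha; apply/allP => b; rewrite mem_iota /= => Hb.
apply/implyP => /and3P[Sa Sb /eqP ab].
have := H (Ordinal Ha) (Ordinal Hb) Sa Sb (fun E => ab (congr1 val E)).
by case=> /link ->; rewrite ?orbT.
Qed.

End Semantics.

(** * Encoded structures as lists of quadruples *)

Section Encoding.
Variables (n m : nat).
Local Notation sg := (horn_sig n).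

Definition quad_of (a : fact sg m.+1) : seq nat :=
  nat_of_ord (tag a) :: [seq nat_of_ord i | i <- (tagged a : seq 'I_m.+1)].

Definition of_quad (x : seq nat) : fact sg m.+1 :=
  @Tagged 'I_(nsymb sg) (inord (nth 0 x 0)) (fun s => (arity s).-tuple 'I_m.+1)
    [tuple inord (nth 0 x 1); inord (nth 0 x 2); inord (nth 0 x 3)].

Lemma encode_factE (a : fact sg m.+1) : encode_fact a = wl (quad_of a).
Proof. by rewrite /encode_fact /wl /= -map_comp. Qed.

Lemma quad_ofE (s : 'I_n.+3) (t : 3.-tuple 'I_m.+1) :
  quad_of (@Tagged 'I_(nsymb sg) s (fun s => (arity s).-tuple 'I_m.+1) t) =
  [:: val s; val (tnth t (@Ordinal 3 0 isT)); val (tnth t (@Ordinal 3 1 isT));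
     val (tnth t (@Ordinal 3 2 isT))].
Proof. by rewrite /quad_of /= {1}(tuple3E t). Qed.

Lemma of_quadK a : of_quad (quad_of a) = a.
Proof.
case: a => s t; rewrite (quad_ofE s t) /of_quad /= !inord_val.
by congr existT; rewrite [RHS](tuple3E (t : 3.-tuple _)).
Qed.

Lemma quad_ofK x : valid_quad n m.+1 x -> quad_of (of_quad x) = x.
Proof.
case: x => [|k [|a [|b [|c [|? ?]]]]] // /and3P[_ /= Hk /and4P[Ha Hb Hc _]].
by rewrite /quad_of /= !inordK.
Qed.

Lemma valid_quad_of a : valid_quad n m.+1 (quad_of a).
Proof.
case: a => s t; rewrite /valid_quad /= size_map size_tuple eqxx ltn_ord /=.
by apply/allP => _ /mapP[i _ ->]; exact: ltn_ord.
Qed.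

Lemma encodesP (A : structure sg 'I_m.+1) w : encodes A w <->
  exists qs, [/\ all (valid_quad n m.+1) qs, w = wl (m.+1 :: flatten qs) &
    tern_of A = quad_rel qs].
Proof.
have wE (facts : seq (fact sg m.+1)) :
    encode_nat m.+1 ++ flatten [seq encode_fact a | a <- facts] =
    wl (m.+1 :: flatten (map quad_of facts)).
  rewrite wl_cons wl_flatten -!map_comp /encode_nat cat_rcons.
  by congr (_ ++ _ :: flatten _); apply: eq_map => a; rewrite /= encode_factE.
split=> [[facts -> HA]|[qs [Hq -> HA]]].
  exists (map quad_of facts); split=> //.
    by apply/allP => _ /mapP[a _ ->]; exact: valid_quad_of.
  apply: funext => k; apply: funext => a; apply: funext => b; apply: funext => c.
  apply/propext; split=> [[s <- /HA Hs]|/mapP[[s t] Hs]].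
    by apply/mapP; eexists; [exact: Hs | rewrite quad_ofE].
  rewrite (quad_ofE s t) => -[-> /val_inj -> /val_inj -> /val_inj ->].
  by exists s => //; apply/HA; rewrite -(tuple3E (t : 3.-tuple _)).
exists (map of_quad qs).
  rewrite wE -map_comp (_ : map _ qs = qs) //.
  by rewrite -[RHS]map_id; apply/eq_in_map => x /(allP Hq) /quad_ofK.
move=> s t; have E : A s t <-> tern_of A s (tnth (t : 3.-tuple _) (@Ordinal 3 0 isT))
    (tnth (t : 3.-tuple _) (@Ordinal 3 1 isT)) (tnth (t : 3.-tuple _) (@Ordinal 3 2 isT)).
  split=> [HAt|[s' /val_inj ->]]; last by rewrite -(tuple3E (t : 3.-tuple _)).
  by exists s; rewrite -?(tuple3E (t : 3.-tuple _)).
rewrite E HA /quad_rel -(quad_ofE s t); split=> [Ht|/mapP[x Hx ->]].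
  by apply/mapP; eexists; [exact: Ht | rewrite of_quadK].
by rewrite quad_ofK //; exact: (allP Hq).
Qed.

End Encoding.

Lemma valid_checkP n w : valid_check n w <->
  exists m qs, all (valid_quad n m.+1) qs /\ w = wl (m.+1 :: flatten qs).
Proof.
split.
  rewrite /valid_check wl_nums => /and4P[/eqP Hw H0 /hasP[q _ /eqP Hq] /allP Hall].
  move: Hw H0 Hq Hall; case: (nums w) => [|[|m] ns] // Hw _ Hq Hall.
  rewrite addn1 in Hq; case: Hq => Hq.
  have Hr : sumn (nseq q 4) = size ns by rewrite sumn_nseq Hq mulnC.
  pose qs := reshape (nseq q 4) ns.
  have Eqs : flatten qs = ns by rewrite reshapeKr // Hr.
  exists m, qs; rewrite Eqs; split=> //.
  have Sqs : all (fun x => size x == 4) qs.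
    have /(congr1 (all (fun k => k == 4))) : shape qs = nseq q 4 by rewrite reshapeKl // Hr.
    by rewrite all_nseq orbT /shape all_map.
  have szqs : size qs = q.
    by rewrite -(size_map size) -/(shape qs) reshapeKl ?size_nseq // Hr.
  have fE l t' i : all (fun x => size x == 4) l -> i < size l -> t' < 4 ->
      nth 0 (flatten l) (i * 4 + t') = nth 0 (nth [::] l i) t'.
    elim: l i => //= x l IH [|i] /andP[/eqP sx Hl] Hi Ht; first by rewrite nth_cat sx Ht.
    by rewrite nth_cat sx mulSn -addnA ltnNge leq_addr /= addKn IH.
  apply/allP => x /(nthP [::]) [i Hi Ex]; rewrite szqs in Hi.
  have Hi' : i \in iota 0 (size ns).+1 by rewrite mem_iota /=; lia.
  have fE' t' : t' < 4 -> field (m.+1 :: ns) i t' = nth 0 x t'.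
    by move=> Ht; rewrite /field addnS /= -Eqs fE ?szqs // Ex.
  have := Hall i Hi'; rewrite !fE' //.
  have -> : is_quad (m.+1 :: ns) i by rewrite /is_quad /=; lia.
  have : size x == 4 by apply: (allP Sqs); rewrite -Ex mem_nth ?szqs.
  by case: x {Ex fE'} => [|a [|b [|c [|d [|? ?]]]]] //= _; rewrite /valid_quad /= andbT.
case=> m [qs [Hq ->]]; rewrite /valid_check nums_wl eqxx.
have sz : size (flatten qs) = size qs * 4.
  elim: qs Hq => //= x l IH /andP[/and3P[/eqP sx _ _] /IH Hl].
  by rewrite size_cat sx Hl mulSn.
apply/and4P; split=> //.
  by apply/hasP; exists (size qs); rewrite ?mem_iota /= sz; lia.
apply/allP => q _; rewrite (is_quadE Hq); apply/implyP => Hqs.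
rewrite !(fieldE Hq) //; have := allP Hq _ (mem_nth [::] Hqs).
by case: (nth _ _ _) => [|a [|b [|c [|d [|? ?]]]]] //= /and3P[_ -> /=]; rewrite andbT.
Qed.

Lemma wl_inj ns ns' : wl ns = wl ns' -> ns = ns'.
Proof. by move/(congr1 nums); rewrite !nums_wl. Qed.

Lemma flatten_inj n m (qs qs' : seq (seq nat)) : all (valid_quad n m) qs ->
  all (valid_quad n m) qs' -> flatten qs = flatten qs' -> qs = qs'.
Proof.
elim: qs qs' => [|x l IH] [|x' l'] //=.
- by move=> _ /andP[+ _]; case: x' => //.
- by move=> /andP[+ _]; case: x => //.
move=> /andP[/and3P[/eqP sx _ _] Hl] /andP[/and3P[/eqP sx' _ _] Hl'] /eqP.
by rewrite eqseq_cat ?sx ?sx' // => /andP[/eqP -> /eqP /(IH _ Hl Hl') ->].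
Qed.

(* [spec] is the condition under which a finite structure maps to the template. *)
Lemma CSPP n T (D : structure (horn_sig n) T) (spec : forall m, tern 'I_m -> Prop) :
  (forall m (A : structure (horn_sig n) 'I_m.+1),
     (exists h, homomorphism A D h) <-> spec _ (tern_of A)) ->
  forall w, CSP D w <->
    exists m qs, [/\ all (valid_quad n m.+1) qs, w = wl (m.+1 :: flatten qs) &
      spec m.+1 (quad_rel qs)].
Proof.
move=> HD w; split=> [[m [A [/encodesP [qs [Hq Hw E]] /HD H]]]|[m [qs [Hq Hw H]]]].
  by exists m, qs; rewrite -E.
pose A : structure (horn_sig n) 'I_m.+1 := @struct_of n _ (quad_rel qs).
have E : tern_of A = quad_rel qs.
  apply: funext => k; apply: funext => a; apply: funext => b; apply: funext => c.
  apply/propext; split=> [[s <-] //|H'].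
  have /and3P[_ /= Hk _] := allP Hq _ H'.
  by exists (Ordinal Hk).
exists m, A; split; last by apply/HD; rewrite E.
by apply/encodesP; exists qs; rewrite E.
Qed.

(** * Membership: from guessed words to valuations and cliques *)

Lemma iter_ufst w ys1 ys2 :
  iter (size ys2) (ufst [::]) (foldl pairing w (ys1 ++ ys2)) = foldl pairing w ys1.
Proof.
elim/last_ind: ys2 => [|ys2 y IH]; first by rewrite cats0.
by rewrite size_rcons iterSr -rcons_cat foldl_rcons ufst_pairing.
Qed.

Lemma base_foldl n w ys : size ys = n -> base n (foldl pairing w ys) = w.
Proof. by move=> <-; exact: (iter_ufst w [::]). Qed.

Lemma guess_foldl n w ys i : size ys = n -> i < n ->
  guess n (foldl pairing w ys) i = nth [::] ys i.
Proof.
move=> Hs Hi; rewrite /guess -{1}(cat_take_drop i.+1 ys).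
have -> : n - i.+1 = size (drop i.+1 ys) by rewrite size_drop Hs.
by rewrite iter_ufst (take_nth [::]) ?Hs // foldl_rcons usnd_pairing.
Qed.

(** The guesses are kept in a list, as the valuations are in [qalt], and not paired into one
    word. *)
Fixpoint altw (ex : bool) (k l : nat) (Phi : seq word -> Prop) (ys : seq word) : Prop :=
  if k is k'.+1 then
    if ex then exists y : l.-tuple bool, altw false k' l Phi (rcons ys y)
    else forall y : l.-tuple bool, altw true k' l Phi (rcons ys y)
  else Phi ys.

Lemma alternationE ex k l V w ys :
  alternation ex k l V (foldl pairing w ys) <->
  altw ex k l (fun ys => V (foldl pairing w ys)) ys.
Proof.
elim: k ex ys => //= k IH [] ys.
  by split=> -[y Hy]; exists y; move: Hy; rewrite -IH foldl_rcons.
by split=> H y; move: (H y); rewrite -IH foldl_rcons.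
Qed.

Lemma altw_ext ex k l Phi Psi ys :
  (forall ys', size ys' = k -> all (fun y => size y == l) ys' ->
     (Phi (ys ++ ys') <-> Psi (ys ++ ys'))) ->
  altw ex k l Phi ys <-> altw ex k l Psi ys.
Proof.
elim: k ex ys => [|k IH] ex ys H /=; first by have := H [::]; rewrite cats0; apply.
have H' (y : l.-tuple bool) b : altw b k l Phi (rcons ys y) <-> altw b k l Psi (rcons ys y).
  apply: IH => ys' Hs Ha; rewrite cat_rcons; apply: H; rewrite /= ?Hs //.
  by rewrite size_tuple eqxx.
case: ex; first by split=> -[y /H' Hy]; exists y.
by split=> Hy y; apply/H'.
Qed.

Definition bits_fun M (y : word) : 'I_M -> bool := fun a => nth false y a.
Arguments bits_fun : clear implicits.

(** Both halves of a guess can be prescribed independently, so one quantifier over words ranges over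
    pairs of a valuation and a set. *)
Lemma bits_fun_onto M l (f : 'I_M -> bool) (S : 'I_M -> Prop) L : M <= L -> L + M <= l ->
  exists y : l.-tuple bool, bits_fun M y = f /\ (fun a : 'I_M => is_true (nth false y (L + a))) = S.
Proof.
move=> ML LMl.
pose g i := if insub i is Some a then f a else false.
pose h i := if insub i is Some a then `[< S a >] else false.
exists [tuple of mkseq (fun i => if i < L then g i else h (i - L)) l]; split; apply: funext => a.
  have aL : a < L by apply: leq_trans ML.
  by rewrite /bits_fun nth_mkseq ?aL /g ?valK //; lia.
rewrite nth_mkseq; last by have := ltn_ord a; lia.
rewrite ltnNge leq_addr /= addKn /h valK.
by apply/propext; split=> /asboolP.
Qed.

Lemma altw_qalt M ex k l (Phi : seq word -> Prop) Psi ys : M.*2 <= l ->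
  (forall ys', size ys' = k ->
     (Phi (ys ++ ys') <-> Psi (map (bits_fun M) (ys ++ ys')))) ->
  altw ex k l Phi ys <-> qalt ex k Psi (map (bits_fun M) ys).
Proof.
move=> Ml; elim: k ex ys => [|k IH] ex ys H /=; first by have := H [::]; rewrite !cats0; apply.
have H' (y : l.-tuple bool) b : altw b k l Phi (rcons ys y) <->
    qalt b k Psi (rcons (map (bits_fun M) ys) (bits_fun M y)).
  rewrite -map_rcons; apply: IH => ys' Hs; rewrite cat_rcons; apply: H.
  by rewrite /= Hs.
have onto f : exists y : l.-tuple bool, bits_fun M y = f.
  have [||y [Hy _]] := @bits_fun_onto M l f (fun=> True) M; rewrite ?addnn //.
  by exists y.
case: ex.
  split=> [[y /H' Hy]|[f]]; first by exists (bits_fun M y).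
  by have [y <-] := onto f => /H' Hy; exists y.
split=> [Hy f|Hf y]; last by apply/H'.
by have [y <-] := onto f; apply/H'.
Qed.

Lemma qalt_if T ex k (P : Prop) (Phi : seq (T -> bool) -> Prop) fs :
  qalt ex k (fun fs => P -> Phi fs) fs <-> (P -> qalt ex k Phi fs).
Proof.
split=> [H HP|H]; first by apply: qalt_impl H => fs'; apply.
case: (pselect P) => HP; last by apply: qalt_all.
by apply: qalt_impl (H HP) => fs'.
Qed.

Section Membership.
Variables (n : nat) (lp : bool) (j : nat) (m : nat) (qs : seq (seq nat)).
Hypothesis qs_valid : all (valid_quad n m.+1) qs.
Hypothesis jn : j < n.
Let w := wl (m.+1 :: flatten qs).
Let R : tern 'I_m.+1 := quad_rel qs.
Let l := (size w).*2.
Let V : language := [set u | verify n lp j u]%classic.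

Let selP (y : word) : 'I_m.+1 -> Prop := fun a => nth false y (size w + a).

Let mw : m.+1 <= size w.
Proof. by rewrite /w wl_cons size_cat size_nseq leq_addr. Qed.

Let m2l : m.+1.*2 <= l.
Proof. by rewrite /l leq_double. Qed.

Lemma verifyP ys : size ys = n ->
  V (foldl pairing w ys) <->
  let S := if lp then selP (nth [::] ys j) else fun=> True in
  ((lp -> clique R S) -> ~ bad R S lp (map (bits_fun m.+1) ys)).
Proof.
move=> Hs; rewrite /V /verify /= base_foldl // nums_wl.
have Hv : valid_check n w by apply/valid_checkP; exists m, qs.
set u := foldl pairing w ys; set Sb := sel n lp j u.
have -> : (if lp then selP (nth [::] ys j) else fun=> True) = (fun a : 'I_m.+1 => is_true (Sb a)).
  apply: funext => a; rewrite /Sb /sel /u guess_foldl // base_foldl //.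
  by case: (lp) => //=; apply/propext; split.
have Hbad := @bad_checkP n m.+1 lp qs qs_valid Sb (vals_of n u) (map (bits_fun m.+1) ys) _.
rewrite Hv /=; split.
  move/implyP => H Hc /Hbad Hb.
  have/negP : ~~ bad_check lp (m.+1 :: flatten qs) Sb
      (der_set n (m.+1 :: flatten qs) Sb (vals_of n u)).
    by apply: H; apply/implyP => /Hc /(clique_checkP qs_valid).
  apply; apply: Hb => i a Hi.
  by rewrite /val_of (nth_map [::]) ?Hs // /vals_of /u guess_foldl.
move=> H; apply/implyP => /implyP Hc; apply/negP => /Hbad Hb.
apply: H; first by move=> /Hc /(clique_checkP qs_valid).
apply: Hb => i a Hi.
by rewrite /val_of (nth_map [::]) ?Hs // /vals_of /u guess_foldl.
Qed.

Lemma verify_np : n = 1 -> lp = false ->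
  alternation true n l V w <-> exists f, ~ bad R (fun=> True) false [:: f].
Proof.
move=> n1 lpF; rewrite -[w]/(foldl pairing w [::]) alternationE.
rewrite (@altw_qalt m.+1 _ _ _ _ (fun fs => ~ bad R (fun=> True) false fs)) //; last first.
  move=> ys' Hs; rewrite verifyP // lpF /=; split=> [H|H _]; last exact: H.
  by apply: H.
by rewrite n1.
Qed.

(** Once guess [j] is made the selected set is fixed, so the premise that it is a clique moves out
    of the remaining quantifiers. *)
Let verify_mid k (ys : seq word) (y : l.-tuple bool) : lp = true -> size ys = j -> n = j.+1 + k ->
  altw true k l (fun ys => V (foldl pairing w ys)) (rcons ys y) <->
  (clique R (selP y) ->
   qalt true k (fun fs => ~ bad R (selP y) true fs) (rcons (map (bits_fun m.+1) ys) (bits_fun m.+1 y))).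
Proof.
move=> lpT Hj Hn; rewrite -qalt_if -map_rcons; apply: altw_qalt => // ys' Hs.
rewrite verifyP; last by rewrite size_cat size_rcons Hj Hs.
rewrite lpT /= nth_cat size_rcons Hj ltnSn nth_rcons Hj ltnn eqxx.
by split=> H Hc; [apply: H | apply: H; apply: Hc].
Qed.

Let level (Q : ('I_m.+1 -> Prop) -> ('I_m.+1 -> bool) -> Prop) :
  (forall y : l.-tuple bool, clique R (selP y) -> Q (selP y) (bits_fun m.+1 y)) <->
  (forall S, clique R S -> forall f, Q S f).
Proof.
split=> [H S HS f|H y Hy]; last exact: H.
have [||y [Ey ES]] := @bits_fun_onto m.+1 l f S (size w); first exact: mw.
  by rewrite /l -addnn leq_add2l.
by rewrite -Ey -ES; apply: H; rewrite /selP ES.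
Qed.

Let cliquesE sigma k c : cliques_good sigma k R c <->
  (forall S, clique R S -> good sigma k R c S).
Proof.
split=> [H S HS|H s S _ HS]; last exact: H.
by apply: (H (enum 'I_m.+1)) => // a _; rewrite mem_enum.
Qed.

Lemma verify_pi : lp = true -> j = 0 ->
  alternation false n l V w <-> exists c, cliques_good false n R c.
Proof.
move=> lpT j0; rewrite -[w]/(foldl pairing w [::]) alternationE.
have [k nk] : exists k, n = k.+1 by exists n.-1; rewrite prednK // (leq_ltn_trans _ jn).
have step c : (forall y : l.-tuple bool, altw true k l (fun ys => V (foldl pairing w ys)) [:: tval y])
   <-> cliques_good false n R c.
  rewrite cliquesE /good [in X in qalt _ X]nk /= -level.
  by split=> H y; [move=> Hy; have /(@verify_mid k [::] y) := H y; rewrite ?j0 ?nk; apply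
    | apply/(@verify_mid k [::] y); rewrite ?j0 ?nk //; exact: H].
(* With [sigma] false the list of valuations starts empty, so the constant colour can serve as
   [c]. *)
rewrite {1}nk /=; split=> [/(step (fun=> false)) H|[c /step]] //.
by exists (fun=> false).
Qed.

(** Guess 0 is the colour, so the clique is selected by guess 1, the first universal one. *)
Lemma verify_sigma k : lp = true -> j = 1 -> n = k.+2 ->
  alternation true n l V w <-> exists c, cliques_good true k.+1 R c.
Proof.
move=> lpT j1 nk; rewrite -[w]/(foldl pairing w [::]) alternationE {1}nk /=.
have step (z : l.-tuple bool) :
   (forall y : l.-tuple bool, altw true k l (fun ys => V (foldl pairing w ys)) [:: tval z; tval y])
   <-> cliques_good true k.+1 R (bits_fun m.+1 z).
  rewrite cliquesE /good /= -level.
  by split=> H y; [move=> Hy; have /(@verify_mid k [:: tval z] y) := H y; rewrite ?j1 ?nk; apply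
    | apply/(@verify_mid k [:: tval z] y); rewrite ?j1 ?nk //; exact: H].
split=> [[z /step Hz]|[c Hc]]; first by exists (bits_fun m.+1 z).
have [||z [Ez _]] := @bits_fun_onto m.+1 l c (fun=> True) (size w); first exact: mw.
  by rewrite /l -addnn leq_add2l.
by exists z; apply/step; rewrite Ez.
Qed.

End Membership.

(* The valuation read by symbol 3 turns [a] on or else [b], which is [a || b] for
   the set of derivable elements. *)
Definition bool_rel : tern bool := fun k a b c =>
  match k with
  | 0 => a && b ==> c
  | 1 => true
  | 2 => ~~ a
  | _ => a || b
  end.

Lemma bool_categorical n : omega_categorical (struct_of (n := n) bool_rel).
Proof.
split; first exact: countableP.
move=> K _.
pose g (X : {ffun K.-tuple bool -> bool}) : set (K.-tuple bool) := [set v | X v]%classic.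
apply: (@sub_finite_set _ _ (g @` setT)%classic); last first.
  by apply: finite_image; exact: finite_finset.
move=> R _ /=; exists [ffun t => `[< R t >]] => //.
by apply/seteqP; split=> v; rewrite /g /= ffunE => /asboolP.
Qed.

(** A homomorphism [h], used as the valuation, contains everything it derives; conversely the set of
    elements derivable from [f] is a homomorphism. *)
Lemma bool_hom m (A : structure (horn_sig 1) 'I_m) :
  (exists h, homomorphism A (struct_of bool_rel) h) <->
  (exists f, ~ bad (tern_of A) (fun=> True) false [:: f]).
Proof.
split=> [[h /hom_tern Hh]|[f Hf]].
  have derh a : der (tern_of A) (fun=> True) (val_of [:: h]) a -> h a.
    elim=> {a} [i a b c HR _ _ _|a b c HR _ _ _ _ Ha _ Hb].
      have := tern_of_lt HR; case: i HR => [|i] HR; last by rewrite addn3.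
      move=> _; have := Hh _ _ _ _ HR; rewrite /val_of /=.
      by case: ifP => // ->.
    by have := Hh _ _ _ _ HR; rewrite /= Ha Hb.
  exists h => -[[a [b [c [HR _ _ _ /derh Ha]]]]|[] //].
  by have := Hh _ _ _ _ HR; rewrite /= Ha.
pose h a := `[< der (tern_of A) (fun=> True) (val_of [:: f]) a >].
exists h; apply/hom_tern => -[|[|[|i]]] a b c HR //=.
- by apply/implyP => /andP[/asboolP Ha /asboolP Hb]; apply/asboolP; exact: der_rule HR _ _ _ Ha Hb.
- apply/asboolPn => Ha; apply: Hf; left; exists a, b, c; split=> //.
- have H : der (tern_of A) (fun=> True) (val_of [:: f]) (if val_of [:: f] i a then a else b).
    by rewrite -addn3 in HR; exact: der_read HR _ _ _.
  by case: ifP H => _ /asboolP H; rewrite /h H ?orbT.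
Qed.

Section Complete.
Variables (T : eqType) (R : tern T) (l : seq T).
Hypothesis lT : forall a, a \in l.
Hypothesis linked : forall a b, a <> b -> R 1 a b b \/ R 1 b a a.
Hypothesis loopless : forall a, ~ R 1 a a a.

Let bad_all S fs : bad R S true fs -> bad R (fun=> True) false fs.
Proof.
case=> [[a [b [c [HR _ _ _ Ha]]]]|[_ [a _ /loopless //]]].
left; exists a, b, c; split=> //.
exact: (@der_mono _ _ R R S (fun=> True) id) Ha.
Qed.

(** The whole domain is a clique, and it is the worst one, since what is bad on a subset is bad on
    the whole. Instances of this form make the condition on cliques a single alternation. *)
Lemma complete_good sigma k c : cliques_good sigma k R c <->
  qalt false k (fun fs => ~ bad R (fun=> True) false fs) (if sigma then [:: c] else [::]).
Proof.
split=> [H|H s S _ _]; last by apply: qalt_impl H => fs Hb /bad_all.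
have HT : clique R (fun=> True) by move=> a b _ _; exact: linked.
have := H l (fun=> True) (fun a _ => lT a) HT; apply: qalt_impl => fs Hb.
by case=> [Hb'|[] //]; apply: Hb; left.
Qed.

End Complete.

(** * The reduction *)

Section Reduction.
Variables (M : machine) (n : nat) (poly_len poly_time : {poly nat}) (ob : bool).

Local Notation K := (tm_k M).+1.
Local Notation sym := (option (bool + tm_aux M))%type.
Local Notation reads := {ffun 'I_K -> sym}.

(* Propositional atoms at time [t] and column [p]; columns are positions
   relative to the head, which is always at column [head_col]. The atom [rd i q ss]
   says that the state is [q] and that the first [i] heads read [ss]. *)
Definition atom : finType := (('I_K * sym) + (tm_state M + 'I_K.+1 * tm_state M * reads))%type.
Definition cell i s : atom := inl (i, s).
Definition stt q : atom := inr (inl q).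
Definition rd i q ss : atom := inr (inr (i, q, ss)).

(** A halted machine repeats its configuration, so the output can be read at the fixed time
    [run_time]. *)
Definition delta (q : tm_state M) (ss : reads) : tm_state M * {ffun 'I_K -> sym * move} :=
  if tm_halted q then (q, [ffun i => (ss i, MoveN)]) else tm_trans q ss.

Section Instance.
Variable x : word.

Definition guess_len : nat := (poly_len.[size x])%R.

(* The input of the verifier, symbolically: 0 and 1 are bits, and [u + 2] is the
   [u]-th guessed bit. *)
Fixpoint sym_input (k : nat) : seq nat :=
  if k is i.+1 then
    flatten [seq [:: nth 0 (sym_input i) j; nth 0 (sym_input i) j]
              | j <- iota 0 (size (sym_input i))] ++
    ([:: 0; 1] ++ flatten [seq [:: (i * guess_len + a).+2] | a <- iota 0 guess_len])
  else flatten [seq [:: nat_of_bool (nth false x j)] | j <- iota 0 (size x)].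

Definition run_time : nat := (poly_time.[size (sym_input n)])%R.
Definition head_col : nat := run_time.+1.
(** No step rule concludes about the outermost columns, so each step makes one more column at either
    end unknown; with this width the head column is still determined at time [run_time]. *)
Definition ncols : nat := (head_col * 2).+1.
(** Two elements for each guessed bit [u]: [u * 2 + 1] asserts that it is 1 and [u * 2] that it is
    0. In [read_quads], the value of the valuation at [u * 2 + 1] decides which of them is
    derived. *)
Definition nguess : nat := n * guess_len * 2.
Definition atom_at (t p : nat) (c : atom) : nat :=
  nguess + ((t * ncols + p) * #|atom| + enum_rank c).
Definition natom : nat := nguess + run_time.+1 * ncols * #|atom|.

Definition rule_quad (a b c : nat) : seq nat := [:: 0; a; b; c].
(** A fact without premises: whatever the first valuation says, [a] is derived. *)
Definition given_quad (a : nat) : seq nat := [:: 3; a; a; a].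

(** The column, counted from the old head position, of the cell that is in column [p] after the
    move. *)
Definition source (mv : move) (p : nat) : nat :=
  match mv with MoveL => p.-1 | MoveN => p | MoveR => p.+1 end.

Definition cell_quads (t p : nat) (q : tm_state M) (ss : reads) (i : 'I_K) : seq (seq nat) :=
  let a := (delta q ss).2 i in
  if source a.2 p == head_col then
    [:: rule_quad (atom_at t head_col (rd ord_max q ss)) (atom_at t head_col (rd ord_max q ss)) (atom_at t.+1 p (cell i a.1))]
  else
    flatten [seq [:: rule_quad (atom_at t head_col (rd ord_max q ss)) (atom_at t (source a.2 p) (cell i s))
      (atom_at t.+1 p (cell i s))] | s <- enum {: sym}].

(** A transition depends on all the heads while a rule has two premises, so the atoms [rd i] collect
    the symbols read one head at a time. *)
Definition config_quads (t p : nat) (q : tm_state M) (ss : reads) : seq (seq nat) :=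
  [:: rule_quad (atom_at t head_col (stt q)) (atom_at t head_col (stt q)) (atom_at t head_col (rd ord0 q ss))] ++
  ([:: rule_quad (atom_at t head_col (rd ord_max q ss)) (atom_at t head_col (rd ord_max q ss))
      (atom_at t.+1 head_col (stt (delta q ss).1))] ++
  (flatten [seq [:: rule_quad (atom_at t head_col (rd (widen_ord (leqnSn K) i) q ss))
      (atom_at t head_col (cell i (ss i))) (atom_at t head_col (rd (lift ord0 i) q ss))] | i <- enum 'I_K] ++
  flatten [seq cell_quads t p q ss i | i <- enum 'I_K])).

Definition step_quads : seq (seq nat) :=
  flatten [seq flatten [seq flatten [seq config_quads t p.+1 c.1 c.2
      | c <- enum {: tm_state M * reads}]
    | p <- iota 0 (ncols - 2)] | t <- iota 0 run_time].

Definition init_cell (p : nat) (i : 'I_K) : seq (seq nat) :=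
  if (i == ord0) && ((head_col <= p) && (p - head_col < size (sym_input n))) then
    let s := nth 0 (sym_input n) (p - head_col) in
    if s <= 1 then
      if s == 1 then [:: given_quad (atom_at 0 p (cell i (Some (inl true))))]
      else [:: given_quad (atom_at 0 p (cell i (Some (inl false))))]
    else
      [:: rule_quad ((s - 2) * 2).+1 ((s - 2) * 2).+1 (atom_at 0 p (cell i (Some (inl true))))] ++
      [:: rule_quad ((s - 2) * 2) ((s - 2) * 2) (atom_at 0 p (cell i (Some (inl false))))]
  else [:: given_quad (atom_at 0 p (cell i None))].

Definition init_quads : seq (seq nat) :=
  [:: given_quad (atom_at 0 head_col (stt (tm_start M)))] ++
  flatten [seq flatten [seq init_cell p i | i <- enum 'I_K] | p <- iota 0 ncols].

Definition read_quads : seq (seq nat) :=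
  flatten [seq flatten [seq [:: [:: i + 3; ((i * guess_len + a) * 2).+1; (i * guess_len + a) * 2;
    (i * guess_len + a) * 2]] | a <- iota 0 guess_len] | i <- iota 0 n].

(** Goodness forbids the output [ob]. It will be [false] for Sigma and [true] for Pi, whose
    definition refers to a verifier for the complement. *)
Definition goal_atom : nat := atom_at run_time head_col (cell ord_max (Some (inl ob))).

(** These turn the whole domain into one clique without loops, to which [complete_good] applies. *)
Definition link_quads : seq (seq nat) :=
  flatten [seq flatten [seq [:: [:: 1; i; j; j]] | i <- iota 0 j] | j <- iota 0 natom].

Definition all_quads : seq (seq nat) :=
  [:: [:: 2; goal_atom; goal_atom; goal_atom]] ++
  (init_quads ++ (read_quads ++ (step_quads ++ link_quads))).

Definition reduction : word := wl (natom :: flatten all_quads).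

End Instance.

(** * The reduction is computable in polynomial time *)

Section Computable.

Definition wq (qs : seq (seq nat)) : word := wl (flatten qs).

Lemma PF_catq X (cs : seq (X -> word)) (ms ns : X -> seq (seq nat)) :
  PF cs (fun x => wq (ms x)) -> PF cs (fun x => wq (ns x)) ->
  PF cs (fun x => wq (ms x ++ ns x)).
Proof. by move=> Hm Hn; apply: PF_ext (PF_catl Hm Hn) => x; rewrite /wq flatten_cat. Qed.

Lemma flatten_flatten_map (I : Type) (G : I -> seq (seq nat)) (s : seq I) :
  flatten (flatten [seq G i | i <- s]) = flatten [seq flatten (G i) | i <- s].
Proof. by elim: s => //= i s IH; rewrite flatten_cat IH. Qed.

Lemma PF_rangeq X (cs : seq (X -> word)) (k : X -> nat) (G : X -> nat -> seq (seq nat)) :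
  PF cs (fun x => wn (k x)) -> PF (nat_ctx cs) (fun z => wq (G z.1 z.2)) ->
  PF cs (fun x => wq (flatten [seq G x i | i <- iota 0 (k x)])).
Proof.
move=> Hn HG; apply: PF_ext (PF_rangel Hn HG) => x.
by rewrite /wq flatten_flatten_map.
Qed.

Lemma PF_const_flattenq X (cs : seq (X -> word)) (C : Type) (l : seq C)
    (G : X -> C -> seq (seq nat)) :
  (forall c, PF cs (fun x => wq (G x c))) ->
  PF cs (fun x => wq (flatten [seq G x c | c <- l])).
Proof.
move=> H; apply: PF_ext (PF_const_flattenl l H) => x.
by rewrite /wq flatten_flatten_map.
Qed.

Lemma PF_ifq X (cs : seq (X -> word)) b (ms ns : X -> seq (seq nat)) :
  PF cs (fun x => wb (b x)) -> PF cs (fun x => wq (ms x)) -> PF cs (fun x => wq (ns x)) ->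
  PF cs (fun x => wq (if b x then ms x else ns x)).
Proof. by move=> Hb Hc Hd; apply: PF_ext (PF_if Hb Hc Hd) => x; case: ifP. Qed.

Lemma PF_quad X (cs : seq (X -> word)) k a b c :
  PF cs (fun x => wn (k x)) -> PF cs (fun x => wn (a x)) ->
  PF cs (fun x => wn (b x)) -> PF cs (fun x => wn (c x)) ->
  PF cs (fun x => wq [:: [:: k x; a x; b x; c x]]).
Proof.
move=> Hk Ha Hb Hc.
apply: (PF_ext (f := fun x => wl [:: k x; a x; b x; c x])) => //.
by do 4! [apply: PF_consl => //]; exact: (PF_const cs (wl [::])).
Qed.

#[local] Opaque nth size iota has all nums muln addn subn nseq
  horner flatten map odd eq_op leq wl wn wb.

Lemma PF_len X (cs : seq (X -> word)) u : PF cs u -> PF cs (fun z => wn (guess_len (u z))).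
Proof. by move=> Hu; rewrite /guess_len; pf. Qed.

Lemma PF_sym_input X (cs : seq (X -> word)) u k : PF cs u ->
  PF cs (fun z => wl (sym_input (u z) k)).
Proof.
move=> Hu; have Hl := PF_len Hu; elim: k => [|k IH] /=; last by pf.
apply: PF_rangel; first by pf.
apply: PF_consl; last exact: PF_const _ [::].
by apply: PF_wnif; pf.
Qed.

Lemma PF_time X (cs : seq (X -> word)) u : PF cs u -> PF cs (fun z => wn (run_time (u z))).
Proof. by move=> Hu; have Hs := PF_sym_input n Hu; rewrite /run_time; pf. Qed.

Lemma PF_ctr X (cs : seq (X -> word)) u : PF cs u -> PF cs (fun z => wn (head_col (u z))).
Proof. by move=> Hu; exact: PF_succ (PF_time Hu). Qed.

Lemma PF_width X (cs : seq (X -> word)) u : PF cs u -> PF cs (fun z => wn (ncols (u z))).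
Proof. by move=> Hu; have := PF_ctr Hu; rewrite /ncols => H; pf. Qed.

Lemma PF_nvars X (cs : seq (X -> word)) u : PF cs u -> PF cs (fun z => wn (nguess (u z))).
Proof. by move=> Hu; have := PF_len Hu; rewrite /nguess => H; pf. Qed.

Lemma PF_at X (cs : seq (X -> word)) u (t p : X -> nat) c : PF cs u ->
  PF cs (fun z => wn (t z)) -> PF cs (fun z => wn (p z)) ->
  PF cs (fun z => wn (atom_at (u z) (t z) (p z) c)).
Proof.
by move=> Hu Ht Hp; have H1 := PF_nvars Hu; have H2 := PF_width Hu; rewrite /atom_at; pf.
Qed.

Lemma PF_natoms X (cs : seq (X -> word)) u : PF cs u -> PF cs (fun z => wn (natom (u z))).
Proof.
move=> Hu; have H1 := PF_nvars Hu; have H2 := PF_width Hu; have H3 := PF_time Hu.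
by rewrite /natom; pf.
Qed.

Lemma PF_source X (cs : seq (X -> word)) mv (p : X -> nat) :
  PF cs (fun z => wn (p z)) -> PF cs (fun z => wn (source mv (p z))).
Proof. by case: mv => Hp //=; pf. Qed.

Ltac pfq := repeat (cbv beta; lazymatch goal with
  | |- PF _ (fun _ => wn (guess_len _)) => apply PF_len
  | |- PF _ (fun _ => wl (sym_input _ _)) => apply PF_sym_input
  | |- PF _ (fun _ => wn (run_time _)) => apply PF_time
  | |- PF _ (fun _ => wn (head_col _)) => apply PF_ctr
  | |- PF _ (fun _ => wn (ncols _)) => apply PF_width
  | |- PF _ (fun _ => wn (nguess _)) => apply PF_nvars
  | |- PF _ (fun _ => wn (atom_at _ _ _ _)) => apply PF_at
  | |- PF _ (fun _ => wn (natom _)) => apply PF_natoms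
  | |- PF _ (fun _ => wn (source _ _)) => apply PF_source
  | |- PF _ (fun _ => wq (_ ++ _)) => apply PF_catq
  | |- PF _ (fun _ => wq (if _ then _ else _)) => apply PF_ifq
  | |- PF _ (fun _ => wq (flatten (map _ (iota 0 _)))) => apply PF_rangeq; unfold nat_ctx
  | |- PF _ (fun _ => wq (flatten (map _ _))) => apply PF_const_flattenq; intro
  | |- PF _ (fun _ => wq [:: [:: _; _; _; _]]) => apply PF_quad
  | |- PF _ (fun _ => wq [:: rule_quad _ _ _]) => apply PF_quad
  | |- PF _ (fun _ => wq [:: given_quad _]) => apply PF_quad
  | |- _ => first [pf_op | pf_leaf]
  end).

Lemma PF_reduction : PF [:: id] reduction.
Proof.
have Hu : PF [:: id] (fun u : word => u) by exact: (@PF_var _ [:: id] 0 isT).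
apply: PF_consl; first exact: PF_natoms Hu.
rewrite -/(wq _); change (PF [:: id] (fun x => wq (all_quads x))).
rewrite /all_quads /init_quads /read_quads /step_quads /link_quads /goal_atom
  /init_cell /config_quads /cell_quads.
cbv zeta.
by pfq.
Qed.

End Computable.
End Reduction.

(** * The rules of the instance *)

Section Correct.
Variables (M : machine) (n : nat) (poly_len poly_time : {poly nat}) (ob : bool).
Variable x : word.

Local Notation K := (tm_k M).+1.
Local Notation sym := (option (bool + tm_aux M))%type.
Local Notation len := (guess_len poly_len x).
Local Notation sw := (sym_input poly_len x n).
Local Notation time := (run_time n poly_len poly_time x).
Local Notation ctr := (head_col n poly_len poly_time x).
Local Notation width := (ncols n poly_len poly_time x).
Local Notation nvars := (nguess n poly_len x).
Local Notation at_ := (@atom_at M n poly_len poly_time x).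
Local Notation natoms := (natom M n poly_len poly_time x).
Local Notation goal := (goal_atom M n poly_len poly_time ob x).
Local Notation quads := (all_quads M n poly_len poly_time ob x).

Local Notation init_cell := (@init_cell M n poly_len poly_time x).
Local Notation config_quads := (@config_quads M n poly_len poly_time x).

(** The facts sorted by kind, so that well-formedness and soundness become case analyses. *)
Inductive is_quad_of : seq nat -> Prop :=
| q_goal : is_quad_of [:: 2; goal; goal; goal]
| q_start : is_quad_of (given_quad (at_ 0 ctr (stt (tm_start M))))
| q_blank p i : p < width -> ~~ [&& i == ord0, ctr <= p & p - ctr < size sw] ->
    is_quad_of (given_quad (at_ 0 p (cell i None)))
| q_bit p b : ctr <= p < width -> p - ctr < size sw -> nth 0 sw (p - ctr) = nat_of_bool b ->
    is_quad_of (given_quad (at_ 0 p (cell ord0 (Some (inl b)))))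
| q_guess p u (b : bool) : ctr <= p < width -> p - ctr < size sw -> nth 0 sw (p - ctr) = u.+2 ->
    is_quad_of (rule_quad (u * 2 + b) (u * 2 + b) (at_ 0 p (cell ord0 (Some (inl b)))))
| q_read i a : i < n -> a < len ->
    is_quad_of [:: i + 3; ((i * len + a) * 2).+1; (i * len + a) * 2; (i * len + a) * 2]
| q_rd0 t q ss : t < time ->
    is_quad_of (rule_quad (at_ t ctr (stt q)) (at_ t ctr (stt q)) (at_ t ctr (rd ord0 q ss)))
| q_rdS t q ss i : t < time ->
    is_quad_of (rule_quad (at_ t ctr (rd (widen_ord (leqnSn K) i) q ss))
      (at_ t ctr (cell i (ss i))) (at_ t ctr (rd (lift ord0 i) q ss)))
| q_state t q ss : t < time ->
    is_quad_of (rule_quad (at_ t ctr (rd ord_max q ss)) (at_ t ctr (rd ord_max q ss))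
      (at_ t.+1 ctr (stt (delta q ss).1)))
| q_write t p q ss i : t < time -> 0 < p < width.-1 ->
    source ((delta q ss).2 i).2 p = ctr ->
    is_quad_of (rule_quad (at_ t ctr (rd ord_max q ss)) (at_ t ctr (rd ord_max q ss))
      (at_ t.+1 p (cell i ((delta q ss).2 i).1)))
| q_move t p q ss i s : t < time -> 0 < p < width.-1 ->
    source ((delta q ss).2 i).2 p <> ctr ->
    is_quad_of (rule_quad (at_ t ctr (rd ord_max q ss))
      (at_ t (source ((delta q ss).2 i).2 p) (cell i s)) (at_ t.+1 p (cell i s)))
| q_link i j : i < j < natoms -> is_quad_of [:: 1; i; j; j].

Lemma mem_range (T : eqType) (G : nat -> seq T) k y :
  reflect (exists2 i, i < k & y \in G i) (y \in flatten [seq G i | i <- iota 0 k]).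
Proof.
apply: (iffP flatten_mapP) => -[i]; first by rewrite mem_iota; exists i.
by move=> ik Hy; exists i; rewrite ?mem_iota.
Qed.

Lemma mem_enum_range (C : finType) (T : eqType) (G : C -> seq T) y :
  reflect (exists c, y \in G c) (y \in flatten [seq G c | c <- enum C]).
Proof.
apply: (iffP flatten_mapP) => [[c _ Hc]|[c Hc]]; first by exists c.
by exists c; rewrite ?mem_enum.
Qed.

Lemma nvars_ctr : 1 < width - 1.
Proof. by rewrite /width /ctr; lia. Qed.

Lemma init_cellP p i y : p < width -> y \in init_cell p i ->
  is_quad_of y.
Proof.
rewrite /init_cell => pw; case: ifP => [|/negbT H]; last first.
  by rewrite inE => /eqP ->; exact: q_blank.
case/andP => /eqP -> /andP[cp Hs]; set s := nth 0 _ _.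
have Hp : ctr <= p < width by rewrite cp.
case: ifP => [s1|/negbT s2].
  by case: ifP => [/eqP E|/eqP E]; rewrite inE => /eqP ->; apply: q_bit => //; rewrite -/s; lia.
have E : s = (s - 2).+2 by lia.
rewrite !inE => /orP[] /eqP ->.
  by rewrite -[_.+1]addn1; exact: (@q_guess p _ true Hp Hs E).
by rewrite -[_ * 2]addn0; exact: (@q_guess p _ false Hp Hs E).
Qed.

Lemma mem_quads y : (y \in quads) =
  [|| y == [:: 2; goal; goal; goal], y == given_quad (at_ 0 ctr (stt (tm_start M))),
    y \in flatten [seq flatten [seq init_cell p i | i <- enum 'I_K] | p <- iota 0 width],
    y \in read_quads n poly_len x, y \in step_quads M n poly_len poly_time x
    | y \in link_quads M n poly_len poly_time x].
Proof.
rewrite /quads mem_cat mem_seq1; congr (_ || _).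
rewrite mem_cat /init_quads mem_cat mem_seq1 -orbA; congr (_ || (_ || _)).
by rewrite mem_cat; congr (_ || _); rewrite mem_cat.
Qed.

Lemma quadsP y : y \in quads <-> is_quad_of y.
Proof.
rewrite mem_quads; split.
  case/orP => [/eqP ->|/orP[/eqP ->|/orP[/mem_range[p Hp /mem_enum_range[i]]|/or3P[]]]].
  - exact: q_goal.
  - exact: q_start.
  - exact: init_cellP.
  - case/mem_range => i Hi /mem_range[a Ha]; rewrite inE => /eqP ->.
    exact: q_read.
  - case/mem_range => t Ht /mem_range[p Hp /mem_enum_range [[q ss]]].
    rewrite /config_quads /= !inE => /or3P[/eqP ->|/eqP ->|].
    + exact: q_rd0.
    + exact: q_state.
    rewrite mem_cat => /orP[] /mem_enum_range[i].
      by rewrite inE => /eqP ->; exact: q_rdS.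
    have Hp' : 0 < p.+1 < width.-1 by lia.
    rewrite /cell_quads; case: eqP => E.
      by rewrite inE => /eqP ->; apply: q_write.
    by case/mem_enum_range => s; rewrite inE => /eqP ->; apply: q_move.
  - case/mem_range => j Hj /mem_range[i Hi]; rewrite inE => /eqP ->.
    by apply: q_link; rewrite Hi.
have step t p q ss z : t < time -> 0 < p < width.-1 ->
    z \in config_quads t p q ss ->
    z \in step_quads M n poly_len poly_time x.
  move=> Ht Hp Hz; apply/mem_range; exists t => //; apply/mem_range; exists p.-1.
    by lia.
  by apply/mem_enum_range; exists (q, ss); rewrite prednK //; case/andP: Hp.
(* Rules that do not mention the column are generated once for each column; column 1 is taken as the
   witness. *)
have p1 : 0 < 1 < width.-1 by have := nvars_ctr; lia.
have init p i z : p < width -> z \in init_cell p i ->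
    z \in flatten [seq flatten [seq init_cell p i | i <- enum 'I_K] | p <- iota 0 width].
  by move=> Hp Hz; apply/mem_range; exists p => //; apply/mem_enum_range; exists i.
case.
- by rewrite eqxx.
- by rewrite eqxx !orbT.
- move=> p i Hp H; rewrite (init p i) ?orbT //.
  by rewrite /init_cell (negbTE H) inE.
- move=> p b /andP[cp Hp] Hs E; rewrite (init p ord0) ?orbT //.
  by rewrite /init_cell eqxx cp Hs E; case: b {E} => /=; rewrite inE.
- move=> p u b /andP[cp Hp] Hs E; rewrite (init p ord0) ?orbT //.
  rewrite /init_cell eqxx cp Hs E /= !subSS subn0.
  by case: b; rewrite ?addn1 ?addn0 !inE eqxx ?orbT.
- move=> i a Hi Ha; do 3! (apply/orP; right); apply/orP; left.
  by apply/mem_range; exists i => //; apply/mem_range; exists a => //; rewrite inE.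
- move=> t q ss Ht; rewrite (step t 1 q ss) ?orbT //.
  by rewrite /config_quads inE eqxx.
- move=> t q ss i Ht; rewrite (step t 1 q ss) ?orbT //.
  rewrite /config_quads !mem_cat; apply/or4P; apply: Or43.
  by apply/mem_enum_range; exists i; rewrite inE.
- move=> t q ss Ht; rewrite (step t 1 q ss) ?orbT //.
  by rewrite /config_quads !mem_cat !inE eqxx ?orbT.
- move=> t p q ss i Ht Hp E; rewrite (step t p q ss) ?orbT //.
  rewrite /config_quads !mem_cat; apply/or4P; apply: Or44.
  by apply/mem_enum_range; exists i; rewrite /cell_quads E eqxx inE.
- move=> t p q ss i s Ht Hp E; rewrite (step t p q ss) ?orbT //.
  rewrite /config_quads !mem_cat; apply/or4P; apply: Or44.
  apply/mem_enum_range; exists i; rewrite /cell_quads; case: eqP => // _.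
  by apply/mem_enum_range; exists s; rewrite inE.
- move=> i j /andP[ij jm]; do 5! (apply/orP; right).
  by apply/mem_range; exists j => //; apply/mem_range; exists i => //; rewrite inE.
Qed.

Lemma at_lt t p c : t <= time -> p < width -> at_ t p c < natoms.
Proof.
move=> Ht Hp; rewrite /at_ /natoms ltn_add2l.
apply: (@leq_trans ((t * width + p).+1 * #|atom M|)).
  by rewrite mulSn addnC ltn_add2r; have := ltn_ord (enum_rank c).
rewrite leq_mul2r; apply/orP; right.
by apply: leq_trans (leq_mul (Ht : t < time.+1) (leqnn width)); rewrite mulSn addnC -addSn leq_add2r.
Qed.

Lemma nvars_lt : nvars < natoms.
Proof.
have : 0 < #|atom M| by apply/card_gt0P; exists (stt (tm_start M)).
by rewrite /natoms /width; case: (#|atom M|) => // g _; rewrite -addn1 leq_add2l mulSn mulnS.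
Qed.

Lemma ctr_width : ctr < width.
Proof. by rewrite /width; lia. Qed.

Lemma sym_input_lt k j : k <= n -> nth 0 (sym_input poly_len x k) j < (k * len).+2.
Proof.
elim: k j => [|k IH] j kn.
  case: (ltnP j (size (sym_input poly_len x 0))) => Hj; last by rewrite nth_default.
  have /mem_range[i _] := mem_nth 0 Hj; rewrite inE => /eqP ->.
  by case: (nth _ _ _).
case: (ltnP j (size (sym_input poly_len x k.+1))) => Hj; last by rewrite nth_default.
have := mem_nth 0 Hj; move: (nth 0 _ j) => s; rewrite /= mem_cat => /orP[/mem_range[i Hi]|].
  have := IH i (ltnW kn); rewrite mulSn; set s' := nth 0 _ i => H.
  by rewrite !inE => /orP[]/eqP ->; apply: leq_trans H _; rewrite !ltnS leq_addl.
rewrite !inE => /or3P[/eqP ->|/eqP ->|/mem_range[a Ha]] //.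
by rewrite inE => /eqP ->; rewrite mulSn !ltnS addnC ltn_add2r.
Qed.

(** Facts without premises use symbol 3, which belongs to the signature only when there is a
    valuation to read. *)
Lemma quads_valid : 0 < n -> all (valid_quad n natoms) quads.
Proof.
move=> n0; apply/allP => y /quadsP.
have cw := ctr_width; have nm := nvars_lt.
have var u b : u.+2 < (n * len).+2 -> u * 2 + nat_of_bool b < natoms.
  move=> Hu; apply: leq_trans _ (ltnW nm); rewrite /nvars.
  by case: b; lia.
have tm (t : nat) : t < time -> t <= time by exact: ltnW.
have vq k a b c : k < n.+3 -> a < natoms -> b < natoms -> c < natoms ->
    valid_quad n natoms [:: k; a; b; c].
  by move=> Hk Ha Hb Hc; rewrite /valid_quad /= Hk Ha Hb Hc.
case.
- by apply: vq => //; exact: at_lt.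
- by apply: vq => //; try exact: at_lt; lia.
- by move=> p i Hp _; apply: vq => //; try exact: at_lt; lia.
- by move=> p b /andP[_ Hp] _ _; apply: vq => //; try exact: at_lt; lia.
- move=> p u b /andP[_ Hp] Hs E.
  have Hu : u.+2 < (n * len).+2 by rewrite -E; exact: sym_input_lt.
  by apply: vq; [lia | exact: var | exact: var | exact: at_lt].
- move=> i a Hi Ha.
  have Hu : (i * len + a).+2 < (n * len).+2.
    rewrite !ltnS; apply: (@leq_trans (i.+1 * len)); last by rewrite leq_mul2r Hi orbT.
    by rewrite mulSn addnC ltn_add2r.
  have H1 := var _ true Hu; have H0 := var _ false Hu; rewrite ?addn0 ?addn1 in H1 H0.
  by apply: vq => //; lia.
- by move=> t q ss Ht; apply: vq => //; apply: at_lt => //; exact: tm.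
- by move=> t q ss i Ht; apply: vq => //; apply: at_lt => //; exact: tm.
- by move=> t q ss Ht; apply: vq => //; apply: at_lt => //; exact: tm.
- move=> t p q ss i Ht Hp E; apply: vq => //; apply: at_lt => //; try exact: tm.
  by lia.
- move=> t p q ss i s Ht Hp E; apply: vq => //; apply: at_lt => //; try exact: tm.
    by case: (_.2) => /=; lia.
  by lia.
- by move=> i j /andP[ij jm]; apply: vq => //; lia.
Qed.

End Correct.

(** * The run of the machine as the least model *)

Section Run.
Variables (M : machine) (n : nat) (poly_len poly_time : {poly nat}) (ob : bool).
Variable x : word.

Local Notation K := (tm_k M).+1.
Local Notation sym := (option (bool + tm_aux M))%type.
Local Notation len := (guess_len poly_len x).
Local Notation sw := (sym_input poly_len x n).
Local Notation time := (run_time n poly_len poly_time x).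
Local Notation ctr := (head_col n poly_len poly_time x).
Local Notation width := (ncols n poly_len poly_time x).
Local Notation nvars := (nguess n poly_len x).
Local Notation at_ := (@atom_at M n poly_len poly_time x).
Local Notation natoms := (natom M n poly_len poly_time x).
Local Notation goal := (goal_atom M n poly_len poly_time ob x).
Local Notation quads := (all_quads M n poly_len poly_time ob x).
Local Notation is_quad_of := (@is_quad_of M n poly_len poly_time ob x).

Variables (m : nat) (fs : seq ('I_m.+1 -> bool)).
Hypothesis natomsE : natoms = m.+1.
Hypothesis n0 : 0 < n.

Let F (i a : nat) : bool := val_of fs i (inord a).
Let guessed (u : nat) : bool := F (u %/ len) (u * 2).+1.

Definition guess_word (i : nat) (f : 'I_m.+1 -> bool) : word :=
  mkseq (fun a => f (inord ((i * len + a) * 2).+1)) len.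

Let guesses k : seq word := [seq guess_word i (val_of fs i) | i <- iota 0 k].
Let w : word := foldl pairing x (guesses n).

Let ev (s : nat) : bool := if s <= 1 then s == 1 else guessed (s - 2).

Let guessedE i a : a < len -> guessed (i * len + a) = F i ((i * len + a) * 2).+1.
Proof.
move=> Ha; rewrite /guessed divnMDl ?divn_small ?addn0 //.
exact: leq_ltn_trans Ha.
Qed.

Let sym_inputE k : foldl pairing x (guesses k) = map ev (sym_input poly_len x k).
Proof.
elim: k => [|k IH].
  rewrite /= flatten_map1 -map_comp -[LHS](mkseq_nth false).
  by apply: eq_map => i /=; case: (nth _ _ _).
rewrite /guesses -[k.+1]addn1 iotaD map_cat foldl_cat -/(guesses k) IH add0n addn1 /=.
rewrite map_cat /pairing; congr (_ ++ _).
  rewrite map_flatten -map_comp /=; congr flatten.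
  rewrite -[X in map _ X = _](mkseq_nth 0) /mkseq -map_comp -[RHS]map_comp.
  exact: eq_map.
rewrite flatten_map1 /= -map_comp; congr [:: _, _ & _].
apply/eq_in_map => a; rewrite mem_iota add0n => /andP[_ Ha].
by rewrite /= /ev /= subn2 /= guessedE.
Qed.

Let wE : w = map ev sw.
Proof. exact: sym_inputE. Qed.

Let conf t : config M := iter t (@tm_step M) (tm_init M w).

Let cont (tp : tape (tm_aux M)) (p : nat) : sym :=
  if p < ctr then nth None tp.1 (ctr - p.+1) else nth None tp.2 (p - ctr).

Let cont_read tp : cont tp ctr = tape_read tp.
Proof. by rewrite /cont ltnn subnn /tape_read nth0. Qed.

(** The local form of a step, as in [cell_quads]: relative to the head only one cell is rewritten.
    Column 0 is excluded because its left neighbour has no number. *)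
Let cont_act a tp p : 0 < p ->
  cont (tape_act a tp) p = if source a.2 p == ctr then a.1 else cont tp (source a.2 p).
Proof.
case: tp a => l r [s mv] p0; rewrite /cont /tape_act.
have nb (T : Type) (y : T) (u : seq T) i : nth y (behead u) i = nth y u i.+1.
  by case: u => [|? ?] //=; rewrite nth_nil.
have nh (T : Type) (y : T) (u : seq T) : head y u = nth y u 0 by case: u.
case: mv => /=.
- case: (ltngtP p ctr) => Hp.
  + rewrite (_ : (p.-1 == ctr) = false); last by lia.
    rewrite (_ : p.-1 < ctr); last by lia.
    by rewrite nb; congr nth; lia.
  + case: eqP => E.
      by rewrite (_ : p - ctr = 1); last by lia.
    rewrite (_ : (p.-1 < ctr) = false); last by lia.
    have -> : p - ctr = (p - ctr).-2.+2 by lia.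
    by rewrite /= nb; congr nth; lia.
  + rewrite Hp subnn /= (_ : (ctr.-1 == ctr) = false); last by rewrite /ctr; lia.
    rewrite (_ : ctr.-1 < ctr); last by rewrite /ctr.
    by rewrite nh; congr nth; rewrite /ctr; lia.
- case: (ltngtP p ctr) => Hp //; last by rewrite Hp subnn.
  by rewrite -(prednK (_ : 0 < p - ctr)) ?subn_gt0 //= nb.
- case: (ltngtP p.+1 ctr) => Hp.
  + by have -> : ctr - p.+1 = (ctr - p.+2).+1 by lia.
  + by rewrite nb; congr nth; lia.
  + by rewrite Hp subnn.
Qed.

Let ssof t : {ffun 'I_K -> sym} := [ffun i => tape_read ((conf t).2 i)].

Let conf_state t : (conf t.+1).1 = (delta (conf t).1 (ssof t)).1.
Proof.
rewrite /conf iterS -/(conf t) /tm_step /delta /ssof.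
case: ifP => // _; case: (tm_trans _ _) => //.
Qed.

Let conf_cont t i p : 0 < p ->
  let a := (delta (conf t).1 (ssof t)).2 i in
  cont ((conf t.+1).2 i) p =
  if source a.2 p == ctr then a.1 else cont ((conf t).2 i) (source a.2 p).
Proof.
move=> p0 a; rewrite /a /conf iterS -/(conf t) /tm_step /delta.
case: ifP => _.
  rewrite !ffunE /=; case: eqP => // ->; exact: cont_read.
rewrite /ssof; case: (tm_trans _ _) => q act /=.
by rewrite ffunE cont_act.
Qed.

Let cont_init i p : p < width ->
  cont ((tm_init M w).2 i) p =
  if [&& i == ord0, ctr <= p & p - ctr < size sw] then
    Some (inl (ev (nth 0 sw (p - ctr)))) else None.
Proof.
move=> Hp; rewrite /cont ffunE /=; case: ltnP => H; first by rewrite nth_nil andbF.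
case: (i == ord0) => /=; last by rewrite nth_nil.
rewrite /bits wE -map_comp; case: ltnP => H2; first by rewrite (nth_map 0).
by rewrite nth_default // size_map.
Qed.

Let hold (t p : nat) (c : atom M) : bool :=
  match c with
  | inl (i, s) => cont ((conf t).2 i) p == s
  | inr (inl q) => (conf t).1 == q
  | inr (inr (i, q, ss)) => ((conf t).1 == q) &&
      [forall j : 'I_K, (j < i) ==> (tape_read ((conf t).2 j) == ss j)]
  end.

(** The intended model, decoded from the numbers of the elements. It is closed under all the rules
    and therefore contains everything derivable. *)
Let tru (a : nat) : bool :=
  if a < nvars then guessed a./2 == odd a else
    let b := (a - nvars) %/ #|atom M| in
    hold (b %/ width) (b %% width)
      (nth (stt (tm_start M)) (enum (atom M)) ((a - nvars) %% #|atom M|)).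

Let tru_at t p c : p < width -> tru (at_ t p c) = hold t p c.
Proof.
move=> Hp; have Hc := ltn_ord (enum_rank c); have g0 : 0 < #|atom M| by exact: leq_ltn_trans Hc.
rewrite /tru /atom_at ltnNge leq_addr /= addKn.
rewrite modnMDl [in nth _ _ _]modn_small // divnMDl // [enum_rank c %/ _]divn_small // addn0.
rewrite divnMDl; last exact: leq_ltn_trans Hp.
rewrite [p %/ _]divn_small // addn0 modnMDl modn_small //.
by rewrite nth_enum_rank.
Qed.

Let tru_var u (b : bool) : u < n * len -> tru (u * 2 + b) = (guessed u == b).
Proof.
move=> Hu; rewrite /tru (_ : _ < _); last by rewrite /nguess; case: b; lia.
by rewrite addnC muln2 half_bit_double oddD odd_double addbF oddb.
Qed.

Let cw : ctr < width. Proof. exact: ctr_width. Qed.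

Let sound_quad y : is_quad_of y ->
  if y is [:: k; a; b; c] then
    [/\ k = 0 -> tru a -> tru b -> tru c, 3 <= k -> tru (if F (k - 3) a then a else b) &
        k = 2 -> a = goal]
  else False.
Proof.
have w1 : forall p, 0 < p < width.-1 -> p < width by move=> p; lia.
case.
- by split.
- by split=> // _; rewrite if_same tru_at //= /conf /=.
- move=> p i Hp Hi; split=> // _; rewrite if_same tru_at //=.
  by rewrite cont_init // (negbTE Hi).
- move=> p b /andP[cp Hp] Hs E; split=> // _; rewrite if_same tru_at //=.
  by rewrite cont_init // cp Hs E /= /ev; case: b {E}.
- move=> p u b /andP[cp Hp] Hs E; split=> // _.
  have Hu : u.+2 < (n * len).+2 by rewrite -E; exact: sym_input_lt.
  by rewrite tru_var // tru_at //= cont_init // cp Hs E /= /ev /= subn2 /= => /eqP ->.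
- move=> i a Hi Ha; split; [by rewrite addn3 | move=> _; rewrite addnK -guessedE // | by rewrite addn3].
    have Hu : i * len + a < n * len.
      apply: (@leq_trans (i.+1 * len)); last by rewrite leq_mul2r Hi orbT.
      by rewrite mulSn addnC ltn_add2r.
    case E: (guessed _).
      by rewrite -addn1 (tru_var true Hu) E.
    by rewrite -[_ * 2]addn0 (tru_var false Hu) E.
- move=> t q ss Ht; split=> // _ + _; rewrite !tru_at //= => -> /=.
  by apply/forallP.
- move=> t q ss i Ht; split=> // _; rewrite !tru_at //= => /andP[-> /forallP H] /=.
  rewrite cont_read => Hi; apply/forallP => j; apply/implyP.
  rewrite /bump /= add1n ltnS leq_eqVlt => /orP[/eqP/val_inj -> //|].
  exact/implyP/H.
- move=> t q ss Ht; split=> // _ + _; rewrite !tru_at //= => /andP[/eqP <- /forallP H].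
  rewrite conf_state; apply/eqP; congr (delta _ _).1; apply/ffunP => j; rewrite ffunE.
  by apply/eqP; have := H j; rewrite ltn_ord.
- move=> t p q ss i Ht Hp E; split=> // _ + _; rewrite !tru_at ?(w1 _ Hp) //= => /andP[/eqP Eq /forallP H].
  have Es : ssof t = ss by apply/ffunP => j; rewrite ffunE; apply/eqP; have := H j; rewrite ltn_ord.
  by rewrite conf_cont ?Eq ?Es ?E ?eqxx //; case/andP: Hp.
- move=> t p q ss i s Ht Hp E; split=> // _; rewrite !tru_at ?(w1 _ Hp) //=; last first.
    by case: (_.2); rewrite /=; lia.
  case/andP => [/eqP Eq /forallP H] Hc.
  have Es : ssof t = ss by apply/ffunP => j; rewrite ffunE; apply/eqP; have := H j; rewrite ltn_ord.
  rewrite conf_cont ?Eq ?Es //; last by case/andP: Hp.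
  by rewrite (introF eqP E).
- by split.
Qed.

Let R : tern 'I_m.+1 := quad_rel quads.
Let derives (a : nat) : Prop := der R (fun=> True) (val_of fs) (inord a).

Let sound (a : 'I_m.+1) : der R (fun=> True) (val_of fs) a -> tru a.
Proof.
elim=> {a} [i a b c /quadsP/sound_quad [_ H _] _ _ _|a b c /quadsP/sound_quad [H _ _] _ _ _ _ Ha _ Hb].
  move: H; rewrite addnK /F inord_val => H.
  by move: (H (leq_addl _ _)); case: ifP.
exact: H.
Qed.

Let valid k a b c : [:: k; a; b; c] \in quads ->
  R k (inord a) (inord b) (inord c) /\ [/\ a < m.+1, b < m.+1 & c < m.+1].
Proof.
move=> H; have /and3P[_ _] := allP (quads_valid M poly_len poly_time ob x n0) _ H.
rewrite natomsE /= andbT => /and3P[Ha Hb Hc]; split=> //.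
by rewrite /R /quad_rel /= !inordK.
Qed.

Let derives_rule a b c : is_quad_of (rule_quad a b c) -> derives a -> derives b -> derives c.
Proof. by move/quadsP/valid => [HR _]; exact: der_rule HR I I I. Qed.

Let derives_given a : is_quad_of (given_quad a) -> derives a.
Proof.
move/quadsP/valid => [HR _].
by have := @der_read _ R (fun=> True) (val_of fs) 0 _ _ _ HR I I I; rewrite if_same.
Qed.

Let derives_var u : u < n * len -> derives (u * 2 + guessed u).
Proof.
move=> Hu; have l0 : 0 < len by case: (len) Hu => //; rewrite muln0.
have Hq : is_quad_of [:: u %/ len + 3; (u * 2).+1; u * 2; u * 2].
  rewrite {2 3 4}(divn_eq u len); apply: q_read; last by rewrite ltn_mod.
  by rewrite ltn_divLR.
have [HR _] := valid (proj2 (quadsP _ _ _ _ _ _ _) Hq).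
have := @der_read _ R (fun=> True) (val_of fs) _ _ _ _ HR I I I; rewrite -/(F _ _) -/(guessed u) /derives.
by case: (guessed u); rewrite ?addn1 ?addn0.
Qed.

(** A light cone: a rule moves contents by at most one column, so at time [t] the columns at
    distance at least [t] from both ends are derived. *)
Let complete t : t <= time ->
  derives (at_ t ctr (stt (conf t).1)) /\
  forall i p, t <= p -> p + t < width -> derives (at_ t p (cell i (cont ((conf t).2 i) p))).
Proof.
elim: t => [_|t IH Ht].
  split; first exact/derives_given/q_start.
  move=> i p _; rewrite addn0 => Hp; rewrite cont_init //.
  case: ifP => [/and3P[/eqP -> cp Hs]|/negbT H]; last exact/derives_given/q_blank.
  have Hp' : ctr <= p < width by rewrite cp.
  case: (leqP (nth 0 sw (p - ctr)) 1) => E; rewrite /ev ?E.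
    by apply/derives_given/q_bit => //; case: (nth _ _ _) E => [|[]].
  rewrite leqNgt E /=; set u := nth _ _ _ - 2.
  have Eu : nth 0 sw (p - ctr) = u.+2 by rewrite /u; lia.
  have Hu : u.+2 < (n * len).+2 by rewrite -Eu; exact: sym_input_lt.
  have Hd := derives_var Hu.
  exact: (derives_rule (q_guess _ _ _ Hp' Hs Eu) Hd Hd).
have [IHq IHc] := IH (ltnW Ht).
have tc : t <= ctr by rewrite /head_col; lia.
have tw : ctr + t < width by rewrite /ncols /head_col; lia.
have Hrd (i : 'I_K.+1) : derives (at_ t ctr (rd i (conf t).1 (ssof t))).
  case: i; elim=> [|i IHi] Hi.
    have -> : Ordinal Hi = ord0 by apply: val_inj.
    exact: (derives_rule (q_rd0 _ _ _ Ht) IHq IHq).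
  have Hi' : i < K by [].
  have -> : Ordinal Hi = lift ord0 (Ordinal Hi') by apply: val_inj.
  apply: (derives_rule (q_rdS _ _ (ssof t) (Ordinal Hi') Ht)).
    have -> : widen_ord (leqnSn K) (Ordinal Hi') = Ordinal (ltnW Hi) by apply: val_inj.
    exact: IHi.
  by rewrite [ssof t _]ffunE -cont_read; exact: IHc.
split; first by rewrite conf_state; exact: (derives_rule (q_state _ _ _ Ht) (Hrd _) (Hrd _)).
move=> i p tp pw; have Hp : 0 < p < width.-1 by lia.
rewrite conf_cont; last by lia.
case: eqP => E; first exact: (derives_rule (q_write _ Ht Hp E) (Hrd _) (Hrd _)).
apply: (derives_rule (q_move _ _ Ht Hp E) (Hrd _)); apply: IHc.
  by case: (_.2) => /=; lia.
by case: (_.2) => /=; lia.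
Qed.

(** At the final time the derivable atoms at the head column are those of the run, and the run has
    only one symbol under the last head. *)
Lemma bad_quads (b : bool) :
  tm_computes_within M w [:: b] (poly_time.[size w])%R ->
  bad R (fun=> True) false fs <-> b = ob.
Proof.
have -> : (poly_time.[size w])%R = time by rewrite /run_time wE size_map.
rewrite /tm_computes_within -/(conf time) => -[_ [rest Hout _]].
have Hc : cont ((conf time).2 ord_max) ctr = Some (inl b).
  by rewrite /cont ltnn subnn Hout.
split.
  case=> [[a [b' [c [/quadsP/sound_quad [_ _ H] _ _ _ /sound Ha]]]]|[] //].
  move: Ha; rewrite (H erefl) tru_at //= Hc => /eqP [->] //.
move=> bo; have [_ H] := complete (leqnn time).
have := H ord_max ctr; rewrite Hc bo => Hg.
have [HR [Ha _ _]] := valid (proj2 (quadsP _ _ _ _ _ _ _) (q_goal M n poly_len poly_time ob x)).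
left; exists (inord goal), (inord goal), (inord goal); split=> //.
by apply: Hg; rewrite /ncols /head_col; lia.
Qed.

End Run.

(** * Hardness and completeness *)

Lemma alternation_neg ex k l V w :
  ~ alternation ex k l V w <-> alternation (~~ ex) k l (~` V)%classic w.
Proof.
elim: k ex w => //= k IH [] w /=; split.
- by move=> H y; apply/(IH false) => Hy; apply: H; exists y.
- by move=> H [y Hy]; have /(IH false) := H y.
- by move/existsNP => [y Hy]; exists y; apply/(IH true).
- by move=> [y /(IH true) Hy] H.
Qed.

(** Needed for words that encode no structure. Words of every length exist, so no universal
    quantifier holds vacuously. *)
Lemma altw_false ex k l ys : ~ altw ex k l (fun=> False) ys.
Proof.
elim: k ex ys => [|k IH] [] ys //=; first by case=> y; exact: IH.
by move/(_ [tuple of nseq l false]); exact: IH.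
Qed.

Section Hardness.
Variables (M : machine) (n : nat) (poly_len poly_time : {poly nat}) (ob : bool) (x : word).
Hypothesis n0 : 0 < n.
Local Notation natoms := (natom M n poly_len poly_time x).
Local Notation quads := (all_quads M n poly_len poly_time ob x).
Local Notation len := (guess_len poly_len x).
Variable m : nat.
Hypothesis natomsE : natoms = m.+1.
Let R : tern 'I_m.+1 := quad_rel quads.

Lemma quads_linked a b : a <> b -> R 1 a b b \/ R 1 b a a.
Proof.
move=> ab; case: (ltngtP a b) => H.
- by left; apply/quadsP; apply: q_link; rewrite H natomsE /=.
- by right; apply/quadsP; apply: q_link; rewrite H natomsE /=.
- by case: ab; exact: val_inj.
Qed.

Lemma quads_loopless a : ~ R 1 a a a.
Proof.
move/quadsP; move E : [:: 1; val a; val a; val a] => y Hy.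
case: Hy E => //; first by move=> i b _ _ [E _ _ _]; lia.
by move=> i j /andP[ij _] [Ei Ej _]; move: ij; rewrite -Ei -Ej ltnn.
Qed.

Let gw := @guess_word poly_len x m.

Let words (fs : seq ('I_m.+1 -> bool)) : seq word :=
  [seq gw i (val_of fs i) | i <- iota 0 (size fs)].

Let words_rcons fs f : words (rcons fs f) = rcons (words fs) (gw (size fs) f).
Proof.
rewrite /words size_rcons -[(size fs).+1]addn1 iotaD map_cat cats1 add0n.
congr rcons; last by rewrite /val_of nth_rcons ltnn eqxx.
 apply/eq_in_map => i; rewrite mem_iota add0n => /andP[_ Hi].
by rewrite /val_of nth_rcons Hi.
Qed.

Let gw_onto i (y : len.-tuple bool) : i < n -> exists f, gw i f = y.
Proof.
move=> Hi; exists (fun a : 'I_m.+1 => nth false y ((val a)./2 - i * len)).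
rewrite /gw /guess_word -[RHS](mkseq_nth false) size_tuple.
apply/eq_in_map => a; rewrite mem_iota add0n => /andP[_ Ha].
rewrite /= inordK; last first.
  rewrite -natomsE; apply: leq_trans (ltnW (nvars_lt M n poly_len poly_time x)).
  have : i * len + a < n * len.
    apply: (@leq_trans (i.+1 * len)); last by rewrite leq_mul2r Hi orbT.
    by rewrite mulSn addnC ltn_add2r.
  by rewrite /nguess; lia.
by congr nth; rewrite muln2 -[_.+1]/(true + _) half_bit_double addKn.
Qed.

Lemma qalt_altw ex (Phi : seq word -> Prop) Psi :
  (forall fs, size fs = n ->
     (Psi fs <-> Phi [seq gw i (val_of fs i) | i <- iota 0 n])) ->
  qalt ex n Psi [::] <-> altw ex n len Phi [::].
Proof.
move=> H; suff gen k fs b : size fs + k = n ->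
    (qalt b k Psi fs <-> altw b k len Phi (words fs)) by exact: (gen n [::]).
elim: k fs b => [|k IH] fs b Hk /=.
  by rewrite addn0 in Hk; rewrite H // /words Hk.
have Hi : size fs < n by lia.
have H' f c : qalt c k Psi (rcons fs f) <-> altw c k len Phi (rcons (words fs) (gw (size fs) f)).
  by rewrite -words_rcons; apply: IH; rewrite size_rcons addSnnS.
have tup f : exists y : len.-tuple bool, tval y = gw (size fs) f.
  by eexists; exact: (erefl (tval [tuple of gw (size fs) f])).
case: b.
  split=> [[f /H' Hf]|[y]]; first by have [y Ey] := tup f; exists y; rewrite Ey.
  by have [f <-] := gw_onto y Hi => /H' Hf; exists f.
split=> [Hf y|Hy f]; first by have [f <-] := gw_onto y Hi; apply/H'.
by apply/H'; have [y <-] := tup f.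
Qed.

Lemma reduction_correct ex (f : word -> bool) :
  (forall w, tm_computes_within M w [:: f w] (poly_time.[size w])%R) ->
  qalt ex n (fun fs => ~ bad R (fun=> True) false fs) [::] <->
  alternation ex n len [set w | f w <> ob]%classic x.
Proof.
move=> Hf; rewrite -[x in alternation _ _ _ _ x]/(foldl pairing x [::]) alternationE.
apply: qalt_altw => fs Hs.
by rewrite /R (@bad_quads M n poly_len poly_time ob x m fs natomsE n0 _ (Hf _)).
Qed.

End Hardness.

Lemma CSP_wl n T (D : structure (horn_sig n) T) (spec : forall m, tern 'I_m -> Prop) :
  (forall m (A : structure (horn_sig n) 'I_m.+1),
     (exists h, homomorphism A D h) <-> spec _ (tern_of A)) ->
  forall m qs, all (valid_quad n m.+1) qs ->
  CSP D (wl (m.+1 :: flatten qs)) <-> spec m.+1 (quad_rel qs).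
Proof.
move=> HD m qs Hq; rewrite (CSPP HD); split=> [[m' [qs' [Hq' /wl_inj [Em Ef] H]]]|H].
  by subst m'; rewrite (flatten_inj Hq Hq' Ef).
by exists m, qs.
Qed.

(** Shared by the three templates, which differ in [spec], in the use of cliques [lp] and in the
    guess [j] that selects them. *)
Section Complete.
Variables (n : nat) (ex lp : bool) (j : nat) (T : Type) (D : structure (horn_sig n) T).
Variable spec : forall m, tern 'I_m -> Prop.
Hypothesis jn : j < n.
Hypothesis specD : forall m (A : structure (horn_sig n) 'I_m.+1),
  (exists h, homomorphism A D h) <-> spec (tern_of A).
Hypothesis spec_verify : forall m qs, all (valid_quad n m.+1) qs ->
  let w := wl (m.+1 :: flatten qs) in
  alternation ex n (size w).*2 [set u | verify n lp j u]%classic w <->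
  spec (quad_rel qs : tern 'I_m.+1).
Hypothesis spec_complete : forall m (R : tern 'I_m.+1),
  (forall a b, a <> b -> R 1 a b b \/ R 1 b a a) -> (forall a, ~ R 1 a a a) ->
  spec R <-> qalt ex n (fun fs => ~ bad R (fun=> True) false fs) [::].

Let in_P_verify : in_P [set u | verify n lp j u]%classic.
Proof. by exists (verify n lp j) => //; exact: PF_polytime (PF_verify n lp j). Qed.

Let in_P_not_verify : in_P (~` [set u | verify n lp j u])%classic.
Proof.
exists (fun u => ~~ verify n lp j u).
  exact: PF_polytime (PF_neg (PF_verify n lp j)).
by move=> u; split=> /negP.
Qed.

Let CSP_alternation w : CSP D w <->
  alternation ex n (size w).*2 [set u | verify n lp j u]%classic w.
Proof.
case: (boolP (valid_check n w)) => [/valid_checkP [m [qs [Hq ->]]]|/negP Hv].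
  by rewrite (CSP_wl specD Hq) spec_verify.
split.
  by move/(CSPP specD) => [m [qs [Hq Hw _]]]; case: Hv; apply/valid_checkP; exists m, qs.
(* A word that encodes no structure is rejected whatever the guesses are. *)
rewrite -[w in alternation _ _ _ _ w]/(foldl pairing w [::]) alternationE.
move=> H; exfalso; apply: (@altw_false ex n (size w).*2 [::]).
apply: (proj1 (altw_ext _ _) H) => ys Hs _; split=> //.
by rewrite /= /verify base_foldl // => /andP[].
Qed.

Let double_poly (k : nat) : ((2%:R *: 'X : {poly nat}).[k])%R = k.*2.
Proof. by rewrite hornerZ hornerX -mul2n. Qed.

Let hard (L : language) (poly_len poly_time : {poly nat}) (M : machine) (f : word -> bool) :
  (forall w, tm_computes_within M w [:: f w] (poly_time.[size w])%R) ->
  (forall x, L x <-> alternation ex n (poly_len.[size x])%R [set w | f w <> ~~ ex]%classic x) ->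
  polytime_reducible L (CSP D).
Proof.
move=> Hf HL; have n0 : 0 < n by exact: leq_ltn_trans jn.
exists (reduction M n poly_len poly_time (~~ ex)).
  exact: PF_polytime (PF_reduction M n poly_len poly_time (~~ ex)).
move=> x; rewrite HL.
have [m Em] : exists m, natom M n poly_len poly_time x = m.+1.
  exists (natom M n poly_len poly_time x).-1; rewrite prednK //.
  exact: leq_ltn_trans (nvars_lt M n poly_len poly_time x).
have Hq := quads_valid M poly_len poly_time (~~ ex) x n0; rewrite Em in Hq.
rewrite /reduction Em (CSP_wl specD Hq) spec_complete.
- by rewrite -(reduction_correct (~~ ex) n0 Em ex Hf).
- exact: quads_linked Em.
- exact: quads_loopless.
Qed.

Lemma CSP_complete : complete_for (if ex then SigmaP n else PiP n) (CSP D).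
Proof.
move: CSP_alternation hard; case: ex => Halt Hhard; split.
- exists (2%:R *: 'X)%R, [set u | verify n lp j u]%classic; split=> // w.
  by rewrite double_poly.
- move=> L [q [V [[f [M [p Hf]] HV] HL]]]; apply: (Hhard _ q p M f) => // x.
  rewrite HL (_ : V = [set w | f w <> ~~ true]%classic) //.
  by apply/seteqP; split=> w /=; rewrite HV; case: (f w).
- exists (2%:R *: 'X)%R, (~` [set u | verify n lp j u])%classic; split=> // w.
  by rewrite double_poly -(alternation_neg false) -Halt.
- move=> L [q [V [[f [M [p Hf]] HV] HL]]]; apply: (Hhard _ q p M f) => // x.
  rewrite (_ : [set w | f w <> ~~ false]%classic = (~` V)%classic).
    by rewrite -(alternation_neg true) -HL; split=> [Lx /(_ Lx)|/contrapT].
  by apply/seteqP; split=> w /=; rewrite HV; case: (f w).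
Qed.

End Complete.

Theorem theorem1p5 (n : nat) (hn : 1 <= n) :
  (exists (sg : signature) (T : Type) (D : structure sg T),
     omega_categorical D /\ complete_for (SigmaP n) (CSP D)) /\
  (exists (sg : signature) (T : Type) (D : structure sg T),
     omega_categorical D /\ complete_for (PiP n) (CSP D)).
Proof.
split; last first.
  exists (horn_sig n), nat, (struct_of (limit false n n.+3)); split.
    exact: limit_categorical.
  apply: (@CSP_complete n false true 0 _ _
    (fun m R => exists c, cliques_good false n R c) hn).
  - by move=> m A; exact: limit_hom.
  - by move=> m qs Hq; exact: verify_pi.
  - move=> m R H1 H2.
    have E c := @complete_good _ R (enum 'I_m.+1) (mem_enum _) H1 H2 false n c.
    by split=> [[c /E]|H] //; exists (fun=> false); apply/E.
case: n hn => [|[|k]] // _.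
  exists (horn_sig 1), bool, (struct_of bool_rel); split; first exact: bool_categorical.
  apply: (@CSP_complete 1 true false 0 _ _
    (fun m R => exists f, ~ bad R (fun=> True) false [:: f])) => //.
  - by move=> m A; exact: bool_hom.
  - by move=> m qs Hq; exact: verify_np.
(* The colour is the first of the [k.+2] valuations, so [k.+1] alternating ones remain, while the
   signature reads all [k.+2]. *)
exists (horn_sig k.+2), nat, (struct_of (limit true k.+1 k.+2.+3)); split.
  exact: limit_categorical.
apply: (@CSP_complete k.+2 true true 1 _ _
  (fun m R => exists c, cliques_good true k.+1 R c)) => //.
- by move=> m A; exact: limit_hom.
- by move=> m qs Hq; exact: verify_sigma.
- move=> m R H1 H2.
  have E c := @complete_good _ R (enum 'I_m.+1) (mem_enum _) H1 H2 true k.+1 c.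
  by split=> -[c /E Hc]; exists c; [exact: Hc | exact: Hc].
Qed.
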